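(* Let $\{X, X_n, n\in\mathbb{N}\}$ be a sequence of i.i.d. real random variables with partial sums $S_n=\sum_{k=1}^n X_k$. Suppose that $\mathbb{E}[X]=0$, $\mathbb{E}[X^2]=\sigma^2>0$, and $\mathbb{E}[|X|^q]<\infty$ for some $q\in(2,3]$. (a) For any $p\in(0,2)$, $$\lim_{\epsilon\searrow 0}\epsilon^{(\gamma-1)(2-p)}\Big[\epsilon^{2-p}\lambda_1(\epsilon,p)-\frac{2\sigma^2}{2-p}\Big]=0,$$ where $\gamma=\frac{q-p}{2q-2-p}$ and $\lambda_1(\epsilon,p)=\sum_{n=1}^{\infty}\frac{1}{n^p}\mathbb{E}\big[|S_n|^p I\{|S_n|\geq \epsilon n\}\big]$. (b) For any $0<\delta\leq 1$, $$\lim_{\epsilon\searrow 0}\Big(\log\frac{1}{\epsilon}\Big)^{-\delta}\epsilon^{-2\delta}\Big[\epsilon^{2\delta}\lambda_2(\epsilon,\delta)-\frac{\sigma^{2\delta+2}}{\delta}\mathbb{E}\big[|N|^{2\delta+2}\big]\Big]=0,$$ where $\lambda_2(\epsilon,\delta)=\sum_{n=2}^{\infty}\frac{(\log n)^{\delta-1}}{n^2}\mathbb{E}\big[S_n^2 I\{|S_n|\geq\epsilon\sqrt{n\log n}\}\big]$.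
   Context: $N$ denotes a standard normal random variable, $I\{\cdot\}$ denotes the indicator of an event, $\log$ is the natural logarithm, $\sigma>0$, and $\mathbb{N}=\{1,2,\dots\}$. The quantities $\lambda_1(\epsilon,p)$ and $\lambda_2(\epsilon,\delta)$ are defined for $\epsilon>0$. *)

(* Defs.v *)
From HB Require Import structures.
From mathcomp Require Import all_boot all_order all_algebra.
From mathcomp Require Import all_classical all_reals all_analysis.

Set Implicit Arguments.
Unset Strict Implicit.
Unset Printing Implicit Defensive.
Import Order.TTheory GRing.Theory Num.Theory.
Import numFieldNormedType.Exports.
Local Open Scope classical_set_scope.
Local Open Scope ring_scope.

(* Laws are compared on measurable sets only: the set functions themselves
   may differ on non-measurable ones. *)
Definition same_law d (T : measurableType d) (R : realType)
    (P : probability T R) (X Y : {RV P >-> R}) : Prop :=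
  forall B : set R, measurable B -> distribution P X B = distribution P Y B.

Definition standard_normal d (T : measurableType d) (R : realType)
    (P : probability T R) (N : {RV P >-> R}) : Prop :=
  forall B : set R, measurable B -> distribution P N B = normal_prob 0 1 B.

(* Mutual independence: the product rule over every finite subfamily,
   enumerated without repetition. *)
Definition independent_RVs d (T : measurableType d) (R : realType)
    (P : probability T R) (X_ : nat -> {RV P >-> R}) : Prop :=
  forall (J : seq nat) (B : nat -> set R), uniq J ->
    (forall i, measurable (B i)) ->
    P (\bigcap_(i in [set` J]) (X_ i @^-1` B i)) =
    (\prod_(i <- J) P (X_ i @^-1` B i))%E.

(* The sequence X_1, X_2, ... is indexed from 0: [X_ k] stands for X_{k+1};
   [X] is the generic copy of the X_n. *)
Definition iid_copies d (T : measurableType d) (R : realType)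
    (P : probability T R) (X : {RV P >-> R}) (X_ : nat -> {RV P >-> R}) : Prop :=
  independent_RVs X_ /\ forall k, same_law (X_ k) X.

Definition partial_sum d (T : measurableType d) (R : realType)
    (P : probability T R) (X_ : nat -> {RV P >-> R}) (n : nat) (w : T) : R :=
  \sum_(k < n) X_ k w.

(* The series have nonnegative terms and are valued in [0, +oo]. *)
Definition lambda1 d (T : measurableType d) (R : realType)
    (P : probability T R) (X_ : nat -> {RV P >-> R}) (eps p : R) : \bar R :=
  let S := partial_sum X_ in
  (\sum_(1 <= n <oo) ((n%:R `^ p)^-1)%:E *
     'E_P[fun w =>
       (`|S n w| `^ p * \1_[set v | `|S n v| >= eps * n%:R] w)%R])%E.

Definition lambda2 d (T : measurableType d) (R : realType)
    (P : probability T R) (X_ : nat -> {RV P >-> R}) (eps delta : R) : \bar R :=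
  let S := partial_sum X_ in
  (\sum_(2 <= n <oo) (ln n%:R `^ (delta - 1) / n%:R ^+ 2)%:E *
     'E_P[fun w => (S n w ^+ 2 *
       \1_[set v | `|S n v| >= eps * Num.sqrt (n%:R * ln n%:R)] w)%R])%E.

(* Main.v *)
(** The error in both series is controlled by a nonuniform normal approximation
    with a suboptimal rate: with Z_n = S_n / (sigma sqrt n), a = q - 2 and any
    kappa < a / (1 + a),
      | P(|Z_n| >= u) - P(|N| >= u) | <= C n^(-kappa/2) min(1, u^(-q)).
    Stein's method with the leave-one-out sum needs only moments of order q and
    gives, for an L-Lipschitz test function with values in [0, 1], an error of
    order (L / sqrt n)^a; a ramp of well-chosen width then yields the uniform
    rate n^(-a / (2 (1 + a))). Truncation and an exponential Markov inequality
    supply tails of order n^(-a/2) u^(-q) + u^(-m) for every m, which upgrades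
    the uniform rate to the nonuniform one.

    Bounding u^(-q) by a discrete measure with mass 2^(-q j) at 2^j, the layer
    cake formula turns this into a comparison of E |Z_n|^p 1_{|Z_n| >= y} with
    its Gaussian counterpart. Summing over n first (Tonelli), the Gaussian
    series is E |N|^p A(|N| sigma / eps) and the error series is a weighted sum
    over j of A'(2^j sigma / eps), where A and A' are counting sums such as
    sum_{n <= x^2} n^(s-1) = x^(2s) / s + O(1).
    For (a), kappa can be taken above a b / (2 a + b), b = 2 - p, because
    p > 0. *)
Require Import Defs.
From HB Require Import structures.
From mathcomp Require Import all_boot all_order all_algebra.
From mathcomp Require Import all_classical all_reals all_analysis.
From mathcomp Require Import measurable_realfun zify ring lra.
Set Implicit Arguments.
Unset Strict Implicit.
Unset Printing Implicit Defensive.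
Import Order.TTheory GRing.Theory Num.Theory.
Import numFieldNormedType.Exports.
Local Open Scope classical_set_scope.
Local Open Scope ring_scope.

(** * Integrability and independence *)

Section integrability.
Context d (T : measurableType d) (R : realType) (mu : {measure set T -> \bar R}).
Implicit Types f g : T -> R.

(** The normalization in (a) is eps^(-rho) with rho = a b / (2 a + b), and the bracket is O(eps^b +
    eps^kappa), so it is enough that kappa exceed rho. Balancing the smoothing error against Stein's
    bound caps kappa at a / (1 + a), and rho < a / (1 + a) amounts to b < 2: this slack absorbs the
    suboptimal rate. In (b) the factor (log 1/eps)^(-delta) already tends to 0, so a bounded error
    of the series is enough, and any positive kappa gives it. A uniform rate would not do, because
    the layer cake formula integrates tail differences over an unbounded range of levels; the decay
    u^(-q) must beat the power p and also the growth x^tau of the error counting sum, whence the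
    condition p + tau < q. The dyadic measure keeps every interchange a Tonelli argument for
    nonnegative series and evaluates the error counting sums only at points where a power bound
    yields a geometric series. The normal variable enters through its tail function alone; its
    moments are derived from that. *)

Lemma dominated_integrable f g : measurable_fun setT f ->
  mu.-integrable setT (EFin \o g) -> (forall w, `|f w| <= g w) ->
  mu.-integrable setT (EFin \o f).
Proof.
move=> mf ig fg; apply: le_integrable ig => //; first exact/measurable_EFinP.
move=> w _ /=; rewrite lee_fin (le_trans (fg w))// ler_norm//.
Qed.

Lemma ge0_integrable_lty f : measurable_fun setT f -> (forall w, 0 <= f w) ->
  (\int[mu]_w (f w)%:E < +oo)%E -> mu.-integrable setT (EFin \o f).
Proof.
move=> mf f0 foo; apply/integrableP; split; first exact/measurable_EFinP.
by under eq_integral do rewrite /= ger0_norm//.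
Qed.

Lemma integrable_RintegralE f : mu.-integrable setT (EFin \o f) ->
  (\int[mu]_w (f w)%:E)%E = (\int[mu]_w f w)%:E.
Proof. by move=> fi; rewrite /Rintegral fineK//; exact: integrable_fin_num. Qed.

Lemma integrable_addR f g : mu.-integrable setT (EFin \o f) ->
  mu.-integrable setT (EFin \o g) -> mu.-integrable setT (EFin \o (fun w => f w + g w)).
Proof. by move=> fi gi; exact: (integrableD _ fi gi). Qed.

Lemma integrable_subR f g : mu.-integrable setT (EFin \o f) ->
  mu.-integrable setT (EFin \o g) -> mu.-integrable setT (EFin \o (fun w => f w - g w)).
Proof. by move=> fi gi; exact: (integrableB _ fi gi). Qed.

Lemma integrable_scaleR (k : R) f : mu.-integrable setT (EFin \o f) ->
  mu.-integrable setT (EFin \o (fun w => k * f w)).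
Proof. by move=> fi; exact: (integrableZl _ _ fi). Qed.

Lemma integrable_sumR I (s : seq I) (F : I -> T -> R) :
  (forall i, mu.-integrable setT (EFin \o F i)) ->
  mu.-integrable setT (EFin \o (fun w => \sum_(i <- s) F i w)).
Proof.
move=> Fi; have := @integrable_sum _ _ _ mu _ measurableT _ s xpredT (fun i => EFin \o F i).
move=> /(_ (fun i _ => Fi i)); apply: eq_integrable => // w _ /=.
by rewrite sumEFin.
Qed.

Lemma Rintegral_sumR I (s : seq I) (F : I -> T -> R) :
  (forall i, mu.-integrable setT (EFin \o F i)) ->
  \int[mu]_w (\sum_(i <- s) F i w) = \sum_(i <- s) \int[mu]_w F i w.
Proof.
move=> Fi; elim: s => [|i s IH].
  rewrite big_nil; under eq_Rintegral do rewrite big_nil.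
  by rewrite Rintegral_cst// mul0r.
rewrite big_cons -IH -RintegralD//; last exact: integrable_sumR.
by under eq_Rintegral do rewrite big_cons.
Qed.

Lemma le_normr_Rintegral_dom f g : mu.-integrable setT (EFin \o f) ->
  mu.-integrable setT (EFin \o g) -> (forall w, `|f w| <= g w) ->
  `|\int[mu]_w f w| <= \int[mu]_w g w.
Proof.
move=> fi gi fg; apply: (le_trans (le_normr_Rintegral _ fi)) => //.
by apply: le_Rintegral => //; exact: (integrable_abse fi).
Qed.

End integrability.

Section probability_integrability.
Context d (T : measurableType d) (R : realType) (P : probability T R).

Lemma bounded_integrable (f : T -> R) (M : R) : measurable_fun setT f ->
  (forall w, `|f w| <= M) -> P.-integrable setT (EFin \o f).
Proof.
move=> mf fM; apply: (dominated_integrable (g := cst M)) => //.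
exact: finite_measure_integrable_cst.
Qed.

Lemma Rintegral_cstT (r : R) : \int[P]_w r = r.
Proof. by rewrite Rintegral_cst//= probability_setT mulr1. Qed.

End probability_integrability.

(** * Independence and factorization of expectations *)

Section independence.
Context d (T : measurableType d) (R : realType) (P : probability T R).

Definition independent_pair (U V : T -> R) := forall A B : set R,
  measurable A -> measurable B ->
  P (U @^-1` A `&` V @^-1` B) = (P (U @^-1` A) * P (V @^-1` B))%E.

Section product_rule.
Variables U V : {mfun T >-> R}.
Hypothesis UV : independent_pair U V.

Let W (w : T) := (U w, V w).
Let mW : measurable_fun setT W. Proof. exact: measurable_fun_pair. Qed.
HB.instance Definition _ := isMeasurableFun.Build _ _ _ _ W mW.

Let joint_law (X : set (R * R)) : measurable X ->
  (distribution P U \x distribution P V)%E X = distribution P W X.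
Proof.
apply: product_measure_unique => A B mA mB.
by rewrite /= /pushforward -UV//; congr (P _); apply/seteqP; split => w //=.
Qed.

(** Independence is the product rule on rectangles, which determine the joint law; that law is thus
    a product measure and Tonelli factors the integral. *)
Lemma ge0_independent_integralM (g k : R -> R) :
  measurable_fun setT g -> measurable_fun setT k ->
  (forall x, 0 <= g x) -> (forall x, 0 <= k x) ->
  (\int[P]_w (g (U w) * k (V w))%:E =
   \int[P]_w (g (U w))%:E * \int[P]_w (k (V w))%:E)%E.
Proof.
move=> mg mk g0 k0.
have mgk : measurable_fun setT (fun z : R * R => (g z.1 * k z.2)%:E).
  by apply/measurable_EFinP/measurable_funM; exact: measurableT_comp.
have gk0 z : (0 <= (g z.1 * k z.2)%:E)%E by rewrite lee_fin mulr_ge0.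
transitivity (\int[distribution P W]_z (g z.1 * k z.2)%:E)%E.
  by rewrite ge0_integral_distribution.
transitivity (\int[(distribution P U \x distribution P V)%E]_z (g z.1 * k z.2)%:E)%E.
  by apply: eq_measure_integral => A mA _; exact/esym/joint_law.
rewrite fubini_tonelli1// /fubini_F.
pose K := (\int[distribution P V]_y (k y)%:E)%E.
have K0 : (0 <= K)%E by apply: integral_ge0 => y _; rewrite lee_fin.
have mg' : measurable_fun setT (EFin \o g) by exact/measurable_EFinP.
have mk' : measurable_fun setT (EFin \o k) by exact/measurable_EFinP.
transitivity (\int[distribution P U]_x ((g x)%:E * K))%E.
  by apply: eq_integral => x _; rewrite -ge0_integralZl// => *; rewrite lee_fin.
rewrite ge0_integralZr//; last by move=> y _; rewrite lee_fin.
by rewrite /K !ge0_integral_distribution// => y; rewrite lee_fin.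
Qed.

End product_rule.
End independence.

Section independent_Rintegral.
Context d (T : measurableType d) (R : realType) (P : probability T R).
Variables U V : {mfun T >-> R}.
Hypothesis UV : independent_pair P U V.

(** The nonnegative case for |g| and |k| yields the integrability of the product; the formula then
    follows by bilinearity from the positive and negative parts, written (|h| + h) / 2 and (|h| - h)
    / 2. *)
Lemma independent_RintegralM (g k : R -> R) :
  measurable_fun setT g -> measurable_fun setT k ->
  P.-integrable setT (EFin \o (g \o U)) -> P.-integrable setT (EFin \o (k \o V)) ->
  P.-integrable setT (EFin \o (fun w => g (U w) * k (V w))) /\
  \int[P]_w (g (U w) * k (V w)) = (\int[P]_w g (U w)) * (\int[P]_w k (V w)).
Proof.
move=> mg mk gi ki.
have ge0_case (g' k' : R -> R) :
    measurable_fun setT g' -> measurable_fun setT k' ->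
    (forall x, 0 <= g' x) -> (forall x, 0 <= k' x) ->
    P.-integrable setT (EFin \o (g' \o U)) -> P.-integrable setT (EFin \o (k' \o V)) ->
    P.-integrable setT (EFin \o (fun w => g' (U w) * k' (V w))) /\
    \int[P]_w (g' (U w) * k' (V w)) = (\int[P]_w g' (U w)) * (\int[P]_w k' (V w)).
  move=> mg' mk' g'0 k'0 g'i k'i.
  have E := ge0_independent_integralM UV mg' mk' g'0 k'0.
  rewrite (integrable_RintegralE g'i) (integrable_RintegralE k'i) -EFinM in E.
  split; last by rewrite {1}/Rintegral E.
  apply: ge0_integrable_lty => [|w|]; last by rewrite E ltry.
  - by apply: measurable_funM; exact: measurableT_comp.
  - by rewrite mulr_ge0.
have iM := ge0_case (fun x => `|g x|) (fun x => `|k x|).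
have mgk : measurable_fun setT (fun w => g (U w) * k (V w)).
  by apply: measurable_funM; exact: measurableT_comp.
have ab (h : R -> R) (W : {mfun T >-> R}) : measurable_fun setT h ->
    P.-integrable setT (EFin \o (h \o W)) ->
    P.-integrable setT (EFin \o (fun w => `|h (W w)|)).
  by move=> mh hi; exact: (integrable_abse hi).
have mN (h : R -> R) : measurable_fun setT h -> measurable_fun setT (fun x => `|h x|).
  by move=> mh; exact: measurableT_comp.
pose hp (h : R -> R) x := (`|h x| + h x) / 2.
pose hn (h : R -> R) x := (`|h x| - h x) / 2.
have hp0 h x : 0 <= hp h x by rewrite divr_ge0// -lerBlDr sub0r -normrN ler_norm.
have hn0 h x : 0 <= hn h x by rewrite divr_ge0// subr_ge0 ler_norm.
have hE h x : h x = hp h x - hn h x by rewrite /hp /hn; field.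
have mhp h : measurable_fun setT h -> measurable_fun setT (hp h).
  by move=> mh; apply: measurable_funM => //; apply: measurable_funD => //; exact: mN.
have mhn h : measurable_fun setT h -> measurable_fun setT (hn h).
  by move=> mh; apply: measurable_funM => //; apply: measurable_funB => //; exact: mN.
have dom (h h' : R -> R) (W : {mfun T >-> R}) : measurable_fun setT h -> measurable_fun setT h' ->
    (forall x, 0 <= h' x <= `|h x|) ->
    P.-integrable setT (EFin \o (h \o W)) -> P.-integrable setT (EFin \o (h' \o W)).
  move=> mh mh' hh' hi; apply: (dominated_integrable _ (ab _ _ mh hi)).
    exact: measurableT_comp.
  by move=> w /=; have /andP[h0 h1] := hh' (W w); rewrite ger0_norm.
have hpb h x : 0 <= hp h x <= `|h x|.
  by rewrite hp0/= /hp ler_pdivrMr// mulr_natr mulr2n lerD2l ler_norm.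
have hnb h x : 0 <= hn h x <= `|h x|.
  by rewrite hn0/= /hn ler_pdivrMr// mulr_natr mulr2n lerD2l -normrN ler_norm.
have gpi := dom _ _ U mg (mhp _ mg) (hpb g) gi.
have gni := dom _ _ U mg (mhn _ mg) (hnb g) gi.
have kpi := dom _ _ V mk (mhp _ mk) (hpb k) ki.
have kni := dom _ _ V mk (mhn _ mk) (hnb k) ki.
have [i1 e1] := ge0_case _ _ (mhp _ mg) (mhp _ mk) (hp0 g) (hp0 k) gpi kpi.
have [i2 e2] := ge0_case _ _ (mhp _ mg) (mhn _ mk) (hp0 g) (hn0 k) gpi kni.
have [i3 e3] := ge0_case _ _ (mhn _ mg) (mhp _ mk) (hn0 g) (hp0 k) gni kpi.
have [i4 e4] := ge0_case _ _ (mhn _ mg) (mhn _ mk) (hn0 g) (hn0 k) gni kni.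
split.
  apply: (dominated_integrable mgk (iM _ _ _ _ _ _).1) => //; try exact: mN.
  - exact: ab.
  - exact: ab.
  - by move=> w; rewrite normrM.
have E : (fun w => g (U w) * k (V w)) =
   (fun w => (hp g (U w) * hp k (V w) + hn g (U w) * hn k (V w)) -
    (hp g (U w) * hn k (V w) + hn g (U w) * hp k (V w))).
  by apply/funext => w; rewrite (hE g (U w)) (hE k (V w)); ring.
rewrite E RintegralB//; [|exact: integrable_addR..].
rewrite !RintegralD// e1 e2 e3 e4.
have -> : \int[P]_w g (U w) = \int[P]_w hp g (U w) - \int[P]_w hn g (U w).
  by rewrite -RintegralB//; apply: eq_Rintegral => w _; exact: hE.
have -> : \int[P]_w k (V w) = \int[P]_w hp k (V w) - \int[P]_w hn k (V w).
  by rewrite -RintegralB//; apply: eq_Rintegral => w _; exact: hE.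
ring.
Qed.

End independent_Rintegral.

Section independent_sums.
Context d (T : measurableType d) (R : realType) (P : probability T R).
Variable X_ : nat -> {RV P >-> R}.
Hypothesis indX : independent_RVs X_.

(** Uniqueness of measures: E -> P(E and X_i in B) and E -> P(E) P(X_i in B) are finite measures
    that agree on the cylinders over [J]. These form a pi-system, and the sum over [J] is measurable
    for the sigma-algebra they generate. *)
Lemma independent_sum (phi : R -> R) (J : seq nat) (i : nat) :
  measurable_fun setT phi -> uniq (i :: J) ->
  independent_pair P (fun w => \sum_(k <- J) phi (X_ k w)) (X_ i).
Proof.
move=> mphi uJ A B mA mB.
pose G := [set E : set T | exists2 C : nat -> set R, (forall k, measurable (C k)) &
  E = \bigcap_(k in [set` J]) (X_ k @^-1` C k)].
have mX k C : measurable C -> measurable (X_ k @^-1` C).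
  by move=> mC; rewrite -[X in measurable X]setTI; exact: measurable_funP.
have Gm : G `<=` measurable.
  by move=> E [C mC ->]; apply: bigcap_measurableType => k _; exact: mX.
have GT : G setT.
  exists (fun=> setT) => //; apply/seteqP; split => // w _ k _; exact: I.
have GI : setI_closed G.
  move=> _ _ [C mC ->] [D mD ->]; exists (fun k => C k `&` D k).
    by move=> k; exact: measurableI.
  rewrite -bigcapI; apply: eq_bigcapr => k _.
  by rewrite preimage_setI.
have mXB : measurable (X_ i @^-1` B) by exact: mX.
pose m1 := mrestr P mXB.
have PB0 : 0 <= fine (P (X_ i @^-1` B)) by exact: fine_ge0.
pose m2 := mscale (NngNum PB0) P.
have PBE : P (X_ i @^-1` B) = (fine (P (X_ i @^-1` B)))%:E.
  by rewrite fineK// fin_num_measure.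
have m2E E : m2 E = (P E * P (X_ i @^-1` B))%E by rewrite [in RHS]PBE muleC.
suff : m1 ((fun w => \sum_(k <- J) phi (X_ k w)) @^-1` A) =
       m2 ((fun w => \sum_(k <- J) phi (X_ k w)) @^-1` A).
  by rewrite m2E.
apply: (@g_sigma_algebra_measure_unique _ _ _ G Gm (fun=> setT)) => //.
- by rewrite bigcup_const//; exists 0%N.
- move=> _ [C mC ->].
  apply: (etrans _ (esym (m2E _))); rewrite /= /mrestr/=.
  (* Inserting [B] at the index [i], which is not in [J], turns the event into one cylinder over
     [i :: J], to which the product rule applies. *)
  pose C' k := if k == i then B else C k.
  have mC' k : measurable (C' k) by rewrite /C'; case: ifP.
  have iJ : i \notin J by move: uJ => /andP[].
  have uJ' : uniq J by move: uJ => /andP[].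
  have eJ : \bigcap_(k in [set` J]) (X_ k @^-1` C k) =
            \bigcap_(k in [set` J]) (X_ k @^-1` C' k).
    apply: eq_bigcapr => k /= kJ; rewrite /C'; case: eqP => // ki.
    by move: iJ; rewrite -ki kJ.
  have eiJ : \bigcap_(k in [set` J]) (X_ k @^-1` C k) `&` X_ i @^-1` B =
             \bigcap_(k in [set` i :: J]) (X_ k @^-1` C' k).
    rewrite eJ; apply/seteqP; split => w.
      move=> [wJ wB] k /=; rewrite inE => /predU1P[->|]; last exact: wJ.
      by rewrite /C' eqxx.
    move=> wJ; split; first by move=> k /= kJ; apply: wJ; rewrite /= inE kJ orbT.
    by have := wJ i; rewrite /C' eqxx; apply; rewrite /= inE eqxx.
  rewrite eiJ (indX uJ mC') big_cons eJ (indX uJ' mC') muleC.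
  by rewrite {2}/C' eqxx.
- move=> k; rewrite (le_lt_trans (_ : _ <= 1)%E) ?ltry//.
  by rewrite /m1 /mrestr/=; apply: probability_le1; rewrite setTI.
suff : measurable_fun (setT : set (g_sigma_algebraType G))
    (fun w => \sum_(k <- J) phi (X_ k w)).
  by move=> /(_ measurableT _ mA); rewrite setTI.
(* The induction runs over lists with entries in the fixed [J], because the cylinders only constrain
   coordinates in [J]. *)
have sub : forall L : seq nat, {subset L <= J} ->
    measurable_fun (setT : set (g_sigma_algebraType G))
      (fun w => \sum_(k <- L) phi (X_ k w)).
  elim=> [|k L IH] LJ.
    by under eq_fun do rewrite big_nil; exact: measurable_cst.
  under eq_fun do rewrite big_cons.
  apply: measurable_funD; last by apply: IH => l lL; apply: LJ; rewrite inE lL orbT.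
  apply: measurableT_comp => //= _ C mC; rewrite setTI.
  apply: sub_sigma_algebra; exists (fun l => if l == k then C else setT).
    by move=> l; case: ifP.
  apply/seteqP; split => w wC; last by have := wC k; rewrite eqxx; apply; apply: LJ; rewrite inE eqxx.
  by move=> l _ /=; case: eqP => // ->.
exact: sub.
Qed.

End independent_sums.

(** * Stein's equation for the Gaussian density *)

Section mean_value.
Context (R : realType).

(** Locating the intermediate point by its distance to x frees the mean value theorem from the order
    of x and y; this is the form that a Hölder bound on f' consumes. *)
Lemma MVT_total (f df : R -> R) : (forall x : R, is_derive x 1 f (df x)) ->
  forall x y, exists2 c, `|c - x| <= `|y - x| & f y - f x = df c * (y - x).
Proof.
move=> dF x y.
have cf a b : {within `[a, b], continuous f}.
  apply: derivable_within_continuous => z _; exact: ex_derive.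
have [xy|/ltW yx] := leP x y.
  have [c + ->] := MVT_segment xy (fun z _ => dF z) (cf x y).
  rewrite in_itv/= => /andP[xc cy]; exists c => //.
  by rewrite !ger0_norm ?subr_ge0// lerD2r.
have [c + E] := MVT_segment yx (fun z _ => dF z) (cf y x).
rewrite in_itv/= => /andP[yc cx]; exists c.
  by rewrite !ler0_norm ?subr_le0// lerN2 lerD2r.
by rewrite -opprB E -mulrN opprB.
Qed.

End mean_value.

Section gauss_density.
Context (R : realType).
Notation mu := (@lebesgue_measure R).

Definition phi : R -> R := normal_pdf 0 1.

Lemma phiE x : phi x = normal_peak 1 * expR (- (x ^+ 2 / 2)).
Proof.
by rewrite /phi normal_pdfE ?oner_neq0// /normal_fun subr0 expr1n mulNr.
Qed.

Lemma phi_gt0 x : 0 < phi x.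
Proof. by rewrite phiE mulr_gt0 ?expR_gt0// normal_peak_gt0// oner_neq0. Qed.

Lemma phi_ge0 x : 0 <= phi x. Proof. exact/ltW/phi_gt0. Qed.

Lemma phiN x : phi (- x) = phi x.
Proof. by rewrite !phiE sqrrN. Qed.

Lemma phi_le x y : `|x| <= `|y| -> phi y <= phi x.
Proof.
move=> xy; rewrite !phiE ler_wpM2l ?normal_peak_ge0// ler_expR lerN2.
by rewrite ler_pM2r// -[x ^+ 2]real_normK ?num_real// -[y ^+ 2]real_normK ?num_real// lerXn2r ?nnegrE.
Qed.

Lemma continuous_phi : continuous phi.
Proof. by apply: continuous_normal_pdf; rewrite oner_neq0. Qed.

Lemma measurable_phi : measurable_fun setT phi.
Proof. exact: continuous_measurable_fun continuous_phi. Qed.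

Lemma is_derive_phi (x : R) : is_derive x 1 phi (- x * phi x).
Proof.
have d1 : is_derive x 1 (fun y : R => - (2^-1 * y ^+ 2)) (- x).
  apply: (is_derive_eq (is_deriveN (is_deriveZ (2^-1 : R) (is_deriveX 2 (is_derive_id x (1 : R)))))).
  by rewrite /GRing.scale/= expr1 !mulr1; field.
have d2 := is_deriveZ (normal_peak 1 : R) (is_derive1_comp (is_derive_expR _) d1).
have -> : phi = normal_peak 1 \*: (expR \o (fun y : R => - (2^-1 * y ^+ 2))).
  by apply/funext => y; rewrite phiE mulrC/= [2^-1 * _]mulrC /GRing.scale/= mulrC.
by apply: (is_derive_eq d2); rewrite /GRing.scale/= -[_ *: _]/(_ * _); ring.
Qed.

Lemma cvg_phi : phi x @[x --> +oo%R] --> (0 : R).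
Proof.
have -> : phi = (fun x => normal_peak 1 * expR (- (x ^+ 2 / 2))).
  by apply/funext => y; exact: phiE.
rewrite -[X in _ --> X](mulr0 (normal_peak 1)); apply: cvgM; first exact: cvg_cst.
apply: (cvg_comp (fun x : R => x ^+ 2 / 2) (fun x : R => expR (- x))); last exact: cvgr_expR.
apply: gt0_cvgMly; first by rewrite invr_gt0.
exact: cvgr_expr2.
Qed.

Lemma integrable_phi : mu.-integrable setT (EFin \o phi).
Proof. exact: integrable_normal_pdf. Qed.

Lemma integral_phi : \int[mu]_x phi x = 1.
Proof. by rewrite /Rintegral integral_normal_pdf. Qed.

(** Since phi' = - x phi, a primitive of t phi(t) is - phi. *)
Lemma integral_id_phi (x : R) : 0 <= x ->
  (\int[mu]_(t in `[x, +oo[) (t * phi t)%:E = (phi x)%:E)%E.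
Proof.
move=> x0.
have c1 : continuous (fun t : R => t * phi t).
  by move=> t; apply: cvgM; [exact: cvg_id|exact: continuous_phi].
have dF (y : R) : is_derive y 1 (fun z => - phi z) (y * phi y).
  by apply: (is_derive_eq (is_deriveN (is_derive_phi y))); rewrite mulNr opprK.
rewrite (@ge0_continuous_FTC2y _ _ (fun y => - phi y) _ 0).
- by rewrite sub0e EFinN oppeK.
- by move=> t xt; rewrite mulr_ge0 ?phi_ge0// (le_trans x0).
- exact: continuous_subspaceT.
- by rewrite -oppr0; apply: cvgN; exact: cvg_phi.
- by move=> y _; exact: ex_derive.
- apply: cvg_at_right_filter; apply: cvgN; exact: continuous_phi.
- by move=> y _; rewrite derive1E derive_val.
Qed.

Lemma integrable_phiS (D : set R) : measurable D -> mu.-integrable D (EFin \o phi).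
Proof. by move=> mD; apply: integrableS integrable_phi. Qed.

(** On the domain x <= t, and t phi(t) integrates exactly to phi(x). *)
Lemma mills (x : R) : 0 < x -> \int[mu]_(t in `[x, +oo[) phi t <= phi x / x.
Proof.
move=> x0; rewrite ler_pdivlMr// mulrC -RintegralZl//; last exact: integrable_phiS.
have E : (\int[mu]_(t in `[x, +oo[) (t * phi t)%:E)%E = (phi x)%:E.
  by rewrite integral_id_phi// ltW.
have iE : mu.-integrable `[x, +oo[ (EFin \o (fun t => t * phi t)).
  apply/integrableP; split.
    by apply/measurable_EFinP/measurable_funTS/measurable_funM => //; exact: measurable_phi.
  under eq_integral => t.
    rewrite inE/= in_itv/= andbT => xt.
    rewrite /= ger0_norm; last by rewrite mulr_ge0 ?phi_ge0// (le_trans (ltW x0)).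
    over.
  by rewrite E ltry.
have -> : phi x = \int[mu]_(t in `[x, +oo[) (t * phi t) by rewrite /Rintegral E.
apply: le_Rintegral => //.
  by apply: (integrableZl _ x (integrable_phiS _)).
by move=> t; rewrite /= in_itv/= andbT => xt; rewrite ler_wpM2r ?phi_ge0.
Qed.

Lemma left_tail_phi (x : R) :
  \int[mu]_(t in `]-oo, - x]) phi t = \int[mu]_(t in `[x, +oo[) phi t.
Proof.
rewrite /Rintegral ge0_integration_by_substitutionNy.
- by congr fine; apply: eq_integral => t _; rewrite fctE phiN.
- by apply: continuous_subspaceT; exact: continuous_phi.
- by move=> t _; exact: phi_ge0.
Qed.

End gauss_density.

Section stein_equation.
Context (R : realType).
Notation mu := (@lebesgue_measure R).
Notation phi := (@phi R).
Variable h : R -> R.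
Hypothesis ch : continuous h.
Hypothesis h01 : forall x, 0 <= h x <= 1.

Definition gauss_mean : R := \int[mu]_x (h x * phi x).

Let c := gauss_mean.
Let k t := (h t - c) * phi t.

Let mh : measurable_fun setT h. Proof. exact: continuous_measurable_fun. Qed.

Let integrable_hphi : mu.-integrable setT (EFin \o (fun x => h x * phi x)).
Proof.
apply: le_integrable (integrable_phi R) => //.
  by apply/measurable_EFinP/measurable_funM => //; exact: measurable_phi.
move=> x _; rewrite lee_fin normrM (ger0_norm (phi_ge0 x)).
have /andP[h0 h1] := h01 x.
by rewrite ger0_norm// ler_piMl ?phi_ge0.
Qed.

Lemma gauss_mean_itv : 0 <= c <= 1.
Proof.
apply/andP; split.
  by apply: Rintegral_ge0 => x _; have /andP[h0 _] := h01 x; rewrite mulr_ge0 ?phi_ge0.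
rewrite -(integral_phi R); apply: le_Rintegral => //; first exact: integrable_phi.
by move=> x _; have /andP[_ h1] := h01 x; rewrite ler_piMl ?phi_ge0.
Qed.

Lemma gauss_mean_dist x : `|h x - c| <= 1.
Proof.
have /andP[h0 h1] := h01 x; have /andP[c0 c1] := gauss_mean_itv.
by rewrite ler_norml; apply/andP; split; lra.
Qed.

Let kE t : k t = h t * phi t - c * phi t. Proof. by rewrite /k mulrBl. Qed.

Let integrable_k D : measurable D -> mu.-integrable D (EFin \o k).
Proof.
move=> mD; apply: integrableS (subsetT D) _ => //.
have -> : k = (fun t => h t * phi t - c * phi t) by apply/funext => t; exact: kE.
by apply: integrable_subR => //; exact: integrable_scaleR (integrable_phi R).
Qed.

Let Rintegral_k : \int[mu]_x k x = 0.
Proof.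
under eq_Rintegral do rewrite kE.
rewrite RintegralB//; last exact: integrable_scaleR (integrable_phi R).
by rewrite RintegralZl//; [rewrite integral_phi mulr1 subrr|exact: integrable_phi].
Qed.

Let k_bound D : measurable D -> `|\int[mu]_(t in D) k t| <= \int[mu]_(t in D) phi t.
Proof.
move=> mD; apply: (le_trans (le_normr_Rintegral _ (integrable_k mD))) => //.
apply: le_Rintegral => //.
- exact: (integrable_abse (integrable_k mD)).
- exact: integrable_phiS.
- move=> x _; rewrite normrM (ger0_norm (phi_ge0 x)) ler_piMl ?phi_ge0//.
  exact: gauss_mean_dist.
Qed.

(** Multiplied by phi, the Stein equation f' - x f = h - c reads (f phi)' = k, so that f = H / phi
    is a solution. *)
Let H x := \int[mu]_(t in `]-oo, x]) k t.

Let is_derive_H (x : R) : is_derive x 1 H (k x).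
Proof.
have x1 : x < x + 1 by rewrite ltrDl.
have ck : {for x, continuous k}.
  apply: cvgM; last exact: continuous_phi.
  by apply: cvgB; [exact: ch|exact: cvg_cst].
have [dH EH] : derivable H x 1 /\ H^`()%classic x = k x.
  by apply: (@continuous_FTC1 R k -oo%O x (x + 1)) => //; [exact: integrable_k|exact: ltNyr].
by rewrite -EH derive1E; exact: derivableP.
Qed.

(** Centring h makes the integral of [k] vanish, so H can be estimated from whichever tail lies on
    the side of x. *)
Let HE x : H x = - \int[mu]_(t in `[x, +oo[) k t.
Proof.
have iT : mu.-integrable [set` `]-oo, +oo[] (EFin \o k) by exact: integrable_k.
have := @Rintegral_itvB R k -oo%O +oo%O x iT isT isT.
rewrite Rintegral_itv_obnd_cbnd; last exact: integrable_k.
by rewrite set_itvNyy Rintegral_k sub0r => <-; rewrite opprK.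
Qed.

(** The summand 1 / phi(1) serves |x| < 1, where |H| <= 1 and phi(x) >= phi(1); the summand 1 serves
    |x| >= 1, where Mills' inequality gives |H| <= phi(x). *)
Definition stein_bound : R := 1 + (phi 1)^-1.

Lemma stein_bound_ge1 : 1 <= stein_bound.
Proof. by rewrite lerDl invr_ge0 phi_ge0. Qed.

Let H_bound (x : R) : `|x| * `|H x| <= phi x /\ `|H x| <= stein_bound * phi x.
Proof.
have Hx : `|H x| <= \int[mu]_(t in `[`|x|, +oo[) phi t.
  have [x0|x0] := leP 0 x.
    by rewrite HE normrN (ger0_norm x0); exact: k_bound.
  by rewrite (ltr0_norm x0) -left_tail_phi opprK; exact: k_bound.
have phix : phi `|x| = phi x by case: (ger0P x) => // _; rewrite phiN.
have Hm : `|x| * `|H x| <= phi x.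
  have [->|x0] := eqVneq x 0; first by rewrite normr0 mul0r phi_ge0.
  have xn0 : 0 < `|x| by rewrite normr_gt0.
  by have := le_trans Hx (mills xn0); rewrite phix ler_pdivlMr// mulrC.
split => //; have [x1|x1] := leP 1 `|x|.
  rewrite (le_trans (y := `|x| * `|H x|))//; first by rewrite ler_peMl.
  by rewrite (le_trans Hm)// ler_peMl ?phi_ge0//; exact: stein_bound_ge1.
have tail : \int[mu]_(t in `[`|x|, +oo[) phi t <= 1.
  rewrite -(integral_phi R) Rintegral_mkcond; apply: le_Rintegral => //.
  - by rewrite -restrict_EFin; apply/(integrable_mkcond _ _).1 => //; exact: integrable_phiS.
  - exact: integrable_phi.
  - by move=> t _; rewrite patchE; case: ifP => // _; exact: phi_ge0.
rewrite (le_trans Hx)// (le_trans tail)// mulrDl mul1r.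
rewrite ler_wpDl ?phi_ge0// ler_pdivlMl ?phi_gt0// mulr1.
by apply: phi_le; rewrite normr1 ltW.
Qed.

(** The bound on x f is what bounds f' = x f + h - c by 2 through h itself, without a derivative of
    h. *)
Lemma stein_solution : exists f : R -> R,
  [/\ forall x : R, is_derive x 1 f (x * f x + (h x - c)),
      forall x, `|f x| <= stein_bound & forall x, `|x * f x| <= 1].
Proof.
exists (fun x => H x / phi x); split => x.
- have dV := is_deriveV (lt0r_neq0 (phi_gt0 x)) (is_derive_phi x).
  apply: (is_derive_eq (is_deriveM (is_derive_H x) dV)).
  rewrite /GRing.scale/= /k.
  have p0 := lt0r_neq0 (phi_gt0 x).
  by field.
- by rewrite normrM normfV (ger0_norm (phi_ge0 x)) ler_pdivrMr ?phi_gt0//; have [] := H_bound x.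
- rewrite mulrA normrM normfV (ger0_norm (phi_ge0 x)) ler_pdivrMr ?phi_gt0// mul1r normrM.
  by have [] := H_bound x.
Qed.

End stein_equation.

Lemma le_powRl (R : realType) (r x y : R) : 0 <= r -> 0 <= x -> x <= y ->
  x `^ r <= y `^ r.
Proof. by move=> r0 x0 xy; apply: ge0_ler_powR => //; rewrite nnegrE// (le_trans x0). Qed.

(** * Hölder regularity of the derivative of Stein's solution *)

Section stein_smoothness.
Context (R : realType).
Variables (f h : R -> R) (c B L a : R).
Let df (x : R) := x * f x + (h x - c).
Hypothesis dF : forall x : R, is_derive x 1 f (df x).
Hypothesis fB : forall x, `|f x| <= B.
Hypothesis xf1 : forall x, `|x * f x| <= 1.
Hypothesis h_c : forall x, `|h x - c| <= 1.
Hypothesis hL : forall x y, `|h x - h y| <= L * `|x - y|.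
Hypothesis L1 : 1 <= L.
Hypothesis B1 : 1 <= B.
Hypothesis a01 : 0 < a <= 1.

Lemma stein_deriv_bound x : `|df x| <= 2.
Proof. by rewrite (le_trans (ler_normD _ _))// -[2]/(1 + 1) lerD. Qed.

(* The increment of f' is at most min(4, |z' - z| (2|z| + B + L)), and
   min(4, w) <= 4 w^a. *)
Lemma stein_deriv_holder z z' :
  `|df z' - df z| <= 4 * `|z' - z| `^ a * L `^ a * (2 * `|z| + B + 1).
Proof.
have /andP[a0 a1] := a01; have L1' := L1; have B1' := B1.
have b4 : `|df z' - df z| <= 4.
  rewrite (le_trans (ler_normB _ _))//.
  by have := stein_deriv_bound z; have := stein_deriv_bound z'; lra.
pose w := `|z' - z| * (2 * `|z| + B + L).
have bw : `|df z' - df z| <= w.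
  have [e _ He] := MVT_total dF z z'.
  have -> : df z' - df z = z * (f z' - f z) + (z' - z) * f z' + (h z' - h z).
    by rewrite /df; ring.
  rewrite (le_trans (ler_normD _ _))// (le_trans (lerD (ler_normD _ _) (lexx _)))//.
  rewrite !normrM He normrM.
  have -> : w = `|z| * (2 * `|z' - z|) + `|z' - z| * B + L * `|z' - z| by rewrite /w; ring.
  rewrite !lerD//; last by rewrite ler_wpM2l.
  by rewrite ler_wpM2l// ler_wpM2r// stein_deriv_bound.
have BL0 : 0 <= 2 * `|z| + B + L by have z0 : 0 <= `|z| by []; lra.
have w0 : 0 <= w by rewrite mulr_ge0.
have wa : `|df z' - df z| <= 4 * w `^ a.
  have [w1|w1] := leP 1 w.
    rewrite (le_trans b4)// ler_peMr//.
    by have := le_powRl (ltW a0) ler01 w1; rewrite powR1.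
  rewrite (le_trans bw)//.
  have [->|wn0] := eqVneq w 0; first by rewrite mulr_ge0// powR_ge0.
  have wp : 0 < w by rewrite lt_def wn0.
  have : w <= w `^ a by apply: ger1_powR => //; rewrite wp ltW.
  by have := powR_ge0 w a; lra.
rewrite (le_trans wa)// -!mulrA ler_pM2l// /w powRM//.
rewrite ler_wpM2l ?powR_ge0//.
have z0 : 0 <= `|z| by [].
(* As L >= 1, 2|z| + B + L <= L (2|z| + B + 1); and for a <= 1 the power a of a number at least 1
   does not exceed that number. *)
have W1 : 1 <= 2 * `|z| + B + 1 by lra.
rewrite (le_trans (y := (L * (2 * `|z| + B + 1)) `^ a))//.
  apply: le_powRl => //; first exact: ltW.
  have : 0 <= (L - 1) * (2 * `|z| + B) by rewrite mulr_ge0//; lra.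
  by lra.
rewrite powRM; [|lra|lra].
by rewrite ler_wpM2l ?powR_ge0// ler1_powR.
Qed.

(** By the mean value theorem the remainder is t (f'(e) - f'(z)) with e within |t| of z. *)
Lemma stein_taylor z t : `|f (z + t) - f z - t * df z| <=
  4 * `|t| `^ (1 + a) * L `^ a * (2 * `|z| + B + 1).
Proof.
have /andP[a0 a1] := a01; have L1' := L1; have B1' := B1.
have [e + ->] := MVT_total dF z (z + t).
rewrite [z + t - z]addrAC subrr add0r => et.
rewrite [df e * t]mulrC -mulrBr normrM.
have [->|t0] := eqVneq t 0.
  by rewrite normr0 mul0r !mulr_ge0// ?powR_ge0//; have z0 : 0 <= `|z| by []; lra.
rewrite powRD; last by rewrite normr_eq0 t0 implybT.
rewrite powRr1// -!mulrA mulrCA ler_pM2l ?normr_gt0//.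
rewrite (le_trans (stein_deriv_holder z e))// -!mulrA ler_pM2l//.
rewrite ler_wpM2r//.
  by rewrite mulr_ge0 ?powR_ge0//; have z0 : 0 <= `|z| by []; lra.
by apply: le_powRl => //; exact: ltW.
Qed.

End stein_smoothness.

(** * Uniform normal approximation of sums *)

Lemma normr_le1Dsqr (R : realType) (x : R) : `|x| <= 1 + x ^+ 2.
Proof.
have : 0 <= (`|x| - 1) ^+ 2 by exact: sqr_ge0.
rewrite sqrrB1 real_normK ?num_real//.
by have := sqr_ge0 x; have := normr_ge0 x; lra.
Qed.

(** * Moments of sums and the leave-one-out estimate *)

Section partial_sums.
Context d (T : measurableType d) (R : realType) (P : probability T R).
Variable Y : nat -> {RV P >-> R}.

Definition psum (J : seq nat) (w : T) : R := \sum_(k <- J) Y k w.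

Lemma measurable_psum J : measurable_fun setT (psum J).
Proof. by apply: measurable_sum => k; exact: measurable_funP. Qed.

HB.instance Definition _ J := isMeasurableFun.Build _ _ _ _ (psum J) (measurable_psum J).

Definition standardized (q M : R) := forall k,
  [/\ P.-integrable setT (EFin \o Y k), \int[P]_w Y k w = 0,
      P.-integrable setT (EFin \o (fun w => Y k w ^+ 2)), \int[P]_w (Y k w ^+ 2) = 1 &
      P.-integrable setT (EFin \o (fun w => `|Y k w| `^ q)) /\
      \int[P]_w (`|Y k w| `^ q) <= M].

Variables q M : R.
Hypothesis indY : independent_RVs Y.
Hypothesis stdY : standardized q M.

Lemma independent_psum i J : uniq (i :: J) -> independent_pair P (psum J) (Y i).
Proof. by move=> uJ; exact: (independent_sum indY (@measurable_id _ _ setT) uJ). Qed.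

Lemma psum_moments J : uniq J ->
  [/\ P.-integrable setT (EFin \o psum J), \int[P]_w psum J w = 0,
      P.-integrable setT (EFin \o (fun w => psum J w ^+ 2)) &
      \int[P]_w (psum J w ^+ 2) = (size J)%:R].
Proof.
elim: J => [_|i J IH /= uJ].
  have E0 : psum [::] = cst 0 by apply/funext => w; rewrite /psum big_nil.
  rewrite E0; split => /=.
  - exact: integrable0.
  - by rewrite Rintegral_cstT.
  - apply: (@bounded_integrable _ _ _ P _ 0) => // w; by rewrite expr0n/= normr0.
  - by under eq_Rintegral do rewrite /= expr0n/=; rewrite Rintegral_cstT.
have /andP[_ uJ'] := uJ.
have [i1 e1 i2 e2] := IH uJ'.
have [j1 f1 j2 f2 _] := stdY i.
have [ip ep] := independent_RintegralM (independent_psum uJ) (@measurable_id _ _ setT)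
  (@measurable_id _ _ setT) i1 j1.
have E : psum (i :: J) = (fun w => psum J w + Y i w).
  by apply/funext => w; rewrite /psum big_cons addrC.
have E2 : (fun w => psum (i :: J) w ^+ 2) =
    (fun w => (psum J w ^+ 2 + Y i w ^+ 2) + 2 * (psum J w * Y i w)).
  by apply/funext => w; rewrite E; ring.
rewrite E2 E; split.
- exact: integrable_addR.
- by rewrite RintegralD// e1 f1 addr0.
- by apply: integrable_addR; [exact: integrable_addR|exact: integrable_scaleR].
- rewrite RintegralD//; last 2 first.
  - exact: integrable_addR.
  - exact: integrable_scaleR.
  by rewrite RintegralD// RintegralZl// ep e1 mul0r mulr0 addr0 e2 f2 natr1.
Qed.

Variables (f h : R -> R) (c B L : R).
Let df (x : R) := x * f x + (h x - c).
Hypothesis ch : continuous h.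
Hypothesis dF : forall x : R, is_derive x 1 f (df x).
Hypothesis fB : forall x, `|f x| <= B.
Hypothesis xf1 : forall x, `|x * f x| <= 1.
Hypothesis h_c : forall x, `|h x - c| <= 1.
Hypothesis hL : forall x y, `|h x - h y| <= L * `|x - y|.
Hypothesis L1 : 1 <= L.
Hypothesis B1 : 1 <= B.
Hypothesis q23 : 2 < q <= 3.
Let a := q - 2.

Let mf : measurable_fun setT f.
Proof.
apply: continuous_measurable_fun => x; apply: differentiable_continuous.
by apply/derivable1_diffP; exact: ex_derive.
Qed.

Let mdf : measurable_fun setT df.
Proof.
apply: measurable_funD; first exact: measurable_funM.
by apply: measurable_funB => //; exact: continuous_measurable_fun.
Qed.

(** Expand f around s U, where the sum U over [J] is independent of Y_i. The term s Y_i f(s U) has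
    mean 0 and (s Y_i)^2 f'(s U) has mean s^2 E f'(s U). The Taylor remainder costs E |s Y_i|^q, and
    replacing f'(s U) by f' at the full sum costs s^2 E |s Y_i|^a: both are of order s^q. *)
Lemma stein_leave_one_out i J (s : R) : uniq (i :: J) -> 0 < s ->
  s ^+ 2 * (size (i :: J))%:R = 1 ->
  `| \int[P]_w (s * Y i w * f (s * psum (i :: J) w))
     - s ^+ 2 * \int[P]_w df (s * psum (i :: J) w) |
  <= 4 * L `^ a * (B + 5) * (M + 2) * s `^ q.
Proof.
move=> uJ s0 s1; have L1' := L1; have B1' := B1.
have /andP[q2 q3] := q23.
have a01 : 0 < a <= 1 by rewrite /a; apply/andP; split; lra.
have /andP[a0 a1] := a01.
have E : psum (i :: J) = (fun w => psum J w + Y i w).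
  by apply/funext => w; rewrite /psum big_cons addrC.
have [u1 ue1 u2 ue2] := @psum_moments J (proj2 (andP uJ)).
have [v1 ve1 v2 ve2 [vq veq]] := stdY i.
have ind := independent_psum uJ.
pose U := psum J; pose V := Y i.
have mU : measurable_fun setT (fun w => s * U w).
  by apply: measurable_funM => //; exact: measurable_psum.
have mZ : measurable_fun setT (fun w => s * psum (i :: J) w).
  by apply: measurable_funM => //; exact: measurable_psum.
have ms (g : R -> R) : measurable_fun setT g -> measurable_fun setT (fun x => g (s * x)).
  by move=> mg; apply: measurableT_comp => //; exact: measurable_funM.
have dfb x : `|df x| <= 2 by exact: stein_deriv_bound.
pose W u := 2 * `|s * u| + B + 1.
have mW : measurable_fun setT W.
  apply: measurable_funD => //; apply: measurable_funD => //; apply: measurable_funM => //.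
  by apply: measurableT_comp => //; exact: measurable_funM.
have W0 u : 0 <= W u by rewrite /W; have z0 : 0 <= `|s * u| by []; lra.
have iW : P.-integrable setT (EFin \o (W \o U)).
  apply: integrable_addR; last exact: finite_measure_integrable_cst.
  apply: integrable_addR; last exact: finite_measure_integrable_cst.
  apply: integrable_scaleR.
  by apply: (integrable_abse (f := EFin \o (fun w => s * U w))) => //; exact: integrable_scaleR.
(* From |x| <= 1 + x^2 and E (s U)^2 <= 1, the mean is at most 2 * 2 + B + 1. *)
have eW : \int[P]_w W (U w) <= B + 5.
  have i2 : P.-integrable setT (EFin \o (fun w => 2 * (s ^+ 2 * U w ^+ 2) + (B + 3))).
    apply: integrable_addR; last exact: finite_measure_integrable_cst.
    by apply: integrable_scaleR; exact: integrable_scaleR.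
  apply: (@le_trans _ _ (\int[P]_w (2 * (s ^+ 2 * U w ^+ 2) + (B + 3)))).
    apply: le_Rintegral => // w _; rewrite /W -exprMn.
    by have := normr_le1Dsqr (s * U w); lra.
  rewrite RintegralD//; last 2 first.
  - by apply: integrable_scaleR; exact: integrable_scaleR.
  - exact: finite_measure_integrable_cst.
  rewrite Rintegral_cstT RintegralZl//; last exact: integrable_scaleR.
  rewrite RintegralZl// ue2.
  have : s ^+ 2 * (size J)%:R <= 1.
    by rewrite -[leRHS]s1 ler_pM2l ?exprn_gt0// ler_nat/=.
  by lra.
have bnd (g : R -> R) (K : R) : measurable_fun setT g -> (forall x, `|g x| <= K) ->
    P.-integrable setT (EFin \o ((fun u => g (s * u)) \o U)).
  move=> mg gK; apply: (@bounded_integrable _ _ _ P _ K) => [|w]; last exact: gK.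
  by apply: measurableT_comp => //; exact: ms.
have mid : measurable_fun setT (fun v : R => s * v) by exact: measurable_funM.
have mid2 : measurable_fun setT (fun v : R => (s * v) ^+ 2) by exact: measurable_funX.
have mpow r : measurable_fun setT (fun v : R => `|s * v| `^ r).
  by apply: (measurableT_comp (measurable_powR r)); exact: measurableT_comp.
have isV : P.-integrable setT (EFin \o ((fun v => s * v) \o V)) by exact: integrable_scaleR.
have isV2 : P.-integrable setT (EFin \o ((fun v => (s * v) ^+ 2) \o V)).
  rewrite (_ : _ \o V = (fun w => s ^+ 2 * V w ^+ 2)); first exact: integrable_scaleR.
  by apply/funext => w /=; rewrite exprMn.
have esV2 : \int[P]_w ((s * V w) ^+ 2) = s ^+ 2.
  by under eq_Rintegral do rewrite exprMn; rewrite RintegralZl// ve2 mulr1.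
have powsV r w : `|s * V w| `^ r = s `^ r * `|V w| `^ r.
  by rewrite normrM (gtr0_norm s0) powRM// ltW.
have isVq : P.-integrable setT (EFin \o ((fun v => `|s * v| `^ q) \o V)).
  rewrite (_ : _ \o V = (fun w => s `^ q * `|V w| `^ q)); first exact: integrable_scaleR.
  by apply/funext => w /=; exact: powsV.
have esVq : \int[P]_w (`|s * V w| `^ q) <= s `^ q * M.
  under eq_Rintegral do rewrite powsV.
  by rewrite RintegralZl// ler_wpM2l// powR_ge0.
(* This yields E |V|^a <= 2, the origin of the 2 in M + 2. *)
have Va w : `|V w| `^ a <= 1 + V w ^+ 2.
  have [V1|V1] := leP `|V w| 1.
    apply: (@le_trans _ _ 1); last by rewrite lerDl sqr_ge0.
    by have := le_powRl (ltW a0) (normr_ge0 (V w)) V1; rewrite powR1.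
  apply: (@le_trans _ _ `|V w|); last exact: normr_le1Dsqr.
  by apply: ler1_powR => //; exact: ltW.
have iVa1 : P.-integrable setT (EFin \o (fun w => 1 + V w ^+ 2)).
  by apply: integrable_addR => //; exact: finite_measure_integrable_cst.
have mVa : measurable_fun setT (fun w => `|V w| `^ a).
  by apply: (measurableT_comp (measurable_powR a)); exact: measurableT_comp.
have iVa : P.-integrable setT (EFin \o (fun w => `|V w| `^ a)).
  by apply: (dominated_integrable mVa iVa1) => w; rewrite ger0_norm ?powR_ge0.
have isVa : P.-integrable setT (EFin \o ((fun v => `|s * v| `^ a) \o V)).
  rewrite (_ : _ \o V = (fun w => s `^ a * `|V w| `^ a)); first exact: integrable_scaleR.
  by apply/funext => w /=; exact: powsV.
have esVa : \int[P]_w (`|s * V w| `^ a) <= s `^ a * 2.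
  under eq_Rintegral do rewrite powsV.
  rewrite RintegralZl// ler_wpM2l ?powR_ge0//.
  apply: (le_trans (le_Rintegral _ iVa iVa1 _)) => //.
  by rewrite RintegralD ?Rintegral_cstT ?ve2//; exact: finite_measure_integrable_cst.
have [iT1 eT1] := independent_RintegralM ind (ms _ mf) mid (bnd _ _ mf fB) isV.
have [iT2 eT2] := independent_RintegralM ind (ms _ mdf) mid2 (bnd _ _ mdf dfb) isV2.
have [iWq eWq] := independent_RintegralM ind mW (mpow q) iW isVq.
have [iWa eWa] := independent_RintegralM ind mW (mpow a) iW isVa.
rewrite esV2 in eT2.
rewrite RintegralZl// ve1 !mulr0 in eT1.
pose K := 4 * L `^ a.
have K0 : 0 <= K by rewrite mulr_ge0// powR_ge0.
pose Z w := s * psum (i :: J) w.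
have ZE w : Z w = s * U w + s * V w by rewrite /Z E mulrDr.
(* [D] is the change of f' on returning from s U to the full sum, and [Q] is the Taylor remainder at
   s U. *)
pose D w := df (Z w) - df (s * U w).
pose Q w := s * V w * f (Z w) - (f (s * U w) * (s * V w) + df (s * U w) * (s * V w) ^+ 2).
have Dle w : `|D w| <= K * (W (U w) * `|s * V w| `^ a).
  apply: (le_trans (stein_deriv_holder dF fB xf1 h_c hL L1 B1 a01 (s * U w) (Z w))).
  by rewrite ZE [s * U w + _ - _]addrAC subrr add0r le_eqVlt; apply/orP; left; apply/eqP; rewrite /K /W; ring.
have Qle w : `|Q w| <= K * (W (U w) * `|s * V w| `^ q).
  have -> : Q w = s * V w * (f (s * U w + s * V w) - f (s * U w) - s * V w * df (s * U w)).
    by rewrite /Q ZE; ring.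
  rewrite normrM.
  have Ht := stein_taylor dF fB xf1 h_c hL L1 B1 a01 (s * U w) (s * V w).
  apply: (le_trans (ler_wpM2l (normr_ge0 _) Ht)).
  have -> : `|s * V w| `^ q = `|s * V w| * `|s * V w| `^ (1 + a).
    have -> : q = 1 + (1 + a) by rewrite /a; ring.
    have aa0 := addr_gt0 ltr01 (addr_gt0 ltr01 a0).
    by rewrite powRD ?powRr1// (gt_eqF aa0).
  by rewrite le_eqVlt; apply/orP; left; apply/eqP; rewrite /K /W; ring.
have mdfZ : measurable_fun setT (fun w => df (Z w)) by exact: measurableT_comp.
have iZ : P.-integrable setT (EFin \o (fun w => df (Z w))).
  by apply: (@bounded_integrable _ _ _ P _ 2) => // w; exact: dfb.
have iU := bnd _ _ mdf dfb.
have iD : P.-integrable setT (EFin \o D) by exact: integrable_subR.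
have iZf : P.-integrable setT (EFin \o (fun w => s * V w * f (Z w))).
  have isVB : P.-integrable setT (EFin \o (fun w => B * `|s * V w|)).
    by apply: integrable_scaleR; exact: (integrable_abse isV).
  apply: (dominated_integrable _ isVB) => [|w].
    by apply: measurable_funM; [exact: measurable_funM|exact: measurableT_comp].
  by rewrite normrM mulrC ler_wpM2r.
have iQ : P.-integrable setT (EFin \o Q).
  by apply: integrable_subR => //; exact: integrable_addR.
have eQ : \int[P]_w Q w = \int[P]_w (s * V w * f (Z w)) - (\int[P]_w df (s * U w)) * s ^+ 2.
  by rewrite RintegralB//; [rewrite RintegralD// eT1 eT2 add0r|exact: integrable_addR].
have eD : \int[P]_w D w = \int[P]_w df (Z w) - \int[P]_w df (s * U w) by rewrite RintegralB.
have -> : \int[P]_w (s * Y i w * f (s * psum (i :: J) w))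
     - s ^+ 2 * \int[P]_w df (s * psum (i :: J) w) =
   \int[P]_w Q w - s ^+ 2 * \int[P]_w D w by rewrite eQ eD; ring.
have bQ : `|\int[P]_w Q w| <= K * ((B + 5) * (s `^ q * M)).
  apply: (le_trans (le_normr_Rintegral_dom iQ _ Qle)); first exact: integrable_scaleR.
  rewrite RintegralZl// ler_wpM2l// eWq ler_pM//.
    by apply: Rintegral_ge0 => w _; exact: W0.
  by apply: Rintegral_ge0 => w _; exact: powR_ge0.
have bD : `|\int[P]_w D w| <= K * ((B + 5) * (s `^ a * 2)).
  apply: (le_trans (le_normr_Rintegral_dom iD _ Dle)); first exact: integrable_scaleR.
  rewrite RintegralZl// ler_wpM2l// eWa ler_pM//.
    by apply: Rintegral_ge0 => w _; exact: W0.
  by apply: Rintegral_ge0 => w _; exact: powR_ge0.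
rewrite (le_trans (ler_normB _ _))// normrM ger0_norm ?sqr_ge0//.
apply: (le_trans (lerD bQ (ler_wpM2l (sqr_ge0 s) bD))).
have -> : s `^ q = s ^+ 2 * s `^ a.
  rewrite -powR_mulrn ?ltW// -powRD; last by rewrite (gt_eqF s0) implybT.
  by congr (_ `^ _); rewrite /a; ring.
by rewrite le_eqVlt; apply/orP; left; apply/eqP; rewrite /K; ring.
Qed.

End partial_sums.

Section stein_sum.
Context d (T : measurableType d) (R : realType) (P : probability T R).
Variable Y : nat -> {RV P >-> R}.
Variables q M : R.
Hypothesis indY : independent_RVs Y.
Hypothesis stdY : standardized Y q M.
Hypothesis q23 : 2 < q <= 3.
Let a := q - 2.

(** By Stein's equation h(Z) - c = f'(Z) - Z f(Z). As s^2 n = 1, f'(Z) splits into n shares of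
    weight s^2, one for each summand s Y_k f(Z) of Z f(Z); the n leave-one-out errors of order s^q
    add up to order s^a. *)
Lemma stein_sum (h : R -> R) (L s : R) (n : nat) :
  continuous h -> (forall x, 0 <= h x <= 1) ->
  (forall x y, `|h x - h y| <= L * `|x - y|) -> 1 <= L ->
  0 < s -> s ^+ 2 * n%:R = 1 ->
  `| \int[P]_w h (s * psum Y (iota 0 n) w) - gauss_mean h |
    <= 4 * (stein_bound R + 5) * (M + 2) * (L * s) `^ a.
Proof.
move=> ch h01 hL L1 s0 sn.
have [f [dF fB xf1]] := stein_solution ch h01.
have h_c := gauss_mean_dist ch h01.
set c := gauss_mean h in dF h_c *.
pose df x := x * f x + (h x - c).
pose I := iota 0 n.
pose Z w := s * psum Y I w.
have uI : uniq I by exact: iota_uniq.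
have mZ : measurable_fun setT Z.
  by apply: measurable_funM => //; exact: measurable_psum.
have mh : measurable_fun setT h by exact: continuous_measurable_fun.
have mf : measurable_fun setT f.
  apply: continuous_measurable_fun => x; apply: differentiable_continuous.
  by apply/derivable1_diffP; exact: ex_derive.
have mdf : measurable_fun setT df.
  by apply: measurable_funD; [exact: measurable_funM|exact: measurable_funB].
have iZ : P.-integrable setT (EFin \o (fun w => df (Z w))).
  apply: (@bounded_integrable _ _ _ P _ 2) => [|w]; first exact: measurableT_comp.
  exact: stein_deriv_bound.
have iY k : P.-integrable setT (EFin \o (fun w => s * Y k w * f (Z w))).
  have [v1 _ _ _ _] := stdY k.
  have isVB : P.-integrable setT (EFin \o (fun w => stein_bound R * `|s * Y k w|)).
    by apply: integrable_scaleR; apply: (integrable_abse (f := EFin \o (fun w => s * Y k w))) => //;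
      exact: integrable_scaleR.
  apply: (dominated_integrable _ isVB) => [|w].
    by apply: measurable_funM; [exact: measurable_funM|exact: measurableT_comp].
  by rewrite normrM mulrC ler_wpM2r.
have step k : k \in I ->
  `| \int[P]_w (s * Y k w * f (Z w)) - s ^+ 2 * \int[P]_w df (Z w) |
     <= 4 * L `^ a * (stein_bound R + 5) * (M + 2) * s `^ q.
  (* The sum does not depend on the order of the indices, so [k] is moved to the head, where the
     leave-one-out estimate expects it. *)
  move=> kI; have pI := perm_to_rem kI.
  have sI : size I = n by rewrite size_iota.
  have ek w : psum Y I w = psum Y (k :: rem k I) w by exact: perm_big.
  rewrite /Z; under eq_Rintegral do rewrite ek.
  under [X in _ - _ * X]eq_Rintegral do rewrite ek.
  apply: (stein_leave_one_out indY stdY ch dF fB xf1 h_c hL L1 (stein_bound_ge1 R) q23) => //.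
    by rewrite -(perm_uniq pI).
  by rewrite -(perm_size pI) sI.
have E : \int[P]_w h (Z w) - c =
    - \sum_(k <- I) (\int[P]_w (s * Y k w * f (Z w)) - s ^+ 2 * \int[P]_w df (Z w)).
  rewrite sumrB big_const_seq count_predT size_iota iter_addr addr0.
  rewrite -mulr_natr mulrAC sn mul1r -Rintegral_sumR// opprB.
  rewrite -RintegralB//; last exact: integrable_sumR.
  have -> : \int[P]_w h (Z w) - c = \int[P]_w (h (Z w) - c).
    rewrite RintegralB ?Rintegral_cstT//; last exact: finite_measure_integrable_cst.
    apply: (@bounded_integrable _ _ _ P _ 1) => [|w]; first exact: measurableT_comp.
    by have /andP[h0 h1] := h01 (Z w); rewrite ger0_norm.
  apply: eq_Rintegral => w _; rewrite -mulr_suml -mulr_sumr -/(psum Y I w) -/(Z w) /df.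
  ring.
rewrite -[X in `|X|]/(\int[P]_w h (Z w) - c) E normrN.
apply: (le_trans (ler_norm_sum _ _ _)); rewrite big_seq.
apply: (le_trans (ler_sum _ step)).
rewrite -big_seq big_const_seq count_predT size_iota iter_addr addr0.
rewrite powRM ?(ltW s0)//; last exact: le_trans L1.
have -> : s `^ q = s ^+ 2 * s `^ a.
  rewrite -powR_mulrn ?ltW// -powRD; last by rewrite (gt_eqF s0) implybT.
  by congr (_ `^ _); rewrite /a; ring.
rewrite -mulr_natr le_eqVlt; apply/orP; left; apply/eqP.
transitivity (4 * L `^ a * (stein_bound R + 5) * (M + 2) * s `^ a * (s ^+ 2 * n%:R)); first by ring.
by rewrite sn; ring.
Qed.

End stein_sum.

(** * Smoothed tail indicators *)

Section ramp.
Context (R : realType).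
Notation mu := (@lebesgue_measure R).
Notation phi := (@phi R).
Implicit Types u v x y eta : R.

(* Both strict and large inequalities are needed: the level sets of
   |x|^p 1_{|x| >= y} are of the two kinds. *)
Definition tail (b : bool) u x : R := (if b then u <= `|x| else u < `|x|)%R%:R.

Lemma tail_eq0 b u x : `|x| < u -> tail b u x = 0.
Proof. by move=> xu; rewrite /tail [u <= _]leNgt xu [u < _]ltNge (ltW xu) if_same. Qed.

Lemma tail_eq1 b u x : u < `|x| -> tail b u x = 1.
Proof. by move=> xu; rewrite /tail xu (ltW xu) if_same. Qed.

Lemma tail_itv b u x : 0 <= tail b u x <= 1.
Proof. by rewrite /tail ler0n lern1 leq_b1. Qed.

(** A continuous function between the tails at v + eta and at v; its slope 1 / eta is the Lipschitz
    constant that enters Stein's bound. *)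
Definition ramp v eta x : R := Num.min 1 (Num.max 0 ((`|x| - v) / eta)).

Lemma clamp_lip x y :
  `|Num.min 1 (Num.max 0 x) - Num.min 1 (Num.max 0 y)| <= `|x - y|.
Proof.
have H1 : x - y <= `|x - y| by exact: ler_norm.
have H2 : y - x <= `|x - y| by rewrite distrC; exact: ler_norm.
rewrite ler_norml !minEle !maxEle; set D := `|x - y| in H1 H2 *.
case: (leP 0 x) => x0; case: (leP 0 y) => y0; rewrite ?ler10;
  case: (leP 1 x) => x1; case: (leP 1 y) => y1; apply/andP; split; lra.
Qed.

Lemma ramp_itv v eta x : 0 <= ramp v eta x <= 1.
Proof. by rewrite /ramp le_min ler01 le_max lexx ge_min lexx. Qed.

Lemma ramp_lip v eta x y : 0 < eta ->
  `|ramp v eta x - ramp v eta y| <= eta^-1 * `|x - y|.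
Proof.
move=> e0; rewrite /ramp.
have H : `|(`|x| - v) / eta - (`|y| - v) / eta| <= eta^-1 * `|x - y|.
  rewrite -mulrBl opprB addrA subrK normrM mulrC ler_pM//.
    by rewrite gtr0_norm ?invr_gt0.
  exact: ler_dist_dist.
apply: (le_trans _ H); set A := _ / eta; set B := _ / eta.
exact: clamp_lip.
Qed.

Lemma tail_ramp_le b v eta x : 0 < eta -> tail b (v + eta) x <= ramp v eta x.
Proof.
move=> e0; have [vx|vx] := leP (v + eta) `|x|; last first.
  by rewrite tail_eq0//; have /andP[] := ramp_itv v eta x.
apply: (@le_trans _ _ 1); first by have /andP[] := tail_itv b (v + eta) x.
rewrite /ramp le_min lexx/= le_max ler_pdivlMr// mul1r; apply/orP; right; lra.
Qed.

Lemma ramp_le_tail b v eta x : 0 < eta -> ramp v eta x <= tail b v x.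
Proof.
move=> e0; have [vx|vx] := ltP v `|x|.
  by rewrite tail_eq1//; have /andP[] := ramp_itv v eta x.
apply: (@le_trans _ _ 0); last by have /andP[] := tail_itv b v x.
rewrite /ramp ge_min ge_max lexx/= pmulr_lle0 ?invr_gt0//; apply/orP; right; lra.
Qed.

Lemma continuous_ramp v eta : 0 < eta -> continuous (ramp v eta).
Proof.
move=> e0 x; apply/cvgrPdist_le => /= e he.
near=> y.
rewrite (le_trans (ramp_lip _ _ _ e0))// ler_pdivrMl//.
near: y; apply: cvgr_dist_le; first exact: cvg_id.
exact: mulr_gt0.
Unshelve. all: by end_near. Qed.

Lemma measurable_tail b u : measurable_fun setT (tail b u).
Proof.
have mn : measurable_fun setT (fun x : R => `|x|) by exact: measurableT_comp.
have -> : tail b u = \1_((fun x => `|x|) @^-1` [set` Interval (BSide b u) +oo%O]).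
  apply/funext => x; rewrite /tail indicE; congr (nat_of_bool _)%:R.
  by apply/idP/idP; rewrite inE/= in_itv/= andbT; case: b.
by apply: measurable_indic; rewrite -[X in measurable X]setTI; exact: mn.
Qed.

Definition gauss_tail b u : R := \int[mu]_x (tail b u x * phi x).

Lemma integrable_bounded_phi (g : R -> R) : measurable_fun setT g ->
  (forall x, 0 <= g x <= 1) -> mu.-integrable setT (EFin \o (fun x => g x * phi x)).
Proof.
move=> mg g01; apply: (dominated_integrable _ (integrable_phi R)).
  by apply: measurable_funM => //; exact: measurable_phi.
move=> x; have /andP[g0 g1] := g01 x.
by rewrite normrM (ger0_norm (phi_ge0 x)) ger0_norm// ler_piMl ?phi_ge0.
Qed.

Lemma measurable_ramp v eta : 0 < eta -> measurable_fun setT (ramp v eta).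
Proof. by move=> e0; apply: continuous_measurable_fun; exact: continuous_ramp. Qed.

Lemma integrable_ramp_phi v eta : 0 < eta ->
  mu.-integrable setT (EFin \o (fun x => ramp v eta x * phi x)).
Proof.
move=> e0; apply: integrable_bounded_phi; first exact: measurable_ramp.
exact: ramp_itv.
Qed.

Lemma integrable_tail_phi b v : mu.-integrable setT (EFin \o (fun x => tail b v x * phi x)).
Proof. by apply: integrable_bounded_phi; [exact: measurable_tail|exact: tail_itv]. Qed.

(** The two ramps differ only for u - eta <= |x| <= u + eta, that is on two intervals of length 2
    eta, and the density is at most [normal_peak 1]. *)
Lemma gauss_ramp_gap u eta : 0 < eta ->
  gauss_mean (ramp (u - eta) eta) - gauss_mean (ramp u eta) <= 4 * normal_peak 1 * eta.
Proof.
move=> e0; rewrite /gauss_mean -RintegralB//; try exact: integrable_ramp_phi.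
pose p : R := normal_peak 1.
have p0 : 0 <= p by exact: normal_peak_ge0.
pose g x := p * (\1_`[u - eta, u + eta] x + \1_`[- u - eta, - u + eta] x) : R.
have iI v : mu.-integrable setT (EFin \o (\1_`[v - eta, v + eta] : R -> R)).
  by apply: integrable_indic_itv.
have eI v : \int[mu]_x (\1_`[v - eta, v + eta] x : R) = 2 * eta.
  rewrite /Rintegral integral_indic//= setIT. rewrite lebesgue_measure_itv/= lte_fin.
  by rewrite ltrBlDr -addrA ltrDl addr_gt0//=; ring.
have ig : mu.-integrable setT (EFin \o g).
  by apply: integrable_scaleR; exact: integrable_addR.
apply: (@le_trans _ _ (\int[mu]_x g x)); last first.
  rewrite RintegralZl//; last exact: integrable_addR.
  by rewrite RintegralD// !eI -/p; lra.
apply: le_Rintegral => //.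
  by apply: integrable_subR; exact: integrable_ramp_phi.
move=> x _; rewrite -mulrBl mulrC /g.
have H : ramp (u - eta) eta x - ramp u eta x <=
    \1_`[u - eta, u + eta] x + \1_`[- u - eta, - u + eta] x.
  have := ramp_le_tail true (u - eta) x e0; have := tail_ramp_le true u x e0.
  rewrite /tail !indicE !mem_setE !in_itv/=.
  have /andP[r0 r1] := ramp_itv (u - eta) eta x.
  have /andP[r0' r1'] := ramp_itv u eta x.
  have [ux|ux] := leP (u + eta) `|x|; have [ux'|ux'] := leP (u - eta) `|x| => /= h1 h2.
  - have : (0 : R) <= (u - eta <= x <= u + eta)%R%:R + (- u - eta <= x <= - u + eta)%R%:R.
      by rewrite addr_ge0.
    lra.
  - lra.
  - suff : (1 : R) <= (u - eta <= x <= u + eta)%R%:R + (- u - eta <= x <= - u + eta)%R%:R by lra.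
    have [x0|x0] := leP 0 x.
      rewrite (ger0_norm x0) in ux ux'.
      by rewrite ux' (ltW ux)/= lerDl.
    rewrite (ltr0_norm x0) in ux ux'.
    have -> : (- u - eta <= x <= - u + eta) by apply/andP; split; lra.
    by rewrite lerDr.
  - have : (0 : R) <= (u - eta <= x <= u + eta)%R%:R + (- u - eta <= x <= - u + eta)%R%:R.
      by rewrite addr_ge0.
    lra.
have px : phi x <= p by apply: normal_pdf_ub; rewrite oner_neq0.
have i0 : 0 <= \1_`[u - eta, u + eta] x + \1_`[- u - eta, - u + eta] x :> R.
  by rewrite addr_ge0.
apply: (le_trans (ler_wpM2l (phi_ge0 x) H)).
by rewrite ler_wpM2r.
Qed.

Lemma gauss_tail_ramp b u eta : 0 < eta ->
  gauss_mean (ramp u eta) <= gauss_tail b u <= gauss_mean (ramp (u - eta) eta).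
Proof.
move=> e0; apply/andP; split; apply: le_Rintegral => //;
  try exact: integrable_ramp_phi; try exact: integrable_tail_phi.
- by move=> x _; rewrite ler_wpM2r ?phi_ge0//; exact: ramp_le_tail.
- move=> x _; rewrite ler_wpM2r ?phi_ge0//.
  by have := tail_ramp_le b (u - eta) x e0; rewrite subrK.
Qed.

End ramp.

Section kolmogorov_rate.
Context d (T : measurableType d) (R : realType) (P : probability T R).
Variable Y : nat -> {RV P >-> R}.
Variables q M : R.
Hypothesis indY : independent_RVs Y.
Hypothesis stdY : standardized Y q M.
Hypothesis q23 : 2 < q <= 3.
Hypothesis M0 : 0 <= M.
Let a := q - 2.

Definition sum_tail (b : bool) s n u : R := \int[P]_w tail b u (s * psum Y (iota 0 n) w).

(* Smoothing the indicator over a width eta costs O(eta) for the Gaussian and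
   O((s/eta)^a) in Stein's bound; eta = s^(a/(1+a)) balances the two. *)
Lemma kolmogorov_bound : exists2 C : R, 0 <= C & forall cl (s : R) n u,
  0 < s -> s ^+ 2 * n%:R = 1 ->
  `|sum_tail cl s n u - gauss_tail cl u| <= C * s `^ (a / (1 + a)).
Proof.
have /andP[q2 q3] := q23.
have a0 : 0 < a by rewrite /a; lra.
have a1 : a <= 1 by rewrite /a; lra.
pose K := 4 * (stein_bound R + 5) * (M + 2).
have K0 : 0 <= K.
  have sb := stein_bound_ge1 R; have M0' := M0.
  by rewrite /K !mulr_ge0//; lra.
have p0 : 0 <= normal_peak (1 : R) by exact: normal_peak_ge0.
exists (K + 4 * normal_peak 1); first by rewrite addr_ge0// mulr_ge0.
move=> cl s n u s0 sn.
pose b := a / (1 + a).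
have b0 : 0 < b by rewrite divr_gt0//; lra.
pose eta := s `^ b.
have e0 : 0 < eta by exact: powR_gt0.
have n0 : (0 < n)%N by case: n sn => // /eqP; rewrite mulr0 eq_sym oner_eq0.
have s1 : s <= 1.
  rewrite -(@ler_pXn2r _ 2) ?nnegrE ?(ltW s0)// expr1n -sn ler_peMr ?sqr_ge0//.
  by rewrite ler1n.
have eta1 : eta <= 1 by have := le_powRl (ltW b0) (ltW s0) s1; rewrite powR1.
pose L := eta^-1.
have L1 : 1 <= L by rewrite invf_ge1.
have Ls : (L * s) `^ a = eta.
  rewrite /L /eta -powRN -[X in _ * X](powRr1 (ltW s0)) -powRD; last by rewrite (gt_eqF s0) implybT.
  rewrite -powRrM; congr (_ `^ _); rewrite /b; field.
  by rewrite gt_eqF//; lra.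
pose Z w := s * psum Y (iota 0 n) w.
have mZ : measurable_fun setT Z.
  by apply: measurable_funM => //; exact: measurable_psum.
have irZ v : P.-integrable setT (EFin \o (fun w => ramp v eta (Z w))).
  apply: (@bounded_integrable _ _ _ P _ 1) => [|w].
    by apply: measurableT_comp => //; exact: measurable_ramp.
  by have /andP[r0 r1] := ramp_itv v eta (Z w); rewrite ger0_norm.
have itZ v : P.-integrable setT (EFin \o (fun w => tail cl v (Z w))).
  apply: (@bounded_integrable _ _ _ P _ 1) => [|w].
    by apply: measurableT_comp => //; exact: measurable_tail.
  by have /andP[r0 r1] := tail_itv cl v (Z w); rewrite ger0_norm.
have B v : `| \int[P]_w ramp v eta (Z w) - gauss_mean (ramp v eta) | <= K * eta.
  rewrite -[X in K * X]Ls; apply: (stein_sum indY stdY q23) => //.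
  - exact: continuous_ramp.
  - exact: ramp_itv.
  - by move=> x y; exact: ramp_lip.
(* The ramps at u and u - eta enclose both tails, so the error is at most one Stein error plus the
   gap between the Gaussian ramps. *)
have /andP[g1 g2] := gauss_tail_ramp cl u e0.
have gap := gauss_ramp_gap u e0.
have up : sum_tail cl s n u <= \int[P]_w ramp (u - eta) eta (Z w).
  apply: le_Rintegral => // w _.
  by have := tail_ramp_le cl (u - eta) (Z w) e0; rewrite subrK.
have lo : \int[P]_w ramp u eta (Z w) <= sum_tail cl s n u.
  by apply: le_Rintegral => // w _; exact: ramp_le_tail.
have := B u; have := B (u - eta); rewrite !ler_norml => /andP[b1 b2] /andP[b3 b4].
rewrite -/b -/eta mulrDl; clear B Ls irZ itZ mZ.
by apply/andP; split; lra.
Qed.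

End kolmogorov_rate.

(** * Tail bounds and the nonuniform approximation *)

Section exponential_inequalities.
Context (R : realType).
Implicit Types z l u : R.

(* Two applications of 1 + z <= exp z, in the forms exp z (1 - z) <= 1 and
   exp z - 1 <= z exp z. *)
Lemma expR_le_quadratic z l : z <= l -> 0 <= l ->
  expR z <= 1 + z + z ^+ 2 * expR l.
Proof.
move=> zl l0.
have H1 : expR z * (1 - z) <= 1.
  by rewrite -ler_pdivlMl ?expR_gt0// mulr1 -expRN expR_ge1Dx.
have e0 := expR_gt0 z.
suff : z * (expR z - 1) <= z ^+ 2 * expR l by lra.
have el : expR z <= expR l by rewrite ler_expR.
have e1 : 1 <= expR l by rewrite -[X in X <= _]expR0 ler_expR.
have [z0|z0] := leP 0 z.
  rewrite expr2 -mulrA ler_wpM2l//.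
  have : z * expR z <= z * expR l by rewrite ler_wpM2l.
  by lra.
have : z * (expR z - 1) <= z * z.
  by rewrite ler_wnM2l ?(ltW z0)// lerBrDr addrC expR_ge1Dx.
move=> /le_trans; apply; rewrite -expr2 ler_peMr// sqr_ge0//.
Qed.

Lemma ln_le_self u : 0 < u -> ln u <= u.
Proof. by move=> u0; exact/ltW/ln_sublinear. Qed.

(** Square ln u = 2 ln (sqrt u) <= 2 sqrt u. *)
Lemma ln_sqr_le u : 1 <= u -> ln u ^+ 2 <= 4 * u.
Proof.
move=> u1; have u0 : 0 < u by lra.
have E : u = Num.sqrt u ^+ 2 by rewrite sqr_sqrtr// ltW.
have s0 : 0 < Num.sqrt u by rewrite sqrtr_gt0.
have l0 : 0 <= ln u by exact: ln_ge0.
have H : ln u <= 2 * Num.sqrt u.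
  by rewrite [X in ln X]E lnXn// -[ln _ *+ 2]mulr_natl ler_pM2l// ltW// ln_sublinear.
have -> : 4 * u = (2 * Num.sqrt u) ^+ 2 by rewrite exprMn -E; ring.
by rewrite lerXn2r ?nnegrE ?mulr_ge0 ?(ltW s0).
Qed.

End exponential_inequalities.

(** * Truncation and exponential moments *)

Section truncated_sums.
Context d (T : measurableType d) (R : realType) (P : probability T R).

Lemma exp_moment_psum (W : nat -> {RV P >-> R}) (t tau kappa : R) (J : seq nat) :
  independent_RVs W -> (forall k w, `|W k w| <= tau) ->
  (forall k, \int[P]_w expR (t * W k w) <= expR kappa) -> uniq J ->
  P.-integrable setT (EFin \o (fun w => expR (t * psum W J w))) /\
  \int[P]_w expR (t * psum W J w) <= expR (kappa * (size J)%:R).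
Proof.
move=> indW Wtau Wk.
have mexp : measurable_fun setT (fun x : R => expR (t * x)).
  by apply: measurableT_comp => //; exact: measurable_funM.
have iW k : P.-integrable setT (EFin \o ((fun x => expR (t * x)) \o W k)).
  apply: (@bounded_integrable _ _ _ P _ (expR (`|t| * tau))) => [|w].
    exact: measurableT_comp.
  rewrite ger0_norm ?expR_ge0// ler_expR (le_trans (ler_norm _))// normrM.
  by rewrite ler_wpM2l.
elim: J => [_|i J IH uJ].
  rewrite mulr0 expR0; split.
    apply: (@bounded_integrable _ _ _ P _ 1) => [|w].
      by apply: (measurableT_comp mexp); exact: measurable_psum.
    by rewrite /psum big_nil mulr0 expR0 normr1.
  under eq_Rintegral do rewrite /psum big_nil mulr0 expR0.
  by rewrite Rintegral_cstT.
have [iJ leJ] := IH (proj2 (andP uJ)).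
have [iE eE] := independent_RintegralM (independent_psum indW uJ) mexp mexp iJ (iW i).
have E : (fun w => expR (t * psum W (i :: J) w)) =
    (fun w => expR (t * psum W J w) * expR (t * W i w)).
  by apply/funext => w; rewrite -expRD -mulrDr addrC /psum big_cons.
rewrite E; split => //.
rewrite eE /= -natr1 mulrDr mulr1 expRD ler_pM//;
  by apply: Rintegral_ge0 => w _; exact: expR_ge0.
Qed.

Variable Y : nat -> {RV P >-> R}.
Variables q M : R.
Hypothesis indY : independent_RVs Y.
Hypothesis stdY : standardized Y q M.

(** The sign [sg] is taken to be 1 or -1, so that one exponential bound serves both tails of the
    sum. *)
Definition trunc (tau sg y : R) : R := sg * y * \1_`[- tau, tau] y.

Lemma measurable_trunc tau sg : measurable_fun setT (trunc tau sg).
Proof. by apply: measurable_funM; [exact: measurable_funM|exact: measurable_indic]. Qed.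

Definition truncY tau sg k (w : T) := trunc tau sg (Y k w).

Lemma measurable_truncY tau sg k : measurable_fun setT (truncY tau sg k).
Proof. by apply: measurableT_comp => //; exact: measurable_trunc. Qed.

HB.instance Definition _ tau sg k :=
  isMeasurableFun.Build _ _ _ _ (truncY tau sg k) (measurable_truncY tau sg k).

Lemma independent_truncY tau sg :
  independent_RVs (fun k => truncY tau sg k : {RV P >-> R}).
Proof.
move=> J B uJ mB; apply: (indY uJ (B := fun k => trunc tau sg @^-1` B k)) => k.
by rewrite -[X in measurable X]setTI; exact: measurable_trunc.
Qed.

Lemma truncE tau sg y : trunc tau sg y = if `|y| <= tau then sg * y else 0.
Proof.
rewrite /trunc indicE mem_setE in_itv/= -ler_norml.
by case: ifP; rewrite ?mulr1 ?mulr0.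
Qed.

(** Truncation raises the mean from 0 to at most 1 / tau and keeps the second moment at most 1, so
    the quadratic bound on the exponential integrates to at most 1 + t / tau + t^2 exp(t tau). *)
Lemma trunc_exp_moment t tau (sg : R) k : `|sg| = 1 -> 0 < tau -> 0 <= t ->
  \int[P]_w expR (t * truncY tau sg k w) <=
  expR (t / tau + t ^+ 2 * expR (t * tau)).
Proof.
move=> sg1 tau0 t0.
have [y1 ey1 y2 ey2 _] := stdY k.
have bW w : `|truncY tau sg k w| <= tau.
  by rewrite /truncY truncE; case: ifP => // H; rewrite ?normrM ?sg1 ?mul1r// normr0 ltW.
have iW : P.-integrable setT (EFin \o truncY tau sg k).
  by apply: (@bounded_integrable _ _ _ P _ tau) => //; exact: measurable_truncY.
have W2 w : truncY tau sg k w ^+ 2 <= Y k w ^+ 2.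
  rewrite /truncY truncE; case: ifP => _; last by rewrite expr0n sqr_ge0.
  by rewrite exprMn -[sg ^+ 2]real_normK ?num_real// sg1 expr1n mul1r.
have iW2 : P.-integrable setT (EFin \o (fun w => truncY tau sg k w ^+ 2)).
  apply: (dominated_integrable _ y2) => [|w]; first exact: measurable_funX (measurable_truncY _ _ _).
  by rewrite ger0_norm ?sqr_ge0.
(* Subtracting the centred sg Y leaves a term supported on |Y| > tau, where |Y| <= Y^2 / tau. *)
have EW : \int[P]_w truncY tau sg k w <= tau^-1.
  have -> : \int[P]_w truncY tau sg k w = \int[P]_w (truncY tau sg k w - sg * Y k w).
    by rewrite RintegralB//; [rewrite RintegralZl// ey1 mulr0 subr0|exact: integrable_scaleR].
  rewrite -[leRHS]mulr1 -ey2 -RintegralZl//.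
  apply: le_Rintegral => //.
  - by apply: integrable_subR => //; exact: integrable_scaleR.
  - exact: integrable_scaleR.
  move=> w _; rewrite /truncY truncE; case: ifPn => [_|].
    by rewrite subrr mulr_ge0// ?invr_ge0 ?sqr_ge0 ?ltW.
  rewrite -ltNge => H; rewrite sub0r (le_trans (ler_norm _))// normrN normrM sg1 mul1r.
  rewrite ler_pdivlMl// -[Y k w ^+ 2]real_normK ?num_real// expr2.
  by rewrite ler_wpM2r// ltW.
have l0 : 0 <= t * tau by rewrite mulr_ge0// ltW.
apply: (le_trans _ (expR_ge1Dx _)).
pose g w := 1 + t * truncY tau sg k w + t ^+ 2 * expR (t * tau) * truncY tau sg k w ^+ 2.
have i1 : P.-integrable setT (EFin \o (fun w => 1 + t * truncY tau sg k w)).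
  by apply: integrable_addR; [exact: finite_measure_integrable_cst|exact: integrable_scaleR].
have ig : P.-integrable setT (EFin \o g).
  by apply: integrable_addR => //; exact: integrable_scaleR.
apply: (@le_trans _ _ (\int[P]_w g w)).
  apply: le_Rintegral => //.
    apply: (@bounded_integrable _ _ _ P _ (expR (t * tau))) => [|w].
      by apply: measurableT_comp => //; apply: measurable_funM => //; exact: measurable_truncY.
    by rewrite ger0_norm ?expR_ge0// ler_expR ler_wpM2l// (le_trans (ler_norm _)).
  move=> w _; rewrite /g.
  have := @expR_le_quadratic R (t * truncY tau sg k w) (t * tau) _ l0.
  rewrite exprMn [X in _ <= _ + X]mulrAC; apply.
  by rewrite ler_wpM2l// (le_trans (ler_norm _)).
rewrite RintegralD//; last exact: integrable_scaleR.
rewrite RintegralD//; [|exact: finite_measure_integrable_cst|exact: integrable_scaleR].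
rewrite Rintegral_cstT RintegralZl// RintegralZl// -addrA lerD2l lerD//.
  by rewrite ler_wpM2l.
rewrite ler_piMr ?mulr_ge0 ?sqr_ge0 ?expR_ge0//.
by rewrite -ey2; apply: le_Rintegral.
Qed.

End truncated_sums.

Section large_deviations.
Context d (T : measurableType d) (R : realType) (P : probability T R).
Variable Y : nat -> {RV P >-> R}.
Variables q M : R.
Hypothesis indY : independent_RVs Y.
Hypothesis stdY : standardized Y q M.
Hypothesis q2 : 2 < q.
Hypothesis M0 : 0 <= M.

(* Truncation at tau and the exponential Markov inequality at parameter t. *)
Lemma tail_truncation_bound cl (s t tau u : R) n : 0 < s -> 0 < tau -> 0 <= t -> 0 <= u ->
  sum_tail Y cl s n u <= n%:R * (tau `^ (- q) * M) +
    expR (- (t * (u / s))) * (2 * expR ((t / tau + t ^+ 2 * expR (t * tau)) * n%:R)).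
Proof.
move=> s0 tau0 t0 u0.
pose I := iota 0 n; have uI : uniq I by exact: iota_uniq.
have sI : size I = n by rewrite size_iota.
pose kappa := t / tau + t ^+ 2 * expR (t * tau).
have ex (sg : R) : `|sg| = 1 ->
  P.-integrable setT (EFin \o (fun w => expR (t * psum (fun k => truncY Y tau sg k : {RV P >-> R}) I w))) /\
  \int[P]_w expR (t * psum (fun k => truncY Y tau sg k : {RV P >-> R}) I w) <= expR (kappa * n%:R).
  move=> sg1; have := @exp_moment_psum _ _ _ P (fun k => truncY Y tau sg k) t tau kappa I.
  rewrite sI; apply => //.
  - exact: independent_truncY.
  - move=> k w; rewrite /= /truncY truncE.
    by case: ifP => // H; rewrite ?normrM ?sg1 ?mul1r// normr0 ltW.
  - by move=> k; exact: (trunc_exp_moment stdY).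
have [ip ep] := ex 1 (normr1 _).
have [im em] := ex (-1) (normrN1 _).
pose Ap w := expR (t * psum (fun k => truncY Y tau 1 k : {RV P >-> R}) I w).
pose Am w := expR (t * psum (fun k => truncY Y tau (-1) k : {RV P >-> R}) I w).
pose Bg w := \sum_(k <- I) tau `^ (- q) * `|Y k w| `^ q.
pose c := expR (- (t * (u / s))).
have iB : P.-integrable setT (EFin \o Bg).
  apply: integrable_sumR => k; apply: integrable_scaleR.
  by have [_ _ _ _ []] := stdY k.
have iA : P.-integrable setT (EFin \o (fun w => c * (Ap w + Am w))).
  by apply: integrable_scaleR; exact: integrable_addR.
(* If some |Y_k| exceeds tau, then [Bg] is at least 1. Otherwise the truncated sums are the sum and
   its opposite, and when the tail event occurs one of the two exponentials times [c] is at least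
   1. *)
have pw w : tail cl u (s * psum Y I w) <= Bg w + c * (Ap w + Am w).
  have A0 : 0 <= c * (Ap w + Am w) by rewrite mulr_ge0 ?addr_ge0 ?expR_ge0.
  have B0 k : 0 <= tau `^ (- q) * `|Y k w| `^ q by rewrite mulr_ge0 ?powR_ge0.
  have B0' : 0 <= Bg w by apply: sumr_ge0.
  have [uZ|uZ] := leP u `|s * psum Y I w|; last first.
    by rewrite tail_eq0// addr_ge0.
  apply: (@le_trans _ _ 1); first by have /andP[] := tail_itv cl u (s * psum Y I w).
  have [/hasP[k kI Yk]|/hasPn nY] := boolP (has (fun k => tau < `|Y k w|) I).
    apply: (@le_trans _ _ (tau `^ (- q) * `|Y k w| `^ q)); last first.
      rewrite -[leLHS]addr0 lerD// /Bg (perm_big _ (perm_to_rem kI))/= big_cons.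
      by rewrite lerDl; apply: sumr_ge0.
    rewrite powRN ler_pdivlMl ?powR_gt0// mulr1.
    by apply: le_powRl; [rewrite ltW// (lt_trans _ q2)|exact: ltW|exact: ltW].
  have EW sg : psum (fun k => truncY Y tau sg k : {RV P >-> R}) I w = sg * psum Y I w.
    rewrite /psum mulr_sumr; apply: eq_big_seq => k kI.
    by rewrite /= /truncY truncE; have := nY k kI; rewrite -leNgt => ->.
  apply: (@le_trans _ _ (c * (Ap w + Am w))); last by rewrite lerDr.
  rewrite /c /Ap /Am !EW mul1r mulN1r mulrDr -!expRD.
  have uS : u / s <= `|psum Y I w|.
    by rewrite ler_pdivrMr//; move: uZ; rewrite normrM (gtr0_norm s0) mulrC.
  have e0 z : 0 <= expR z :> R by exact: expR_ge0.
  have [S0|S0] := leP 0 (psum Y I w).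
    rewrite -[leLHS]addr0 lerD// -[leLHS]expR0 ler_expR.
    rewrite (ger0_norm S0) in uS.
    by rewrite addrC subr_ge0 ler_wpM2l.
  rewrite -[leLHS]add0r lerD// -[leLHS]expR0 ler_expR.
  rewrite (ltr0_norm S0) in uS.
  by rewrite addrC subr_ge0 ler_wpM2l.
have itZ : P.-integrable setT (EFin \o (fun w => tail cl u (s * psum Y I w))).
  apply: (@bounded_integrable _ _ _ P _ 1) => [|w].
    apply: measurableT_comp; first exact: measurable_tail.
    by apply: measurable_funM => //; exact: measurable_psum.
  by have /andP[r0 r1] := tail_itv cl u (s * psum Y I w); rewrite ger0_norm.
apply: (@le_trans _ _ (\int[P]_w (Bg w + c * (Ap w + Am w)))).
  apply: le_Rintegral => //; exact: integrable_addR.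
rewrite RintegralD// RintegralZl//; last exact: integrable_addR.
rewrite RintegralD// lerD//.
  rewrite Rintegral_sumR; last first.
    by move=> k; apply: integrable_scaleR; have [_ _ _ _ []] := stdY k.
  apply: (@le_trans _ _ (\sum_(k <- I) tau `^ (- q) * M)).
    apply: ler_sum => k _; have [_ _ _ _ [iq leq]] := stdY k.
    by rewrite RintegralZl// ler_wpM2l ?powR_ge0.
  by rewrite big_const_seq count_predT sI iter_addr addr0 mulr_natl.
by rewrite ler_wpM2l ?expR_ge0// mulr_natl mulr2n; exact: lerD ep em.
Qed.

(** The first term comes from a single large summand, as n s^q = s^(q - 2); the second comes from
    the truncated sum, whose decay can be given any order m. *)
Lemma sum_tail_bound (m : R) : 1 <= m -> exists2 C : R, 0 <= C &
  forall cl (s : R) n u, 0 < s -> s ^+ 2 * n%:R = 1 -> 1 <= u ->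
  sum_tail Y cl s n u <= C * (s `^ (q - 2) * u `^ (- q) + u `^ (- m)).
Proof.
move=> m1; have m0 : 0 < m by lra.
pose C1 := M * m `^ q; pose C2 := 2 * expR (5 * m ^+ 2).
have C10 : 0 <= C1 by rewrite mulr_ge0 ?powR_ge0.
have C20 : 0 <= C2 by rewrite mulr_ge0 ?expR_ge0.
exists (C1 + C2); first exact: addr_ge0.
move=> cl s n u s0 sn u1; have u0 : 0 < u by lra.
have sm0 : 0 < s * m by exact: mulr_gt0.
(* With these values t u / s = m ln u, so the Markov factor is u^(-m), and exp(t tau) = u. The other
   exponent is m^2 (ln u / u^2 + (ln u)^2 / u) <= m^2 (1 + 4), the 5 in [C2]. *)
pose tau := u / (s * m); pose t := ln u / tau.
have tau0 : 0 < tau by exact: divr_gt0.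
have l0 : 0 <= ln u by exact: ln_ge0.
have t0 : 0 <= t by rewrite divr_ge0// ltW.
have sn0 := lt0r_neq0 s0; have mn0 := lt0r_neq0 m0; have un0 := lt0r_neq0 u0.
have tt : t * tau = ln u by rewrite divfK// lt0r_neq0.
apply: (le_trans (tail_truncation_bound cl n s0 tau0 t0 (ltW u0))).
have E1 : n%:R * (tau `^ (- q) * M) = C1 * (s `^ (q - 2) * u `^ (- q)).
  rewrite /tau powRM ?invr_ge0 ?(ltW sm0) ?(ltW u0)//.
  rewrite -powR_inv1 ?(ltW sm0)// -powRrM mulN1r opprK powRM ?(ltW s0) ?(ltW m0)//.
  have -> : s `^ q = s ^+ 2 * s `^ (q - 2).
    rewrite -powR_mulrn ?(ltW s0)// -powRD; last by rewrite (gt_eqF s0) implybT.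
    by congr (_ `^ _); ring.
  transitivity (C1 * (s `^ (q - 2) * u `^ (- q)) * (s ^+ 2 * n%:R)); last by rewrite sn mulr1.
  by rewrite /C1; ring.
have E2 : expR (- (t * (u / s))) = u `^ (- m).
  rewrite /powR (gt_eqF u0); congr expR; rewrite /t /tau; field.
  by rewrite sn0 mn0 un0.
have E3 : 2 * expR ((t / tau + t ^+ 2 * expR (t * tau)) * n%:R) <= C2.
  rewrite ler_pM2l// ler_expR tt lnK ?posrE//.
  have -> : (t / tau + t ^+ 2 * u) * n%:R =
     (s ^+ 2 * n%:R) * (m ^+ 2 * (ln u / u ^+ 2) + m ^+ 2 * (ln u ^+ 2 / u)).
    by rewrite /t /tau; field; rewrite sn0 mn0 un0.
  rewrite sn mul1r.
  have h1 : ln u / u ^+ 2 <= 1.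
    rewrite ler_pdivrMr ?exprn_gt0// mul1r (le_trans (ln_le_self u0))//.
    by rewrite expr2 ler_peMl// ltW.
  have h2 : ln u ^+ 2 / u <= 4 by rewrite ler_pdivrMr// ln_sqr_le.
  have m20 : 0 <= m ^+ 2 by exact: sqr_ge0.
  by have := ler_wpM2l m20 h1; have := ler_wpM2l m20 h2; lra.
rewrite E1 E2 mulrDr.
have p1 : 0 <= s `^ (q - 2) * u `^ (- q) by rewrite mulr_ge0 ?powR_ge0.
have p2 : 0 <= u `^ (- m) by exact: powR_ge0.
rewrite lerD//; first by rewrite ler_wpM2r// lerDl.
by rewrite mulrC ler_wpM2r// (le_trans E3)// lerDr.
Qed.

End large_deviations.

(** * Gaussian tails *)

Section gauss_large_deviations.
Context (R : realType).
Notation mu := (@lebesgue_measure R).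
Notation phi := (@phi R).

Lemma gauss_tail_le_phi b (u : R) : 1 <= u -> gauss_tail b u <= 2 * phi u.
Proof.
move=> u1; have u0 : 0 < u by lra.
have mi (D : set R) : measurable D -> mu.-integrable setT (EFin \o (phi \_ D)).
  by move=> mD; rewrite -restrict_EFin; apply/(integrable_mkcond _ _).1 => //; exact: integrable_phiS.
have mil := mills u0.
apply: (@le_trans _ _ (\int[mu]_x ((phi \_ `[u, +oo[) x + (phi \_ `]-oo, - u]) x))).
  apply: le_Rintegral => //.
  - exact: integrable_tail_phi.
  - by apply: integrable_addR; exact: mi.
  move=> x _; rewrite !patchE !mem_setE !in_itv/= andbT.
  have p0 := phi_ge0 x.
  have [ux|ux] := leP u `|x|; last first.
    by rewrite tail_eq0// mul0r addr_ge0//; case: ifP.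
  apply: (@le_trans _ _ (phi x)); first by rewrite ler_piMl//; have /andP[] := tail_itv b u x.
  have [x0|x0] := leP 0 x.
    by rewrite (ger0_norm x0) in ux; rewrite ux lerDl; case: ifP.
  rewrite (ltr0_norm x0) in ux.
  by rewrite [x <= - u]lerNr ux lerDr; case: ifP.
rewrite RintegralD//; [|exact: mi|exact: mi].
rewrite -!Rintegral_mkcond left_tail_phi.
have : phi u / u <= phi u by rewrite ler_pdivrMr// ler_peMr ?phi_ge0.
by lra.
Qed.

Lemma gauss_tail_bound (m : R) : exists2 C : R, 0 <= C &
  forall b u, 1 <= u -> gauss_tail b u <= C * u `^ (- m).
Proof.
pose p : R := normal_peak 1.
have p0 : 0 <= p by exact: normal_peak_ge0.
(* The factor exp(m^2) suffices because m ln u - u^2 / 2 <= m^2; for m >= 0 this follows from ln u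
   <= u and (2 m - u)^2 >= 0. *)
exists (2 * (p * expR (m ^+ 2))); first by rewrite !mulr_ge0 ?expR_ge0.
move=> b u u1; have u0 : 0 < u by lra.
rewrite (le_trans (gauss_tail_le_phi b u1))// -!mulrA ler_pM2l// phiE ler_wpM2l//.
rewrite /powR (gt_eqF u0) -expRD ler_expR.
have [m0|m0] := leP 0 m; last first.
  have : 0 <= (- m) * ln u by rewrite mulr_ge0 ?ln_ge0//; lra.
  by have := sqr_ge0 m; have := sqr_ge0 u; lra.
have : m * ln u <= m * u by rewrite ler_wpM2l// ln_le_self.
have : 0 <= (2 * m - u) ^+ 2 by exact: sqr_ge0.
have -> : (2 * m - u) ^+ 2 = 4 * m ^+ 2 - 4 * (m * u) + u ^+ 2 by ring.
by have := sqr_ge0 u; have := sqr_ge0 m; lra.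
Qed.

End gauss_large_deviations.

(** A case split in place of min(1, u^(-q)): [powR] sends base 0 to 0 when the exponent is nonzero,
    so the minimum would vanish at u = 0. *)
Definition envelope (R : realType) (q u : R) : R := if u <= 1 then 1 else u `^ (- q).

Section nonuniform_bound.
Context d (T : measurableType d) (R : realType) (P : probability T R).
Variable Y : nat -> {RV P >-> R}.
Variables q M : R.
Hypothesis indY : independent_RVs Y.
Hypothesis stdY : standardized Y q M.
Hypothesis q23 : 2 < q <= 3.
Hypothesis M0 : 0 <= M.
Let a := q - 2.

(* For u^q <= s^(kappa - b) use the Kolmogorov bound of order s^b; beyond that
   both tails are small, the power m being chosen so that u^(q - m) <= s^kappa. *)
Lemma nonuniform_bound (kappa : R) : 0 < kappa -> kappa < a / (1 + a) ->
  exists2 C : R, 0 <= C & forall b (s : R) n u, 0 < s -> s ^+ 2 * n%:R = 1 ->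
  `|sum_tail Y b s n u - gauss_tail b u| <= C * s `^ kappa * envelope q u.
Proof.
move=> k0 kb; have /andP[q2 q3] := q23; have M0' := M0.
have a0 : 0 < a by rewrite /a; lra.
have a1 : a <= 1 by rewrite /a; lra.
set bt := a / (1 + a) in kb *.
have b0 : 0 < bt by rewrite divr_gt0//; lra.
have ba : bt <= a.
  have aa : 0 <= a * a by rewrite mulr_ge0// ltW.
  by rewrite /bt ler_pdivrMr; lra.
pose g := bt - kappa.
have g0 : 0 < g by rewrite /g; lra.
(* Past the threshold u^q > s^(-g); raising this to the power kappa / g gives u^(-q kappa / g) <
   s^kappa, hence the excess of m over q. *)
pose m := q + q * (kappa / g).
have m1 : 1 <= m.
  have : 0 <= q * (kappa / g) by rewrite mulr_ge0 ?divr_ge0//; lra.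
  by rewrite /m; lra.
have [C1 C10 H1] := kolmogorov_bound indY stdY q23 M0.
have [C2 C20 H2] := sum_tail_bound indY stdY q2 M0 m1.
have [C3 C30 H3] := gauss_tail_bound m.
exists (C1 + (2 * C2 + C3)); first by rewrite !addr_ge0// mulr_ge0.
move=> b s n u s0 sn.
have n0 : (0 < n)%N by case: n sn => // /eqP; rewrite mulr0 eq_sym oner_eq0.
have s1 : s <= 1.
  rewrite -(@ler_pXn2r _ 2) ?nnegrE ?(ltW s0)// expr1n -[leRHS]sn ler_peMr ?sqr_ge0//.
  by rewrite ler1n.
have sle r r' : r <= r' -> s `^ r' <= s `^ r by move=> rr; apply: ger_powR => //; rewrite s0.
have K := H1 b s n u s0 sn; rewrite -/a -/bt in K.
have sk0 : 0 < s `^ kappa by exact: powR_gt0.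
have CC : 0 <= 2 * C2 + C3 by lra.
have small r : 0 <= r -> s `^ bt <= s `^ kappa * r ->
    `|sum_tail Y b s n u - gauss_tail b u| <= (C1 + (2 * C2 + C3)) * s `^ kappa * r.
  move=> r0 Hr; apply: (le_trans K); apply: (le_trans (ler_wpM2l C10 Hr)).
  by rewrite -mulrA ler_wpM2r ?lerDl// mulr_ge0// ltW.
rewrite /envelope; have [u1|u1] := leP u 1; first by apply: small => //; rewrite mulr1 sle// ltW.
have u0 : 0 < u by lra.
have uq0 : 0 < u `^ q by exact: powR_gt0.
have uNq : u `^ (- q) = (u `^ q)^-1 by exact: powRN.
have sg0 : 0 < s `^ g by exact: powR_gt0.
have sE : s `^ bt = s `^ kappa * s `^ g.
  rewrite -powRD; last by rewrite (gt_eqF s0) implybT.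
  by congr (_ `^ _); rewrite /g; ring.
have [uq|uq] := leP (u `^ q * s `^ g) 1.
  apply: small; first exact: powR_ge0.
  by rewrite sE ler_wpM2l ?(ltW sk0)// uNq -[X in _ <= X]mul1r ler_pdivlMr// mulrC.
have um : u `^ (- m) <= s `^ kappa * u `^ (- q).
  have -> : u `^ (- m) = u `^ (- q) * u `^ (- (q * (kappa / g))).
    rewrite -powRD; last by rewrite (gt_eqF u0) implybT.
    by congr (_ `^ _); rewrite /m; ring.
  rewrite mulrC ler_wpM2r ?powR_ge0// powRN powRrM.
  have kg : 0 < kappa / g by exact: divr_gt0.
  have : s `^ kappa = (s `^ g) `^ (kappa / g).
    by rewrite -powRrM; congr (_ `^ _); field; rewrite gt_eqF.
  move=> ->; rewrite -[X in X <= _]mul1r ler_pdivrMr ?powR_gt0// -powRM ?(ltW sg0) ?(ltW uq0)//.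
  by have := le_powRl (ltW kg) ler01 (ltW uq); rewrite powR1 mulrC.
have sa : s `^ a <= s `^ kappa by apply: sle; lra.
have t0 : 0 <= sum_tail Y b s n u.
  by apply: Rintegral_ge0 => w _; have /andP[] := tail_itv b u (s * psum Y (iota 0 n) w).
have t0' : 0 <= gauss_tail b u.
  by apply: Rintegral_ge0 => x _; rewrite mulr_ge0 ?phi_ge0//; have /andP[] := tail_itv b u x.
have h2 := H2 b s n u s0 sn (ltW u1); have h3 := H3 b u (ltW u1).
rewrite -/a in h2.
have uq0' : 0 <= u `^ (- q) by exact: powR_ge0.
have h4 : s `^ a * u `^ (- q) + u `^ (- m) <= 2 * (s `^ kappa * u `^ (- q)).
  by have := ler_wpM2r uq0' sa; lra.
have h5 := ler_wpM2l C20 h4.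
have h6 := ler_wpM2l C30 um.
have h7 : 0 <= C1 * (s `^ kappa * u `^ (- q)) by rewrite !mulr_ge0// ltW.
clear H1 H2 H3 K small sle sa sE uq uNq um h4.
by rewrite ler_norml; apply/andP; split; lra.
Qed.

End nonuniform_bound.

(** * Layer cake comparison of truncated moments *)

Section truncated_powers.
Context (R : realType).
Notation mu := (@lebesgue_measure R).
Implicit Types p q u x y r : R.

Definition truncated_power p y x : R := `|x| `^ p * tail true y x.

Lemma measurable_truncated_power p y : measurable_fun setT (truncated_power p y).
Proof.
apply: measurable_funM; last exact: measurable_tail.
apply: (measurableT_comp (measurable_powR p)); exact: normr_measurable.
Qed.

Lemma truncated_power_ge0 p y x : 0 <= truncated_power p y x.
Proof. by rewrite mulr_ge0 ?powR_ge0. Qed.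

(** Below height y^p the indicator alone decides, giving a closed tail at y; from there on the power
    decides, giving an open tail at r^(1/p). *)
Lemma truncated_power_gt p y x r : 0 < p -> 0 <= r ->
  (r < truncated_power p y x)%R%:R =
  tail (r `^ p^-1 < y) (Num.max y (r `^ p^-1)) x :> R.
Proof.
move=> p0 r0; set v := r `^ p^-1.
have v0 : 0 <= v by exact: powR_ge0.
have rE : r = v `^ p by rewrite /v -powRrM mulVf ?lt0r_neq0// powRr1.
have lt_v : (r < `|x| `^ p) = (v < `|x|).
  apply/idP/idP => [H|H].
    rewrite ltNge; apply/negP => xv; move: H; rewrite ltNge rE => /negP; apply.
    by apply: le_powRl => //; exact: ltW.
  by rewrite rE; apply: gt0_ltr_powR => //; rewrite nnegrE.
congr (nat_of_bool _)%:R; rewrite /truncated_power /tail.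
have [yx|xy] := leP y `|x|.
  rewrite mulr1 lt_v; have [vy|yv] := ltP v y; first by rewrite yx (lt_le_trans vy).
  by [].
rewrite mulr0 ltNge r0/=; have [vy|yv] := ltP v y; first by rewrite leNgt xy.
by rewrite ltNge (le_trans (ltW xy)).
Qed.

(** The factor 2^q pays for rounding u up to a power of 2: if 2^(j-1) < u <= 2^j and q >= 0, then
    u^(-q) <= 2^q (2^j)^(-q). *)
Definition dyadic_weight q (j : nat) : R := 2 `^ q * (2 ^+ j) `^ (- q).

Lemma dyadic_weight_ge0 q j : 0 <= dyadic_weight q j.
Proof. by rewrite mulr_ge0 ?powR_ge0. Qed.

(** The layer cake integral of the dyadic bound: a mass at 2^j >= y acts on the levels r from 0 to
    (2^j)^p. *)
Definition dyadic_sum q p y : \bar R :=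
  (\sum_(j <oo) (dyadic_weight q j * (2 ^+ j) `^ p * (y <= 2 ^+ j)%R%:R)%:E)%E.

Lemma envelope_dyadic q u : 0 <= q ->
  ((envelope q u)%:E <= \sum_(j <oo) (dyadic_weight q j * (u <= 2 ^+ j)%R%:R)%:E)%E.
Proof.
move=> q0.
have term0 j : (0 <= (dyadic_weight q j * (u <= 2 ^+ j)%R%:R)%:E)%E.
  by rewrite lee_fin mulr_ge0 ?dyadic_weight_ge0.
(* A single term of the series suffices: j = 0 if u <= 1, otherwise the least j with u <= 2^j. *)
suff [j Hj] : exists j, envelope q u <= dyadic_weight q j * (u <= 2 ^+ j)%R%:R.
  rewrite (le_trans (y := (dyadic_weight q j * (u <= 2 ^+ j)%R%:R)%:E)) ?lee_fin//.
  rewrite (nneseriesD1 (n := j))//.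
  by rewrite leeDl// nneseries_ge0.
rewrite /envelope; have [u1|u1] := leP u 1.
  exists 0%N; rewrite /dyadic_weight expr0 u1 powR1 !mulr1.
  by have := @ler_powR _ (2 : R) (ler1n _ 2) 0 q q0; rewrite powRr0.
have [n un] : exists n, u <= 2 ^+ n.
  exists (Num.truncn u).+1; rewrite (le_trans (ltW (truncnS_gt _)))//.
  by rewrite -natrX ler_nat ltnW// ltn_expl.
have Hex : exists n, (u <= 2 ^+ n)%R by exists n.
case: (ex_minnP Hex) => [[|j]]; first by rewrite expr0 leNgt u1.
move=> uj minj; exists j.+1; rewrite uj mulr1 /dyadic_weight.
have uj' : 2 ^+ j < u.
  by rewrite ltNge; apply/negP => /minj; rewrite ltnn.
have u0 : 0 < u by lra.
have -> : u `^ (- q) = 2 `^ q * (2 * u) `^ (- q).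
  rewrite powRM ?(ltW u0)// mulrA -powRD; last by rewrite (gt_eqF (ltr0n _ 2)) implybT.
  by rewrite subrr powRr0 mul1r.
rewrite ler_wpM2l ?powR_ge0// !powRN lef_pV2 ?posrE ?powR_gt0 ?exprn_gt0 ?mulr_gt0//.
by apply: le_powRl => //; rewrite exprS ler_pM2l// ltW.
Qed.

(** The condition max(y, r^(1/p)) <= 2^j is split into y <= 2^j and r <= (2^j)^p, so that
    integrating over r measures an interval. *)
Definition dyadic_kernel q p y (r : R) : \bar R :=
  (\sum_(j <oo) (dyadic_weight q j * (y <= 2 ^+ j)%R%:R * \1_`[0, ((2 ^+ j) `^ p)%R] r)%:E)%E.

Lemma dyadic_kernel_ge0 q p y r : (0 <= dyadic_kernel q p y r)%E.
Proof. by apply: nneseries_ge0 => j _ _; rewrite lee_fin !mulr_ge0 ?dyadic_weight_ge0. Qed.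

Let measurable_dyadic_kernel_term q p y j : measurable_fun setT (fun r : R =>
  (dyadic_weight q j * (y <= 2 ^+ j)%R%:R * \1_`[0, ((2 ^+ j) `^ p)%R] r)%:E).
Proof. by apply/measurable_EFinP/measurable_funM => //; exact: measurable_indic. Qed.

Lemma measurable_dyadic_kernel q p y : measurable_fun setT (dyadic_kernel q p y).
Proof.
apply: ge0_emeasurable_sum => [j r _ _|j _]; last exact: measurable_dyadic_kernel_term.
by rewrite lee_fin !mulr_ge0 ?dyadic_weight_ge0.
Qed.

Lemma integral_dyadic_kernel q p y :
  (\int[mu]_(r in `[0%R, +oo[) dyadic_kernel q p y r = dyadic_sum q p y)%E.
Proof.
rewrite integral_nneseries//; first last.
- by move=> j r _; rewrite lee_fin !mulr_ge0 ?dyadic_weight_ge0.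
- by move=> j; apply: measurable_funTS; exact: measurable_dyadic_kernel_term.
apply: eq_eseriesr => j _.
under eq_integral do rewrite EFinM.
have c0 : (0 <= (dyadic_weight q j * (y <= 2 ^+ j)%R%:R)%:E)%E.
  by rewrite lee_fin mulr_ge0 ?dyadic_weight_ge0.
have mI : measurable_fun [set: R] (EFin \o (\1_`[0, ((2 ^+ j) `^ p)%R] : R -> R)).
  by apply/measurable_EFinP; exact: measurable_indic.
rewrite ge0_integralZl//; last exact: measurable_funTS.
rewrite integral_indic//= (_ : _ `&` _ = `[0, (2 ^+ j) `^ p]%classic).
  by rewrite lebesgue_measure_itv/= lte_fin powR_gt0 ?exprn_gt0// oppr0 adde0 -EFinM mulrAC.
apply/seteqP; split => r /=; rewrite !in_itv/= ?andbT; first by case.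
by move=> /andP[r0 r1]; split => //; rewrite r0.
Qed.

Lemma envelope_kernel q p y r : 0 <= q -> 0 < p -> 0 <= r ->
  ((envelope q (Num.max y (r `^ p^-1)))%:E <= dyadic_kernel q p y r)%E.
Proof.
move=> q0 p0 r0; apply: (le_trans (envelope_dyadic _ q0)).
apply: lee_nneseries => [j _ _|j _]; first by rewrite lee_fin mulr_ge0 ?dyadic_weight_ge0.
rewrite lee_fin -mulrA ler_wpM2l ?dyadic_weight_ge0//.
rewrite ge_max indicE mem_setE in_itv/= r0/=.
have [yj|_] := leP y (2 ^+ j); last by rewrite mul0r.
rewrite mul1r; have [H|//] := leP (r `^ p^-1) (2 ^+ j).
have -> : r <= (2 ^+ j) `^ p => //.
have -> : r = (r `^ p^-1) `^ p by rewrite -powRrM mulVf ?lt0r_neq0// powRr1.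
by apply: (le_powRl (ltW p0) _ H); exact: powR_ge0.
Qed.

End truncated_powers.

Section layer_cake.
Context d (T : measurableType d) (R : realType) (P : probability T R).
Notation mu := (@lebesgue_measure R).
Variable U : {mfun T >-> R}.

Definition rv_tail (b : bool) (u : R) : R := \int[P]_w tail b u (U w).

Lemma integrable_rv_tail b u : P.-integrable setT (EFin \o (fun w => tail b u (U w))).
Proof.
apply: (@bounded_integrable _ _ _ P _ 1) => [|w].
  by apply: measurableT_comp => //; exact: measurable_tail.
by have /andP[r0 r1] := tail_itv b u (U w); rewrite ger0_norm.
Qed.

Definition truncated_power_rv p y (w : T) : R := truncated_power p y (U w).

Lemma measurable_truncated_power_rv p y : measurable_fun setT (truncated_power_rv p y).
Proof. by apply: measurableT_comp => //; exact: measurable_truncated_power. Qed.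

HB.instance Definition _ p y := isMeasurableFun.Build _ _ _ _
  (truncated_power_rv p y) (measurable_truncated_power_rv p y).

Lemma ccdf_truncated_power p y r : 0 < p -> 0 <= r ->
  ccdf (truncated_power_rv p y : {RV P >-> R}) r =
  (rv_tail (r `^ p^-1 < y)%R (Num.max y (r `^ p^-1)))%:E.
Proof.
move=> p0 r0; rewrite /rv_tail -integrable_RintegralE; last exact: integrable_rv_tail.
rewrite /ccdf /distribution /pushforward.
set A := _ @^-1` _.
transitivity (\int[P]_w (\1_A w)%:E)%E.
  rewrite integral_indic ?setIT//.
  by rewrite /A -[X in measurable X]setTI; exact: measurable_truncated_power_rv.
apply: eq_integral => w _; rewrite -truncated_power_gt// indicE.
congr ((nat_of_bool _)%:R)%:E; apply/idP/idP; rewrite inE /A/= in_itv/= andbT //.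
Qed.

Lemma expectation_truncated_power p y : 0 < p ->
  (\int[P]_w (truncated_power p y (U w))%:E =
   \int[mu]_(r in `[0%R, +oo[) ccdf (truncated_power_rv p y : {RV P >-> R}) r)%E.
Proof.
move=> p0; rewrite -ge0_expectation_ccdf ?expectation_def// => w.
exact: truncated_power_ge0.
Qed.

End layer_cake.

Section compare_truncated_powers.
Context d (T : measurableType d) (R : realType) (P : probability T R).
Context d' (T' : measurableType d') (Q : probability T' R).
Variables (U : {mfun T >-> R}) (V : {mfun T' >-> R}).
Notation mu := (@lebesgue_measure R).

(** The hypothesis is integrated over the levels r at u = max(y, r^(1/p)). Being one-sided, it
    serves both directions of the normal approximation and, with V = 0, the moments of N. *)
Lemma compare_truncated_power (K q p y : R) : 0 <= K -> 0 <= q -> 0 < p -> 0 <= y ->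
  (forall b u, 0 <= u -> rv_tail P U b u <= rv_tail Q V b u + K * envelope q u) ->
  (\int[P]_w (truncated_power p y (U w))%:E <=
   \int[Q]_w (truncated_power p y (V w))%:E + K%:E * dyadic_sum q p y)%E.
Proof.
move=> K0 q0 p0 y0 UV; rewrite !expectation_truncated_power// -integral_dyadic_kernel.
have k0 r : (0 <= dyadic_kernel q p y r)%E by exact: dyadic_kernel_ge0.
have mk := measurable_dyadic_kernel q p y.
have mKk : measurable_fun setT (fun r => K%:E * dyadic_kernel q p y r)%E.
  exact: measurable_funeM.
have Kk0 r : (0 <= K%:E * dyadic_kernel q p y r)%E by rewrite mule_ge0 ?lee_fin.
have mU := ccdf_measurable (truncated_power_rv U p y : {RV P >-> R}).
have mV := ccdf_measurable (truncated_power_rv V p y : {RV Q >-> R}).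
rewrite -ge0_integralZl ?lee_fin//; last exact: measurable_funTS.
rewrite -ge0_integralD//; [|exact: measurable_funTS|exact: measurable_funTS].
apply: ge0_le_integral => //; first exact: measurable_funTS.
  by apply: measurable_funTS; exact: emeasurable_funD.
move=> r; rewrite /= in_itv/= andbT => r0.
rewrite !ccdf_truncated_power//.
apply: (@le_trans _ _ ((rv_tail Q V (r `^ p^-1 < y)%R (Num.max y (r `^ p^-1)))%:E +
    K%:E * (envelope q (Num.max y (r `^ p^-1)))%:E)%E).
  by rewrite -EFinM -EFinD lee_fin UV// le_max y0.
by rewrite leeD2l// lee_wpmul2l ?lee_fin// envelope_kernel.
Qed.

End compare_truncated_powers.

(** * Counting sums *)

Section counting_sums.
Context (R : realType).
Variables (n0 : nat) (c : nat -> R) (B : R -> R).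
Hypothesis c_small : forall n, (n <= n0)%N -> c n = 0.
Hypothesis c_lo : forall m, (n0 <= m)%N -> B m.+2%:R - B m.+1%:R <= c m.+1.
Hypothesis c_hi : forall m, (n0 <= m)%N -> c m.+1 <= B m.+1%:R - B m%:R.
Hypothesis B_n0 : B n0%:R = 0.
Hypothesis B_homo : forall x y, n0%:R <= x -> x <= y -> B x <= B y.

Lemma counting_coef_ge0 n : 0 <= c n.
Proof.
have [nn|] := leqP n n0; first by rewrite c_small.
case: n => // m mn; rewrite (le_trans _ (c_lo mn))// subr_ge0 B_homo// ler_nat//.
by rewrite ltnW.
Qed.

Let term (v : R) n : \bar R := (c n * (n%:R <= v)%R%:R)%:E.

Let term_ge0 v n : (0 <= term v n)%E.
Proof. by rewrite lee_fin mulr_ge0// counting_coef_ge0. Qed.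

Let partial_zero v : (\sum_(0 <= n < n0.+1) term v n = 0)%E.
Proof.
rewrite big_nat big1// => n /andP[_ nn]; rewrite /term c_small ?mul0r//.
Qed.

(** The increments in [c_hi] telescope from B(n0) = 0. The model is c = B' with B' nonincreasing. *)
Lemma counting_sum_le (v : R) : n0%:R <= v ->
  (\sum_(n <oo) (c n * (n%:R <= v)%R%:R)%:E <= (B v)%:E)%E.
Proof.
move=> v0.
have H k : (\sum_(0 <= n < (n0 + k).+1) term v n <=
    (if (n0 + k)%:R <= v then B (n0 + k)%:R else B v)%:E)%E.
  elim: k => [|k IH]; first by rewrite addn0 partial_zero v0 B_n0.
  rewrite addnS big_nat_recr//= {2}/term.
  have kk : (n0 + k)%:R <= (n0 + k).+1%:R :> R by rewrite ler_nat.
  have [kv|kv] := leP (n0 + k).+1%:R v.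
    rewrite (le_trans kk kv) in IH.
    rewrite mulr1 (le_trans (leeD2r _ IH))// -EFinD lee_fin -lerBrDl.
    by apply: c_hi; exact: leq_addr.
  rewrite mulr0 adde0 (le_trans IH)// lee_fin; case: ifP => // kv'.
  by apply: B_homo => //; rewrite ler_nat leq_addr.
apply: lime_le; first by apply: is_cvg_nneseries => n _ _; exact: term_ge0.
exists n0.+1 => // n /= nn.
have [k ->] : exists k, n = (n0 + k).+1 by exists (n - n0.+1)%N; lia.
rewrite (le_trans (H k))// lee_fin; case: ifP => // kv.
by apply: B_homo => //; rewrite ler_nat leq_addr.
Qed.

(** In [c_lo] a coefficient is compared with the following increment, so the telescoping starts at
    n0 + 1 and loses the constant B(n0 + 1). *)
Lemma counting_sum_ge (v : R) : n0%:R <= v ->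
  ((B v - B n0.+1%:R)%:E <= \sum_(n <oo) (c n * (n%:R <= v)%R%:R)%:E)%E.
Proof.
move=> v0; have v00 : 0 <= v by rewrite (le_trans _ v0).
have H k : (n0 + k)%:R <= v ->
    ((B (n0 + k).+1%:R - B n0.+1%:R)%:E <= \sum_(0 <= n < (n0 + k).+1) term v n)%E.
  elim: k => [|k IH] kv; first by rewrite addn0 subrr partial_zero.
  rewrite addnS in kv *; rewrite big_nat_recr//= {2}/term kv mulr1.
  have kv' : (n0 + k)%:R <= v by rewrite (le_trans _ kv)// ler_nat.
  rewrite (le_trans _ (leeD2r _ (IH kv')))// -EFinD lee_fin.
  by have := c_lo (leq_addr k n0); lra.
have /andP[k1 k2] := truncn_itv v00.
have nk : (n0 <= Num.truncn v)%N by rewrite truncn_ge_nat.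
have E : Num.truncn v = (n0 + (Num.truncn v - n0))%N by lia.
rewrite E in k1; have := H _ k1; rewrite -E => Hk.
apply: (le_trans _ (nneseries_lim_ge (Num.truncn v).+1 (fun n _ _ => term_ge0 v n))).
apply: (le_trans _ Hk); rewrite lee_fin lerD2r.
by apply: B_homo => //; exact: ltW.
Qed.

End counting_sums.

Section power_increments.
Context (R : realType).

(* x^(r-1) is nonincreasing since r <= 1. *)
Lemma powR_increment (r x y : R) : r != 0 -> r <= 1 -> 0 < x -> x <= y ->
  (y - x) * y `^ (r - 1) <= y `^ r / r - x `^ r / r <= (y - x) * x `^ (r - 1).
Proof.
move=> r0 r1 x0 xy.
have dF (z : R) : 0 < z -> is_derive z 1 (fun t : R => r^-1 * t `^ r) (z `^ (r - 1)).
  move=> z0; have := is_deriveZ (r^-1 : R) (is_derive1_powR r z0).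
  by move=> H; apply: (is_derive_eq H); rewrite /GRing.scale/= mulrA mulVf// mul1r.
have xyd z : z \in `]x, y[ -> is_derive z 1 (fun t : R => r^-1 * t `^ r) (z `^ (r - 1)).
  by rewrite in_itv/= => /andP[xz _]; apply: dF; exact: lt_trans xz.
have cF : {within `[x, y], continuous (fun t : R => r^-1 * t `^ r)}.
  apply: derivable_within_continuous => z; rewrite in_itv/= => /andP[xz _].
  by apply: (@ex_derive _ _ _ _ _ _ _ (dF z _)); exact: lt_le_trans xz.
have [z + E] := MVT_segment xy xyd cF.
rewrite in_itv/= => /andP[xz zy].
have z0 : 0 < z by exact: lt_le_trans xz.
have mono u w : 0 < u -> u <= w -> w `^ (r - 1) <= u `^ (r - 1).
  move=> u0 uw; rewrite -(opprB 1 r) !powRN lef_pV2 ?posrE ?powR_gt0//; last exact: lt_le_trans uw.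
  by apply: le_powRl => //; [lra|exact: ltW].
have -> : y `^ r / r - x `^ r / r = (y - x) * z `^ (r - 1).
  by rewrite mulrC [x `^ r / r]mulrC E mulrC.
by rewrite !ler_wpM2l ?subr_ge0// mono.
Qed.

(** Apply ln z <= z - 1 at z = x / y and at z = y / x. *)
Lemma ln_increment (x y : R) : 0 < x -> x <= y ->
  (y - x) / y <= ln y - ln x <= (y - x) / x.
Proof.
move=> x0 xy; have y0 : 0 < y by exact: lt_le_trans xy.
have le1 z : 0 < z -> ln z <= z - 1 :> R.
  move=> z0; have H := @le_ln1Dx R (z - 1); rewrite [1 + _]addrC subrK in H.
  by apply: H; lra.
rewrite -ln_div ?posrE//; apply/andP; split.
  have := le1 (x / y) (divr_gt0 x0 y0).
  rewrite !ln_div ?posrE// mulrBl divff ?gt_eqF//; lra.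
by have := le1 (y / x) (divr_gt0 y0 x0); rewrite mulrBl divff ?gt_eqF.
Qed.

Lemma power_counting_sum (s v : R) : 0 < s <= 1 -> 0 <= v ->
  ((v `^ s / s - s^-1)%:E <=
    \sum_(n <oo) ((if (0 < n)%N then n%:R `^ (s - 1) else 0) * (n%:R <= v)%R%:R)%:E)%E /\
  (\sum_(n <oo) ((if (0 < n)%N then n%:R `^ (s - 1) else 0) * (n%:R <= v)%R%:R)%:E
    <= (v `^ s / s)%:E)%E.
Proof.
move=> /andP[s0 s1] v0.
pose c n : R := if (0 < n)%N then n%:R `^ (s - 1) else 0.
pose B (v : R) := v `^ s / s.
have sn0 : s != 0 by rewrite gt_eqF.
have c0 n : (n <= 0)%N -> c n = 0 by rewrite leqn0 => /eqP ->.
have clo m : (0 <= m)%N -> B m.+2%:R - B m.+1%:R <= c m.+1.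
  move=> _; have m1 : (0 : R) < m.+1%:R by rewrite ltr0n.
  have m2 : (m.+1%:R : R) <= m.+2%:R by rewrite ler_nat.
  have /andP[_] := powR_increment sn0 s1 m1 m2.
  by rewrite -[m.+2%:R]natr1 addrAC subrr add0r mul1r natr1.
have chi m : (0 <= m)%N -> c m.+1 <= B m.+1%:R - B m%:R.
  (* At m = 0 the left endpoint 0 is excluded from [powR_increment]; there the claim is 1 <= 1 /
     s. *)
  case: m => [|m] _.
    by rewrite /c/= /B powR0// mul0r subr0 !powR1 div1r invf_ge1.
  have m1 : (0 : R) < m.+1%:R by rewrite ltr0n.
  have m2 : (m.+1%:R : R) <= m.+2%:R by rewrite ler_nat.
  have /andP[+ _] := powR_increment sn0 s1 m1 m2.
  by rewrite -{1}[m.+2%:R]natr1 addrAC subrr add0r mul1r.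
have B0 : B 0%:R = 0 by rewrite /B powR0// mul0r.
have Bh x y : 0%:R <= x -> x <= y -> B x <= B y.
  by move=> x0 xy; rewrite ler_pM2r ?invr_gt0// le_powRl// ltW.
split; last exact: (counting_sum_le c0 clo chi B0 Bh v0).
by have := counting_sum_ge c0 clo Bh v0; rewrite {2}/B powR1 div1r.
Qed.

Lemma log_counting_sum (s v : R) : 0 < s <= 1 -> 1 <= v ->
  ((ln v `^ s / s - ln 2 `^ s / s)%:E <=
    \sum_(n <oo) ((if (1 < n)%N then ln n%:R `^ (s - 1) / n%:R else 0) * (n%:R <= v)%R%:R)%:E)%E /\
  (\sum_(n <oo) ((if (1 < n)%N then ln n%:R `^ (s - 1) / n%:R else 0) * (n%:R <= v)%R%:R)%:E
    <= (ln v `^ s / s)%:E)%E.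
Proof.
move=> /andP[s0 s1] v1.
pose c n : R := if (1 < n)%N then ln n%:R `^ (s - 1) / n%:R else 0.
pose B (v : R) := ln v `^ s / s.
have sn0 : s != 0 by rewrite gt_eqF.
have c0 n : (n <= 1)%N -> c n = 0 by rewrite /c ltnNge => ->.
have incr m : (1 <= m)%N -> [/\ (0 : R) < m%:R, (m%:R : R) <= m.+1%:R &
    m.+1%:R^-1 <= ln m.+1%:R - ln m%:R :> R /\ ln m.+1%:R - ln m%:R <= m%:R^-1 :> R].
  move=> m1; have m0 : (0 : R) < m%:R by rewrite ltr0n.
  have mm : (m%:R : R) <= m.+1%:R by rewrite ler_nat.
  split => //; have := ln_increment m0 mm.
  have -> : m.+1%:R - m%:R = 1 :> R by rewrite -natr1 addrAC subrr add0r.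
  by rewrite !div1r => /andP[].
have ln0 m : (2 <= m)%N -> 0 < ln m%:R :> R by move=> m2; rewrite ln_gt0// ltr1n.
have clo m : (1 <= m)%N -> B m.+2%:R - B m.+1%:R <= c m.+1.
  move=> m1; have [p0 pm [i1 i2]] := incr m.+1 isT.
  have l0 := ln0 m.+1 m1.
  have ll : ln m.+1%:R <= ln m.+2%:R :> R by rewrite ler_ln ?posrE.
  have /andP[_ H] := powR_increment sn0 s1 l0 ll.
  by rewrite /c ltnS m1 (le_trans H)// [X in _ <= X]mulrC ler_wpM2r ?powR_ge0.
have chi m : (1 <= m)%N -> c m.+1 <= B m.+1%:R - B m%:R.
  move=> m1; have [p0 pm [i1 i2]] := incr m m1.
  rewrite /c ltnS m1.
  have [m2|m2] := leqP 2 m.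
    have l0 := ln0 m m2.
    have ll : ln m%:R <= ln m.+1%:R :> R by rewrite ler_ln ?posrE ?ltr0n.
    have /andP[H _] := powR_increment sn0 s1 l0 ll.
    by rewrite (le_trans _ H)// mulrC ler_wpM2r ?powR_ge0.
  (* Here ln m = 0 is again excluded from [powR_increment]; the claim follows from 1 / 2 <= ln 2 and
     s <= 1. *)
  have m11 : m = 1%N by lia.
  rewrite m11 in i1 *.
  have l0 := ln0 2%N isT.
  rewrite {2}/B ln1 powR0// mul0r subr0 /B.
  rewrite -[ln 2 `^ s](mulr_powRB1 (ltW l0) s0) mulrC [X in _ <= X / _]mulrC -mulrA.
  rewrite [X in X <= _]mulrC ler_wpM2l ?powR_ge0//.
  rewrite ln1 subr0 in i1; rewrite (le_trans i1)// ler_peMr ?(ltW l0)// invf_ge1//.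
have B0 : B 1%:R = 0 by rewrite /B ln1 powR0// mul0r.
have Bh x y : 1%:R <= x -> x <= y -> B x <= B y.
  move=> x0 xy; rewrite ler_pM2r ?invr_gt0// le_powRl ?(ltW s0)//; first exact: ln_ge0.
  by rewrite ler_ln ?posrE//; lra.
split; last exact: (counting_sum_le c0 clo chi B0 Bh v1).
by have := counting_sum_ge c0 clo Bh v1.
Qed.

(** The counting argument with B(v) = (1 - v^(-t)) / t, which vanishes at 1 and stays below 1 /
    t. *)
Lemma negative_power_sum (t : R) : 0 < t ->
  (\sum_(n <oo) (if (1 < n)%N then n%:R `^ (- t - 1) else 0 : R)%:E <= t^-1%:E)%E.
Proof.
move=> t0.
pose c n : R := if (1 < n)%N then n%:R `^ (- t - 1) else 0.
pose B (v : R) := v `^ (- t) / (- t) + t^-1.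
have tn0 : - t != 0 by rewrite oppr_eq0 gt_eqF.
have t1 : - t <= 1 by lra.
have c0 n : (n <= 1)%N -> c n = 0 by rewrite /c ltnNge => ->.
have clo m : (1 <= m)%N -> B m.+2%:R - B m.+1%:R <= c m.+1.
  move=> mm1; have m1 : (0 : R) < m.+1%:R by rewrite ltr0n.
  have m2 : (m.+1%:R : R) <= m.+2%:R by rewrite ler_nat.
  have /andP[_] := powR_increment tn0 t1 m1 m2.
  rewrite /c ltnS mm1 -[m.+2%:R]natr1 addrAC subrr add0r mul1r natr1 /B; lra.
have chi m : (1 <= m)%N -> c m.+1 <= B m.+1%:R - B m%:R.
  move=> mm1; have m1 : (0 : R) < m%:R by rewrite ltr0n.
  have m2 : (m%:R : R) <= m.+1%:R by rewrite ler_nat.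
  have /andP[+ _] := powR_increment tn0 t1 m1 m2.
  rewrite /c ltnS mm1 -{1}[m.+1%:R]natr1 addrAC subrr add0r mul1r /B; lra.
have B0 : B 1%:R = 0 by rewrite /B powR1 div1r invrN addrC subrr.
have Bh x y : 1%:R <= x -> x <= y -> B x <= B y.
  move=> x1 xy; have x0 : 0 < x by lra.
  have y0 : 0 < y by lra.
  rewrite /B lerD2r !invrN !mulrN lerN2 ler_pM2r ?invr_gt0// !powRN.
  by rewrite lef_pV2 ?posrE ?powR_gt0// le_powRl// ltW.
apply: lime_le; first by apply: is_cvg_nneseries => n _ _; rewrite lee_fin; case: ifP; rewrite ?powR_ge0.
apply: nearW => n.
(* Counting up to v = n + 1 covers all indices of the partial sum below n. *)
have n1 : 1%:R <= n.+1%:R :> R by rewrite ler_nat.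
have := counting_sum_le c0 clo chi B0 Bh n1.
have Bt : B n.+1%:R <= t^-1.
  rewrite /B invrN mulrN addrC lerBlDr lerDl mulr_ge0 ?powR_ge0// invr_ge0 ltW//.
move=> H; apply: (le_trans _ (le_trans H _)); last by rewrite lee_fin.
have F0 k : (0 <= (c k * (k%:R <= n.+1%:R :> R)%R%:R)%:E)%E.
  by rewrite lee_fin mulr_ge0// /c; case: ifP; rewrite ?powR_ge0.
apply: (le_trans _ (nneseries_lim_ge n (fun k _ _ => F0 k))).
rewrite big_nat_cond [leRHS]big_nat_cond; apply: lee_sum => k /andP[/andP[_ kn] _].
by rewrite lee_fin ler_nat (ltnW (leqW kn)) mulr1.
Qed.

End power_increments.

(** * Comparison of the series *)

Section dyadic_sums.
Context (R : realType).

Lemma normr_sub_sandwich (x y u s e : R) :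
  u - s <= y -> y <= u -> 0 <= s -> x <= y + e -> y <= x + e ->
  `|x - u| <= s + e.
Proof. by move=> *; rewrite ler_norml; apply/andP; split; lra. Qed.

Lemma geometric_nneseries (z : R) : 0 <= z < 1 ->
  (\sum_(j <oo) (z ^+ j)%:E <= ((1 - z)^-1)%:E)%E.
Proof.
move=> /andP[z0 z1].
have z0' n : (0 <= (z ^+ n)%:E)%E by rewrite lee_fin exprn_ge0.
apply: lime_le; first by apply: is_cvg_nneseries => n _ _; exact: z0'.
apply: nearW => n; rewrite sumEFin lee_fin big_mkord -[leRHS]mul1r ler_pdivlMr; last by lra.
rewrite mulrC -opprB mulNr -subrX1 opprB.
by rewrite gerBl exprn_ge0.
Qed.

Definition dyadic_const (q r : R) : R := fine (\sum_(j <oo) (dyadic_weight q j * (2 ^+ j) `^ r)%:E)%E.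

(** The terms are geometric with ratio 2^(r - q) < 1, so the value is finite. *)
Lemma dyadic_constE (q r : R) : r < q ->
  (\sum_(j <oo) (dyadic_weight q j * (2 ^+ j) `^ r)%:E = (dyadic_const q r)%:E)%E.
Proof.
move=> rq; rewrite /dyadic_const fineK// ge0_fin_numE; last first.
  by apply: nneseries_ge0 => j _ _; rewrite lee_fin mulr_ge0 ?dyadic_weight_ge0 ?powR_ge0.
pose z : R := 2 `^ (r - q).
have z01 : 0 <= z < 1.
  rewrite powR_ge0/= /z -(opprB q r) powRN invf_lt1 ?powR_gt0//.
  rewrite -[X in X < _](powRr0 (2 : R)) /powR pnatr_eq0/= ltr_expR.
  by rewrite ltr_pM2r ?ln_gt0 ?ltr1n//; lra.
have E j : dyadic_weight q j * (2 ^+ j) `^ r = 2 `^ q * z ^+ j.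
  rewrite /dyadic_weight -mulrA -powRD; last by rewrite (gt_eqF (exprn_gt0 j (ltr0n R 2))) implybT.
  have -> : z ^+ j = 2 `^ ((r - q) * j%:R) by rewrite powRrM powR_mulrn// powR_ge0.
  have -> : (2 : R) ^+ j = 2 `^ j%:R by rewrite powR_mulrn.
  by rewrite -powRrM (mulrC (r - q)) (addrC (- q)).
under eq_eseriesr do rewrite E EFinM.
rewrite nneseriesZl; last by move=> j _; rewrite lee_fin exprn_ge0//; have /andP[] := z01.
rewrite (le_lt_trans (lee_wpmul2l _ (geometric_nneseries z01)))// ?lee_fin ?powR_ge0//.
by rewrite -EFinM ltry.
Qed.

Lemma dyadic_const_ge0 (q r : R) : 0 <= dyadic_const q r.
Proof.
apply: fine_ge0; apply: nneseries_ge0 => j _ _.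
by rewrite lee_fin mulr_ge0 ?dyadic_weight_ge0 ?powR_ge0.
Qed.

Lemma dyadic_sum_le (q p y : R) : p < q -> (dyadic_sum q p y <= (dyadic_const q p)%:E)%E.
Proof.
move=> pq; rewrite -dyadic_constE//; apply: lee_nneseries => [j _ _|j _].
  by rewrite lee_fin !mulr_ge0 ?dyadic_weight_ge0 ?powR_ge0.
rewrite lee_fin ler_piMr// ?mulr_ge0 ?dyadic_weight_ge0 ?powR_ge0//.
by rewrite lern1 leq_b1.
Qed.

Lemma dyadic_sum_ge0 (q p y : R) : (0 <= dyadic_sum q p y)%E.
Proof.
by apply: nneseries_ge0 => j _ _; rewrite lee_fin !mulr_ge0 ?dyadic_weight_ge0 ?powR_ge0.
Qed.

End dyadic_sums.

(** * Tails and moments of the normal variable *)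

Section normal_variable.
Context (R : realType) d' (T' : measurableType d') (Q : probability T' R).
Variable N : {RV Q >-> R}.
Hypothesis normalN : standard_normal N.
Notation mu := (@lebesgue_measure R).

Lemma normal_rv_tail b u : rv_tail Q N b u = gauss_tail b u.
Proof.
pose A := [set x : R | tail b u x = 1].
have tE x : tail b u x = \1_A x.
  rewrite indicE; case: (boolP (x \in A)); first by rewrite inE /A/= => ->.
  move=> /negP; rewrite inE /A/= /tail.
  by case: (if b then _ else _) => // /(_ erefl).
have mA : measurable A.
  have := @measurable_tail R b u measurableT [set 1] (measurable_set1 1).
  by rewrite setTI.
rewrite /rv_tail /gauss_tail /Rintegral; congr fine.
transitivity (Q (N @^-1` A)).
  transitivity (\int[Q]_w (\1_(N @^-1` A) w)%:E)%E; last first.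
    by rewrite integral_indic ?setIT// -[X in measurable X]setTI; exact: measurable_funP.
  by apply: eq_integral => w _; rewrite tE !indicE.
transitivity (normal_prob 0 1 A); first exact: normalN.
rewrite /normal_prob [LHS]integral_mkcond; apply: eq_integral => x _.
rewrite patchE tE indicE; case: ifP => _; first by rewrite mul1r.
by rewrite mul0r.
Qed.

(** Comparison with the zero variable at truncation level 0: the tail of N lies below a multiple of
    the envelope of exponent r + 1, which beats the power r. *)
Lemma normal_moment_integrable (r : R) : 0 < r ->
  Q.-integrable setT (EFin \o (fun w => `|N w| `^ r)).
Proof.
move=> r0.
have [C C0 HC] := gauss_tail_bound (r + 1).
pose V : {mfun T' >-> R} := cst 0.
have cmp b u : 0 <= u -> rv_tail Q N b u <= rv_tail Q V b u + (1 + C) * envelope (r + 1) u.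
  move=> u0; have V0 : 0 <= rv_tail Q V b u.
    by apply: Rintegral_ge0 => w _; have /andP[] := tail_itv b u (V w).
  rewrite normal_rv_tail /envelope; have [u1|u1] := leP u 1.
    have : gauss_tail b u <= 1.
      rewrite -(integral_phi R); apply: le_Rintegral => //.
      - exact: integrable_tail_phi.
      - exact: integrable_phi.
      - by move=> x _; have /andP[t0 t1] := tail_itv b u x; rewrite ler_piMl ?phi_ge0.
    by rewrite mulr1; lra.
  have := HC b u (ltW u1).
  have : 0 <= u `^ (- (r + 1)) by exact: powR_ge0.
  by rewrite mulrDl; lra.
have C1 : 0 <= 1 + C by lra.
have r1 : 0 <= r + 1 by lra.
have := compare_truncated_power C1 r1 r0 (lexx 0) cmp.
have E0 x : truncated_power r 0 x = `|x| `^ r :> R.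
  by rewrite /truncated_power /tail normr_ge0 mulr1.
under eq_integral do rewrite E0.
under [X in (_ <= X + _)%E]eq_integral do rewrite E0 /= normr0 powR0 ?gt_eqF//.
rewrite integral0 add0e => H.
apply: ge0_integrable_lty.
- apply: (measurableT_comp (measurable_powR r)); exact: measurableT_comp.
- by move=> w; exact: powR_ge0.
apply: (le_lt_trans H).
have rr : r < r + 1 by lra.
apply: (le_lt_trans (lee_wpmul2l _ (dyadic_sum_le 0 rr))); first by rewrite lee_fin.
by rewrite -EFinM ltry.
Qed.

End normal_variable.

Section series_comparison.
Context (R : realType) d (T : measurableType d) (P : probability T R).
Context d' (T' : measurableType d') (Q : probability T' R).
Variables (Y : nat -> {RV P >-> R}) (N : {RV Q >-> R}).
Variables q M : R.
Hypothesis indY : independent_RVs Y.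
Hypothesis stdY : standardized Y q M.
Hypothesis q23 : 2 < q <= 3.
Hypothesis M0 : 0 <= M.
Hypothesis normalN : standard_normal N.
Let a := q - 2.

Definition scaled_sum n (w : T) : R := (Num.sqrt n%:R)^-1 * psum Y (iota 0 n) w.

Lemma measurable_scaled_sum n : measurable_fun setT (scaled_sum n).
Proof. by apply: measurable_funM => //; exact: measurable_psum. Qed.

HB.instance Definition _ n := isMeasurableFun.Build _ _ _ _ (scaled_sum n) (measurable_scaled_sum n).

(** The rate is s^kappa at s = n^(-1/2). [K] is uniform in p and in the truncation level y, whose
    influence sits in [dyadic_sum]; summation over n relies on this. *)
Lemma normal_approximation kappa : 0 < kappa -> kappa < a / (1 + a) ->
  exists2 K : R, 0 <= K & forall p y n, 0 < p -> 0 <= y -> (0 < n)%N ->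
  (\int[P]_w (truncated_power p y (scaled_sum n w))%:E <=
   \int[Q]_w (truncated_power p y (N w))%:E +
     (K * n%:R `^ (- (kappa / 2)))%:E * dyadic_sum q p y)%E /\
  (\int[Q]_w (truncated_power p y (N w))%:E <=
   \int[P]_w (truncated_power p y (scaled_sum n w))%:E +
     (K * n%:R `^ (- (kappa / 2)))%:E * dyadic_sum q p y)%E.
Proof.
move=> k0 k1; have [K K0 HK] := nonuniform_bound indY stdY q23 M0 k0 k1.
have /andP[q2 q3] := q23.
exists K => // p y n p0 y0 n0.
have nR : (0 : R) < n%:R by rewrite ltr0n.
pose s : R := (Num.sqrt n%:R)^-1.
have s0 : 0 < s by rewrite invr_gt0 sqrtr_gt0.
have sn : s ^+ 2 * n%:R = 1 by rewrite exprVn sqr_sqrtr ?ltW// mulVf ?gt_eqF.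
have sk : s `^ kappa = n%:R `^ (- (kappa / 2)).
  rewrite /s -powR12_sqrt ?(ltW nR)// -powRN -powRrM; by congr (_ `^ _); field.
have q0 : 0 <= q by lra.
have K'0 : 0 <= K * n%:R `^ (- (kappa / 2)) by rewrite mulr_ge0 ?powR_ge0.
have H b u : `|rv_tail P (scaled_sum n) b u - rv_tail Q N b u| <=
    K * n%:R `^ (- (kappa / 2)) * envelope q u.
  by rewrite (normal_rv_tail normalN) -sk; exact: HK.
split; apply: compare_truncated_power => // b u _;
  by have := H b u; rewrite ler_norml => /andP[]; lra.
Qed.

End series_comparison.

Section series_estimate.
Context (R : realType) d (T : measurableType d) (P : probability T R).
Context d' (T' : measurableType d') (Q : probability T' R).
Variables (Y : nat -> {RV P >-> R}) (N : {RV Q >-> R}).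
Variables q M : R.
Hypothesis indY : independent_RVs Y.
Hypothesis stdY : standardized Y q M.
Hypothesis q23 : 2 < q <= 3.
Hypothesis M0 : 0 <= M.
Hypothesis normalN : standard_normal N.
Let a := q - 2.

Let moment (r : R) : R := \int[Q]_w (`|N w| `^ r).

Lemma exponent_gt0 : 0 < a / (1 + a).
Proof. by have /andP[q2 q3] := q23; rewrite divr_gt0// /a; lra. Qed.

(* The standardized sums have second moment 1, and the second moments converge. *)
Lemma normal_second_moment : moment 2 = 1.
Proof.
have /andP[q2 q3] := q23; have e0 := exponent_gt0.
pose k := a / (1 + a) / 2.
have k0 : 0 < k by rewrite divr_gt0.
have k1 : k < a / (1 + a) by rewrite /k; lra.
have [K K0 HK] := normal_approximation indY stdY q23 M0 normalN k0 k1.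
have i2 := normal_moment_integrable normalN (ltr0n R 2).
pose S := dyadic_const q 2.
have S0 : 0 <= S by exact: dyadic_const_ge0.
have tp2 x : truncated_power 2 0 x = `|x| `^ 2 :> R.
  by rewrite /truncated_power /tail normr_ge0 mulr1.
(* At level y = 0 nothing is truncated; the left side is free of n while the right side tends to
   0. *)
have B n : (0 < n)%N -> `|1 - moment 2| <= K * n%:R `^ (- (k / 2)) * S.
  move=> n0; have nR : (0 : R) < n%:R by rewrite ltr0n.
  have [H1 H2] := HK 2 0 n (ltr0n R 2) (lexx 0) n0.
  have EZ : (\int[P]_w (truncated_power 2 0 (scaled_sum Y n w))%:E = 1%:E)%E.
    have [_ _ j2 f2] := psum_moments indY stdY (iota_uniq 0 n).
    have E w : truncated_power 2 0 (scaled_sum Y n w) = n%:R^-1 * psum Y (iota 0 n) w ^+ 2.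
      rewrite tp2 -[2]/(2%:R) powR_mulrn// real_normK ?num_real// /scaled_sum exprMn exprVn.
      by rewrite sqr_sqrtr ?ltW.
    under eq_integral do rewrite E.
    rewrite integrable_RintegralE; last exact: integrable_scaleR.
    by rewrite RintegralZl// f2 size_iota mulVf// gt_eqF.
  have EN : (\int[Q]_w (truncated_power 2 0 (N w))%:E = (moment 2)%:E)%E.
    by under eq_integral do rewrite tp2; rewrite integrable_RintegralE.
  have K'0 : 0 <= K * n%:R `^ (- (k / 2)) by rewrite mulr_ge0 ?powR_ge0.
  have Dle : ((K * n%:R `^ (- (k / 2)))%:E * dyadic_sum q 2 0 <=
      (K * n%:R `^ (- (k / 2)) * S)%:E)%E.
    by rewrite [leRHS]EFinM lee_wpmul2l ?lee_fin//; exact: dyadic_sum_le.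
  rewrite EZ EN in H1 H2.
  have := le_trans H1 (leeD2l _ Dle); have := le_trans H2 (leeD2l _ Dle).
  rewrite -!EFinD !lee_fin ler_norml => h1 h2; apply/andP; split; lra.
apply/eqP; apply: contraT => ne.
have e1 : 0 < `|1 - moment 2| by rewrite normr_gt0 subr_eq0 eq_sym.
set e := `|1 - moment 2| in B e1.
have KS : 0 <= K * S by rewrite mulr_ge0.
(* With n^(k/2) >= v > K S / e, the bound [B] is violated. *)
pose v := K * S / e + 1.
have v0 : 0 < v by rewrite ltr_wpDl// divr_ge0// ltW.
pose n := (Num.truncn (v `^ (2 / k))).+1.
have nv : v `^ (2 / k) < n%:R by exact: truncnS_gt.
have n0 : (0 : R) < n%:R by rewrite ltr0n.
have k20 : 0 < k / 2 by rewrite divr_gt0.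
have vn : v <= n%:R `^ (k / 2).
  have := le_powRl (ltW k20) (powR_ge0 _ _) (ltW nv).
  by rewrite -powRrM (_ : 2 / k * (k / 2) = 1) ?powRr1 ?(ltW v0)//; field; rewrite gt_eqF.
have := B n isT; rewrite powRN mulrAC ler_pdivlMr ?powR_gt0// => Hn.
have := le_trans (ler_wpM2l (ltW e1) vn) Hn.
by rewrite /v mulrDr mulr1 mulrC divfK ?gt_eqF//; lra.
Qed.

(** Common to both parts: [c] holds the coefficients after standardization and [lev n] the
    truncation level in units of [theta]. Part (a) takes r = 2 - p and tau = 2 - p - kappa; part (b)
    takes p = 2, r = 2 delta and tau = 0. In the conclusion the [C0] term is the counting error of
    the Gaussian series, and the theta^(-tau) term is the cost of the normal approximation. *)
Lemma series_estimate (c lev : nat -> R) (p r g C0 tau D kappa : R) :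
  0 < kappa -> kappa < a / (1 + a) -> 0 < p -> 0 < r -> 0 <= g -> 0 <= D ->
  p + tau < q -> (forall n, 0 <= c n) -> c 0%N = 0 -> (forall n, 0 <= lev n) ->
  (forall x, 0 <= x ->
    ((g * x `^ r - C0)%:E <= \sum_(n <oo) (c n * (lev n <= x)%R%:R)%:E)%E /\
    (\sum_(n <oo) (c n * (lev n <= x)%R%:R)%:E <= (g * x `^ r)%:E)%E) ->
  (forall x, 0 < x ->
    (\sum_(n <oo) (c n * n%:R `^ (- (kappa / 2)) * (lev n <= x)%R%:R)%:E <=
      (D * x `^ tau)%:E)%E) ->
  exists2 C, 0 <= C & forall theta, 0 < theta -> exists2 L : R,
    (\sum_(n <oo) ((c n)%:E * \int[P]_w (truncated_power p (theta * lev n) (scaled_sum Y n w))%:E)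
      = L%:E)%E &
    `|L - g * theta `^ (- r) * moment (p + r)| <= C0 * moment p + C * theta `^ (- tau).
Proof.
move=> k0 k1 p0 r0 g0 D0 ptq c0 c00 lev0 HA HD.
have /andP[q2 q3] := q23.
have [K K0 HK] := normal_approximation indY stdY q23 M0 normalN k0 k1.
pose S := dyadic_const q (p + tau).
have S0 : 0 <= S by exact: dyadic_const_ge0.
exists (K * D * S); first by rewrite !mulr_ge0.
move=> theta t0.
pose EZ n : \bar R := (\int[P]_w (truncated_power p (theta * lev n) (scaled_sum Y n w))%:E)%E.
pose EN n : \bar R := (\int[Q]_w (truncated_power p (theta * lev n) (N w))%:E)%E.
pose er n : \bar R := ((c n * (K * n%:R `^ (- (kappa / 2))))%:E * dyadic_sum q p (theta * lev n))%E.
have tl0 n : 0 <= theta * lev n by rewrite mulr_ge0// ltW.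
have EZ0 n : (0 <= EZ n)%E by apply: integral_ge0 => w _; rewrite lee_fin truncated_power_ge0.
have EN0 n : (0 <= EN n)%E by apply: integral_ge0 => w _; rewrite lee_fin truncated_power_ge0.
have er0 n : (0 <= er n)%E.
  by rewrite mule_ge0 ?dyadic_sum_ge0// lee_fin !mulr_ge0 ?powR_ge0.
have cEZ0 n : (0 <= (c n)%:E * EZ n)%E by rewrite mule_ge0 ?lee_fin.
have cEN0 n : (0 <= (c n)%:E * EN n)%E by rewrite mule_ge0 ?lee_fin.
have cmp n : ((c n)%:E * EZ n <= (c n)%:E * EN n + er n)%E /\
             ((c n)%:E * EN n <= (c n)%:E * EZ n + er n)%E.
  (* The approximation holds for n > 0; the index 0 is disposed of by [c 0 = 0]. *)
  case: n => [|n]; first by rewrite c00 !mul0e ?add0e; split; exact: er0.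
  have [h1 h2] := HK p (theta * lev n.+1) n.+1 p0 (tl0 _) isT.
  have cn : (0 <= (c n.+1)%:E)%E by rewrite lee_fin.
  have dn : (0 <= (K * n.+1%:R `^ (- (kappa / 2)))%:E * dyadic_sum q p (theta * lev n.+1))%E.
    by rewrite mule_ge0 ?dyadic_sum_ge0// lee_fin mulr_ge0 ?powR_ge0.
  rewrite /er EFinM -muleA -!ge0_muleDr//.
  by split; rewrite lee_wpmul2l.
pose LZ : \bar R := (\sum_(n <oo) ((c n)%:E * EZ n))%E.
pose LN : \bar R := (\sum_(n <oo) ((c n)%:E * EN n))%E.
pose LE : \bar R := (\sum_(n <oo) er n)%E.
have ZN : (LZ <= LN + LE)%E.
  rewrite -nneseriesD//; apply: lee_nneseries => // n _; exact: (cmp n).1.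
have NZ : (LN <= LZ + LE)%E.
  rewrite -nneseriesD//; apply: lee_nneseries => // n _; exact: (cmp n).2.
have LEb : (LE <= (K * D * S * theta `^ (- tau))%:E)%E.
  pose f n j : \bar R := (c n * (K * n%:R `^ (- (kappa / 2))) *
    (dyadic_weight q j * (2 ^+ j) `^ p * (theta * lev n <= 2 ^+ j)%R%:R))%:E.
  have f0 n j : (0 <= f n j)%E.
    by rewrite lee_fin !mulr_ge0 ?powR_ge0 ?dyadic_weight_ge0.
  have -> : LE = (\sum_(n <oo) \sum_(j <oo) f n j)%E.
    apply: eq_eseriesr => n _; rewrite /er /dyadic_sum -nneseriesZl; last first.
      by move=> j _; rewrite lee_fin !mulr_ge0 ?powR_ge0 ?dyadic_weight_ge0.
    by apply: eq_eseriesr => j _; rewrite -EFinM.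
  (* The inner sum over n is now the error counting sum at 2^j / theta; its bound contributes
     (2^j)^tau, and p + tau < q makes the sum over j converge. *)
  rewrite nneseries_interchange//.
  have -> : (K * D * S * theta `^ (- tau))%:E =
    ((K * D * theta `^ (- tau))%:E * \sum_(j <oo) (dyadic_weight q j * (2 ^+ j) `^ (p + tau))%:E)%E.
    by rewrite dyadic_constE// -EFinM mulrAC.
  rewrite -nneseriesZl; last first.
    by move=> j _; rewrite lee_fin mulr_ge0 ?dyadic_weight_ge0 ?powR_ge0.
  apply: lee_nneseries => [j _ _|j _]; first exact: nneseries_ge0.
  have j0 : (0 : R) < 2 ^+ j by rewrite exprn_gt0.
  have jt : 0 < 2 ^+ j / theta by rewrite divr_gt0.
  pose wj := K * (dyadic_weight q j * (2 ^+ j) `^ p).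
  have wj0 : 0 <= wj by rewrite !mulr_ge0 ?powR_ge0 ?dyadic_weight_ge0.
  have -> : (\sum_(n <oo) f n j = wj%:E *
     \sum_(n <oo) (c n * n%:R `^ (- (kappa / 2)) * (lev n <= (2 ^+ j / theta)%R)%R%:R)%:E)%E.
    rewrite -nneseriesZl; last by move=> n _; rewrite lee_fin !mulr_ge0 ?powR_ge0.
    apply: eq_eseriesr => n _; rewrite /f -EFinM; congr EFin.
    by rewrite ler_pdivlMr// [lev n * _]mulrC /wj; ring.
  apply: (le_trans (lee_wpmul2l _ (HD _ jt))); first by rewrite lee_fin.
  rewrite -!EFinM lee_fin le_eqVlt; apply/orP; left; apply/eqP.
  rewrite powRM ?invr_ge0 ?(ltW j0) ?(ltW t0)// -[theta^-1]powR_inv1 ?(ltW t0)// -powRrM mulN1r.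
  rewrite powRD; last by rewrite (gt_eqF j0) implybT.
  by rewrite /wj; ring.
have mN (h : R) : measurable_fun setT (fun w => `|N w| `^ h).
  by apply: (measurableT_comp (measurable_powR h)); exact: measurableT_comp.
have ip := normal_moment_integrable normalN p0.
have ipr := normal_moment_integrable normalN (addr_gt0 p0 r0).
pose F n w : \bar R := (c n * truncated_power p (theta * lev n) (N w))%:E.
have F0 n w : (0 <= F n w)%E by rewrite lee_fin mulr_ge0 ?truncated_power_ge0.
have mF n : measurable_fun setT (F n).
  apply/measurable_EFinP; apply: measurable_funM => //.
  by apply: measurableT_comp => //; exact: measurable_truncated_power.
pose G w : \bar R := (\sum_(n <oo) F n w)%E.
have mG : measurable_fun setT G by exact: ge0_emeasurable_sum.
have G0 w : (0 <= G w)%E by exact: nneseries_ge0.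
have LNE : LN = (\int[Q]_w G w)%E.
  rewrite integral_nneseries//; apply: eq_eseriesr => n _.
  rewrite /EN -ge0_integralZl//.
  - apply/measurable_EFinP; apply: measurableT_comp => //.
    exact: measurable_truncated_power.
  - by move=> w _; rewrite lee_fin truncated_power_ge0.
  - by rewrite lee_fin.
have GE w : G w = ((`|N w| `^ p)%:E * \sum_(n <oo) (c n * (lev n <= (`|N w| / theta)%R)%R%:R)%:E)%E.
  rewrite -nneseriesZl; last by move=> n _; rewrite lee_fin mulr_ge0.
  apply: eq_eseriesr => n _; rewrite -EFinM; congr EFin.
  by rewrite /truncated_power /tail ler_pdivlMr// [lev n * _]mulrC; ring.
have x0 w : 0 <= `|N w| / theta by rewrite divr_ge0// ltW.
pose u w : R := g * theta `^ (- r) * `|N w| `^ (p + r).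
have uE w : u w = `|N w| `^ p * (g * (`|N w| / theta) `^ r).
  rewrite /u powRM ?invr_ge0 ?(ltW t0)// -[theta^-1]powR_inv1 ?(ltW t0)// -powRrM mulN1r.
  rewrite powRD; first by ring.
  by rewrite gt_eqF// addr_gt0.
have iu : Q.-integrable setT (EFin \o u) by exact: integrable_scaleR.
have iul : Q.-integrable setT (EFin \o (fun w => u w - C0 * `|N w| `^ p)).
  by apply: integrable_subR => //; exact: integrable_scaleR.
have Gu w : (G w <= (u w)%:E)%E.
  rewrite GE uE EFinM lee_wpmul2l ?lee_fin ?powR_ge0//.
  exact: (HA _ (x0 w)).2.
have Gl w : ((u w - C0 * `|N w| `^ p)%:E <= G w)%E.
  have -> : u w - C0 * `|N w| `^ p = `|N w| `^ p * (g * (`|N w| / theta) `^ r - C0).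
    by rewrite uE; ring.
  rewrite GE EFinM lee_wpmul2l ?lee_fin ?powR_ge0//.
  exact: (HA _ (x0 w)).1.
have Eu : (\int[Q]_w (u w)%:E = (g * theta `^ (- r) * moment (p + r))%:E)%E.
  by rewrite integrable_RintegralE// RintegralZl.
have LNu : (LN <= (g * theta `^ (- r) * moment (p + r))%:E)%E.
  rewrite LNE -Eu; apply: ge0_le_integral => //.
  by apply/measurable_EFinP; apply: measurable_funM.
have iG : Q.-integrable setT G.
  apply/integrableP; split => //.
  under eq_integral do rewrite gee0_abs//.
  by rewrite -LNE (le_lt_trans LNu) ?ltry.
have LNl : ((g * theta `^ (- r) * moment (p + r) - C0 * moment p)%:E <= LN)%E.
  have -> : g * theta `^ (- r) * moment (p + r) - C0 * moment p =
      \int[Q]_w (u w - C0 * `|N w| `^ p).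
    by rewrite RintegralB ?RintegralZl//; exact: integrable_scaleR.
  by rewrite -integrable_RintegralE// LNE; apply: le_integral.
have LN0 : (0 <= LN)%E by exact: nneseries_ge0.
have LZ0 : (0 <= LZ)%E by exact: nneseries_ge0.
have LNf : LN \is a fin_num by rewrite ge0_fin_numE// (le_lt_trans LNu) ?ltry.
have LZf : LZ \is a fin_num.
  by rewrite ge0_fin_numE// (le_lt_trans ZN)// (le_lt_trans (leeD LNu LEb))// -EFinD ltry.
exists (fine LZ); first by rewrite -/LZ fineK.
have NZ' := le_trans NZ (leeD2l _ LEb).
have ZN' := le_trans ZN (leeD2l _ LEb).
rewrite -(fineK LNf) -(fineK LZf) -!EFinD !lee_fin in NZ' ZN'.
rewrite -(fineK LNf) !lee_fin in LNu LNl.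
(* At x = 0 the two bounds of [HA] are - C0 and 0, which forces C0 >= 0. *)
have C0m : 0 <= C0 * moment p.
  have := HA 0 (lexx 0) => -[h1 h2].
  have := le_trans h1 h2; rewrite lee_fin (powR0 (lt0r_neq0 r0)) mulr0 sub0r oppr_le0 => C00.
  by rewrite mulr_ge0//; apply: Rintegral_ge0 => w _; exact: powR_ge0.
exact: normr_sub_sandwich LNl LNu C0m ZN' NZ'.
Qed.

End series_estimate.

(** * Asymptotics of the two series *)

Section identical_laws.
Context d (T : measurableType d) (R : realType) (P : probability T R).
Variables X X' : {RV P >-> R}.
Hypothesis XX' : same_law X' X.

Let law_integral (g : R -> \bar R) :
  (\int[distribution P X']_x g x = \int[distribution P X]_x g x)%E.
Proof. by apply: eq_measure_integral => A mA _; exact: XX'. Qed.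

Lemma same_law_integrable (g : R -> R) : measurable_fun setT g ->
  P.-integrable setT (EFin \o (g \o X)) -> P.-integrable setT (EFin \o (g \o X')).
Proof.
move=> mg /integrableP[_ gi]; apply/integrableP; split.
  by apply/measurable_EFinP; exact: measurableT_comp.
have mg' : measurable_fun setT (fun x => `|(g x)%:E|%E).
  by apply: measurableT_comp => //; exact/measurable_EFinP.
have H (Z : {RV P >-> R}) :
    (\int[P]_w `|(EFin \o (g \o Z)) w| = \int[distribution P Z]_x `|(g x)%:E|)%E.
  by rewrite ge0_integral_distribution.
by rewrite H law_integral -H.
Qed.

Lemma same_law_Rintegral (g : R -> R) : measurable_fun setT g ->
  P.-integrable setT (EFin \o (g \o X)) ->
  \int[P]_w g (X' w) = \int[P]_w g (X w).
Proof.
move=> mg gi; have gi' := same_law_integrable mg gi.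
have mg' : measurable_fun setT (EFin \o g) by exact/measurable_EFinP.
rewrite /Rintegral; congr fine.
have H (Z : {RV P >-> R}) : P.-integrable setT (EFin \o (g \o Z)) ->
    (\int[P]_w (g (Z w))%:E = \int[distribution P Z]_x (EFin \o g) x)%E.
  by move=> iZ; rewrite (integral_distribution (X := Z) mg').
by rewrite !H// law_integral.
Qed.

End identical_laws.

(** * Reduction to unit variance *)

Section rescaling.
Context d (T : measurableType d) (R : realType) (P : probability T R).

Definition rescale (s : R) (X : {RV P >-> R}) (w : T) : R := s * X w.

Lemma measurable_rescale s X : measurable_fun setT (rescale s X).
Proof. exact: measurable_funM. Qed.

HB.instance Definition _ s X := isMeasurableFun.Build _ _ _ _ (rescale s X) (measurable_rescale s X).

Variables (X : {RV P >-> R}) (X_ : nat -> {RV P >-> R}) (sigma q : R).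
Hypothesis iidX : iid_copies X X_.
Hypothesis sigma_gt0 : 0 < sigma.
Hypothesis mean0 : 'E_P[X]%E = 0%E.
Hypothesis variance : 'E_P[fun w => (X w ^+ 2)%R]%E = (sigma ^+ 2)%:E.
Hypothesis moment_q : ('E_P[fun w => (`|X w| `^ q)%R] < +oo)%E.

Definition rescaled : nat -> {RV P >-> R} := fun k => rescale sigma^-1 (X_ k) : {RV P >-> R}.

Lemma rescaled_independent : independent_RVs rescaled.
Proof.
move=> J B uJ mB; have [ind _] := iidX.
have ms : measurable_fun setT (fun x : R => sigma^-1 * x) by exact: measurable_funM.
apply: (ind J (fun k => (fun x : R => sigma^-1 * x) @^-1` B k) uJ) => k.
by rewrite -[X in measurable X]setTI; exact: ms.
Qed.

Definition rescaled_moment : R := \int[P]_w (sigma `^ (- q) * `|X w| `^ q).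

Lemma rescaled_standardized : standardized rescaled q rescaled_moment.
Proof.
have mpow : measurable_fun setT (fun x : R => `|x| `^ q).
  by apply: (measurableT_comp (measurable_powR q)); exact: normr_measurable.
have msq : measurable_fun setT (fun x : R => x ^+ 2) by exact: measurable_funX.
have E2 : (\int[P]_w (X w ^+ 2)%:E = (sigma ^+ 2)%:E)%E by rewrite -variance unlock.
have iX2 : P.-integrable setT (EFin \o (fun w => X w ^+ 2)).
  apply: ge0_integrable_lty => [|w|]; [exact: measurable_funX|exact: sqr_ge0|by rewrite E2 ltry].
have iXq : P.-integrable setT (EFin \o (fun w => `|X w| `^ q)).
  apply: ge0_integrable_lty => [|w|]; last by move: moment_q; rewrite unlock.
  - exact: (measurableT_comp mpow).
  - exact: powR_ge0.
have iX : P.-integrable setT (EFin \o X).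
  apply: (dominated_integrable (g := fun w => 1 + X w ^+ 2)) => //.
    by apply: integrable_addR => //; exact: finite_measure_integrable_cst.
  by move=> w; exact: normr_le1Dsqr.
have E1 : \int[P]_w X w = 0.
  by rewrite /Rintegral; move: mean0; rewrite unlock => ->.
have R2 : \int[P]_w (X w ^+ 2) = sigma ^+ 2 by rewrite /Rintegral E2.
have si0 : 0 <= sigma^-1 by rewrite invr_ge0 ltW.
move=> k; have [_ /(_ k) law] := iidX.
have mid := @measurable_id _ _ (setT : set R).
have j1 := same_law_integrable law mid iX.
have f1 := same_law_Rintegral law mid iX.
have j2 := same_law_integrable law msq iX2.
have f2 := same_law_Rintegral law msq iX2.
have jq := same_law_integrable law mpow iXq.
have fq := same_law_Rintegral law mpow iXq.
have e2 w : rescaled k w ^+ 2 = sigma^-1 ^+ 2 * X_ k w ^+ 2 by exact: exprMn.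
have eq w : `|rescaled k w| `^ q = sigma `^ (- q) * `|X_ k w| `^ q.
  rewrite /= /rescale normrM (ger0_norm si0) powRM// -powR_inv1 ?ltW// -powRrM.
  by rewrite mulN1r.
split.
- exact: integrable_scaleR.
- by rewrite RintegralZl// f1 E1 mulr0.
- under [X in EFin \o X]eq_fun do rewrite e2; exact: integrable_scaleR.
- under eq_Rintegral do rewrite e2.
  by rewrite RintegralZl// f2 R2 exprVn mulVf// gt_eqF// exprn_gt0.
- split.
    under [X in EFin \o X]eq_fun do rewrite eq; exact: integrable_scaleR.
  under eq_Rintegral do rewrite eq.
  by rewrite RintegralZl// fq /rescaled_moment RintegralZl.
Qed.

Lemma rescaled_moment_ge0 : 0 <= rescaled_moment.
Proof. by apply: Rintegral_ge0 => w _; rewrite mulr_ge0 ?powR_ge0. Qed.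

Lemma partial_sum_scaled n w : (0 < n)%N ->
  partial_sum X_ n w = sigma * Num.sqrt n%:R * scaled_sum rescaled n w.
Proof.
move=> n0; have nR : (0 : R) < Num.sqrt n%:R by rewrite sqrtr_gt0 ltr0n.
rewrite /scaled_sum mulrA mulfK ?gt_eqF// /psum mulr_sumr /partial_sum.
rewrite -(big_mkord xpredT (fun k => X_ k w)) /index_iota subn0.
apply: eq_bigr => k _.
by rewrite /= /rescale mulrA divff ?gt_eqF// mul1r.
Qed.

Lemma expectation_partial_sum n p t : (0 < n)%N -> 0 < p ->
  ('E_P[fun w => (`|partial_sum X_ n w| `^ p *
     \1_[set v | `|partial_sum X_ n v| >= sigma * Num.sqrt n%:R * t] w)%R] =
  ((sigma * Num.sqrt n%:R) `^ p)%:E *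
    \int[P]_w (truncated_power p t (scaled_sum rescaled n w))%:E)%E.
Proof.
move=> n0 p0; have c0 : (0 : R) < sigma * Num.sqrt n%:R.
  by rewrite mulr_gt0// sqrtr_gt0 ltr0n.
rewrite unlock -ge0_integralZl//.
- apply: eq_integral => w _; rewrite -EFinM; congr EFin.
  have nS v : `|partial_sum X_ n v| = sigma * Num.sqrt n%:R * `|scaled_sum rescaled n v|.
    by rewrite partial_sum_scaled// normrM (gtr0_norm c0).
  rewrite nS powRM ?(ltW c0)// /truncated_power -mulrA; congr (_ * (_ * _)).
  rewrite indicE /tail; congr (nat_of_bool _)%:R.
  by apply/idP/idP; rewrite inE/= nS ler_pM2l.
- apply/measurable_EFinP; apply: measurableT_comp => //.
  exact: measurable_truncated_power.
- by move=> w _; rewrite lee_fin truncated_power_ge0.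
- by rewrite lee_fin powR_ge0.
Qed.

End rescaling.

Section limits.
Context (R : realType).

Lemma cvge_at_right0_squeeze (F : R -> \bar R) (h : R -> R) :
  h e @[e --> 0^'+] --> (0 : R) ->
  (forall e, 0 < e -> e < 1 -> exists2 f : R, F e = f%:E & `|f| <= h e) ->
  F e @[e --> 0^'+] --> 0%E.
Proof.
move=> h0 Fh.
apply: (@squeeze_cvge _ _ _ _ (fun e => (- h e)%:E) _ (fun e => (h e)%:E)).
- near=> e.
  have e0 : 0 < e by near: e; exact: nbhs_right_gt.
  have e1 : e < 1 by near: e; exact: nbhs_right_lt.
  by have [f -> fh] := Fh e e0 e1; rewrite !lee_fin -ler_norml.
- rewrite -[X in _ --> X]/((0 : R)%:E) -[X in _ --> X%:E]oppr0.
  by apply: cvg_EFin; [apply: nearW => e|exact: cvgN].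
- by rewrite -[X in _ --> X]/((0 : R)%:E); apply: cvg_EFin; [apply: nearW => e|].
Unshelve. all: by end_near. Qed.

Lemma cvg_log_powR (K delta : R) : 0 < delta ->
  K * ln (1 / e) `^ (- delta) @[e --> 0^'+] --> (0 : R).
Proof.
move=> d0; rewrite -[X in _ --> X](mulr0 K); apply: cvgM; first exact: cvg_cst.
apply/cvgr0Pnorm_le => eps eps0.
(* V^(-delta) = eps, and ln(1/e) >= V as soon as e <= exp(-V). *)
pose V : R := (eps^-1) `^ (delta^-1).
have V0 : 0 < V by apply: powR_gt0; rewrite invr_gt0.
near=> e.
have e0 : 0 < e by near: e; exact: nbhs_right_gt.
have eV : e <= expR (- V) by near: e; apply: nbhs_right_le; exact: expR_gt0.
have lV : V <= ln (1 / e).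
  rewrite div1r lnV ?posrE// lerNr -[X in _ <= X]expRK ler_ln ?posrE ?expR_gt0//.
rewrite ger0_norm ?powR_ge0// powRN invf_ple ?posrE ?powR_gt0//; last exact: lt_le_trans lV.
have -> : eps^-1 = V `^ delta by rewrite /V -powRrM mulVf ?gt_eqF// powRr1// invr_ge0 ltW.
by apply: le_powRl => //; exact: ltW.
Unshelve. all: by end_near. Qed.

End limits.

Section asymptotics.
Context (R : realType) d (T : measurableType d) (P : probability T R).
Variables (X : {RV P >-> R}) (X_ : nat -> {RV P >-> R}).
Context d' (T' : measurableType d') (Q : probability T' R).
Variables (N : {RV Q >-> R}) (sigma q : R).
Hypothesis iidX : iid_copies X X_.
Hypothesis normalN : standard_normal N.
Hypothesis sigma_gt0 : 0 < sigma.
Hypothesis mean0 : 'E_P[X]%E = 0%E.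
Hypothesis variance : 'E_P[fun w => (X w ^+ 2)%R]%E = (sigma ^+ 2)%:E.
Hypothesis q_range : 2 < q <= 3.
Hypothesis moment_q : ('E_P[fun w => (`|X w| `^ q)%R] < +oo)%E.
Let a := q - 2.
Let Y := rescaled X_ sigma.
Let indY := rescaled_independent sigma iidX.
Let stdY := rescaled_standardized iidX sigma_gt0 mean0 variance moment_q.
Let M0 := rescaled_moment_ge0 X sigma q.

Let eseries_from (n0 : nat) (f g : nat -> \bar R) :
  (forall n, (n0 <= n)%N -> f n = g n) -> (forall n, (n < n0)%N -> g n = 0%E) ->
  (\sum_(n0 <= n <oo) f n = \sum_(n <oo) g n)%E.
Proof.
move=> fg g0; rewrite eseries_cond eseries_mkcond; apply: eq_eseriesr => n _ /=.
by case: leqP => [/fg //|/g0 ->].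
Qed.

(** At theta = eps / sigma, multiplication by eps^b with b = 2 - p makes the counting error O(eps^b)
    and turns theta^(-(b - kappa)) into a multiple of eps^kappa. *)
Lemma lambda1_estimate p kappa : 0 < p < 2 -> 0 < kappa -> kappa < a / (1 + a) ->
  kappa < 2 - p -> exists2 C : R, 0 <= C & forall eps, 0 < eps -> exists2 L : R,
  lambda1 X_ eps p = L%:E &
  `|eps `^ (2 - p) * L - 2 * sigma ^+ 2 / (2 - p)| <= C * (eps `^ (2 - p) + eps `^ kappa).
Proof.
move=> /andP[p0 p2] k0 k1 k2; have s0 := sigma_gt0; have /andP[q2 q3] := q_range.
pose b := 2 - p; have b0 : 0 < b by rewrite /b; lra.
(* Standardizing |S_n|^p releases n^(p/2), so the coefficients are n^(-p/2) = n^(s - 1); the rate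
   n^(-kappa/2) lowers s to s'. *)
pose s := b / 2; have ss : 0 < s <= 1 by rewrite /s /b; apply/andP; split; lra.
pose s' := (b - kappa) / 2; have ss' : 0 < s' <= 1 by rewrite /s' /b; apply/andP; split; lra.
pose c n : R := if (0 < n)%N then n%:R `^ (s - 1) else 0.
pose lev n : R := Num.sqrt n%:R.
have c0 n : 0 <= c n by rewrite /c; case: ifP; rewrite ?powR_ge0.
have lev0 n : 0 <= lev n by exact: sqrtr_ge0.
have levE n x : 0 <= x -> (lev n <= x) = (n%:R <= x ^+ 2).
  move=> x0; rewrite /lev -[in LHS](ger0_norm x0) -sqrtr_sqr ler_sqrt ?sqr_ge0//.
have sqE x r : 0 <= x -> (x ^+ 2) `^ r = x `^ (2 * r).
  by move=> x0; rewrite -powR_mulrn// -powRrM.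
have s0' : 0 < s by have /andP[] := ss.
have s0'' : 0 < s' by have /andP[] := ss'.
have HA x : 0 <= x ->
    ((s^-1 * x `^ b - s^-1)%:E <= \sum_(n <oo) (c n * (lev n <= x)%R%:R)%:E)%E /\
    (\sum_(n <oo) (c n * (lev n <= x)%R%:R)%:E <= (s^-1 * x `^ b)%:E)%E.
  move=> x0; have [h1 h2] := power_counting_sum ss (sqr_ge0 x).
  have E : (x ^+ 2) `^ s / s = s^-1 * x `^ b.
    by rewrite sqE// mulrC; congr (_ * _ `^ _); rewrite /s; field.
  rewrite E in h1 h2.
  by split; [apply: (le_trans h1)|apply: (le_trans _ h2)]; apply: lee_nneseries => n *;
    rewrite ?lee_fin ?levE// mulr_ge0//; case: ifP; rewrite ?powR_ge0.
have HD x : 0 < x ->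
    (\sum_(n <oo) (c n * n%:R `^ (- (kappa / 2)) * (lev n <= x)%R%:R)%:E <=
      (s'^-1 * x `^ (b - kappa))%:E)%E.
  move=> x0; have [_ h2] := power_counting_sum ss' (sqr_ge0 x).
  have E : (x ^+ 2) `^ s' / s' = s'^-1 * x `^ (b - kappa).
    by rewrite sqE ?ltW// mulrC; congr (_ * _ `^ _); rewrite /s'; field.
  rewrite E in h2; apply: (le_trans _ h2); apply: lee_nneseries => n *.
    by rewrite lee_fin !mulr_ge0 ?powR_ge0.
  rewrite lee_fin (levE _ _ (ltW x0)) /c; case: (boolP (0 < n)%N) => n0 /=; last by rewrite !mul0r.
  rewrite -powRD; last by rewrite pnatr_eq0 -lt0n n0 implybT.
  by rewrite le_eqVlt; apply/orP; left; apply/eqP; congr (_ `^ _ * _); rewrite /s /s'; field.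
have ptq : p + (b - kappa) < q by rewrite /b; lra.
have si0 : 0 <= s^-1 by rewrite invr_ge0 ltW.
have si0' : 0 <= s'^-1 by rewrite invr_ge0 ltW.
have c00 : c 0%N = 0 by [].
have [C C0 HC] := series_estimate indY stdY q_range M0 normalN k0 k1 p0 b0 si0 si0' ptq
  c0 c00 lev0 HA HD.
pose m := \int[Q]_w (`|N w| `^ p).
have m0 : 0 <= m by apply: Rintegral_ge0 => w _; exact: powR_ge0.
have sp0 : 0 <= sigma `^ p by exact: powR_ge0.
pose C1 := sigma `^ p * (s^-1 * m).
pose C2 := sigma `^ p * (C * sigma `^ (b - kappa)).
have C10 : 0 <= C1 by rewrite !mulr_ge0.
have C20 : 0 <= C2 by rewrite !mulr_ge0 ?powR_ge0.
exists (C1 + C2); first exact: addr_ge0.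
move=> eps e0; pose theta := eps / sigma; have t0 : 0 < theta by rewrite divr_gt0.
have [L EL HL] := HC theta t0.
(* Since p + b = 2, the leading moment is E N^2 whatever p is. *)
have m2 : \int[Q]_w (`|N w| `^ (p + b)) = 1.
  have -> : p + b = 2 by rewrite /b; ring.
  exact: (normal_second_moment indY stdY q_range M0 normalN).
rewrite m2 mulr1 -/m in HL.
exists (sigma `^ p * L).
  rewrite /lambda1 EFinM -EL -nneseriesZl; last first.
    by move=> n _; rewrite mule_ge0 ?lee_fin// integral_ge0// => w _; rewrite lee_fin truncated_power_ge0.
  apply: eseries_from => [n n1|n]; last by rewrite ltnS leqn0 => /eqP ->; rewrite mul0e mule0.
  have nR : (0 : R) < n%:R by rewrite ltr0n.
  have sn0 : (0 : R) < Num.sqrt n%:R by rewrite sqrtr_gt0.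
  have Et : eps * n%:R = sigma * Num.sqrt n%:R * (theta * lev n).
    rewrite -[in LHS](sqr_sqrtr (ltW nR)) /theta /lev; field.
    by rewrite gt_eqF.
  rewrite Et (expectation_partial_sum X_ sigma_gt0)// muleA -EFinM muleA -EFinM; congr (_%:E * _)%E.
  rewrite powRM ?(ltW s0) ?(ltW sn0)// /c n1 -powR12_sqrt ?(ltW nR)// -powRrM -powRN.
  rewrite mulrCA -powRD; last by rewrite (gt_eqF nR) implybT.
  by congr (_ * _ `^ _); rewrite /s /b; field.
have e1 : eps `^ b * (sigma `^ p * (s^-1 * theta `^ (- b))) = 2 * sigma ^+ 2 / (2 - p).
  have sb : sigma `^ p * sigma `^ b = sigma ^+ 2.
    rewrite -powRD; last by rewrite (gt_eqF s0) implybT.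
    by rewrite -powR_mulrn ?(ltW s0)//; congr (_ `^ _); rewrite /b; ring.
  have tb : theta `^ (- b) = eps `^ (- b) * sigma `^ b.
    rewrite /theta powRM ?invr_ge0 ?(ltW e0) ?(ltW s0)// -[sigma^-1]powR_inv1 ?(ltW s0)//.
    by rewrite -powRrM mulN1r opprK.
  have eb : eps `^ b * eps `^ (- b) = 1 by rewrite powRN divff// gt_eqF// powR_gt0.
  rewrite tb -sb -/b.
  transitivity (eps `^ b * eps `^ (- b) * (s^-1 * (sigma `^ p * sigma `^ b))); first by ring.
  by rewrite eb /s; field; rewrite gt_eqF.
have tk : eps `^ b * theta `^ (- (b - kappa)) = sigma `^ (b - kappa) * eps `^ kappa.
  rewrite /theta powRM ?invr_ge0 ?(ltW e0) ?(ltW s0)// -[sigma^-1]powR_inv1 ?(ltW s0)//.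
  rewrite -powRrM mulN1r opprK mulrA -powRD; last by rewrite (gt_eqF e0) implybT.
  by rewrite mulrC; congr (_ * _ `^ _); ring.
rewrite -e1 -/b.
have -> : eps `^ b * (sigma `^ p * L) - eps `^ b * (sigma `^ p * (s^-1 * theta `^ (- b))) =
    eps `^ b * (sigma `^ p * (L - s^-1 * theta `^ (- b))) by ring.
rewrite normrM (ger0_norm (powR_ge0 _ _)) normrM (ger0_norm sp0).
have eb0 : 0 <= eps `^ b by exact: powR_ge0.
have ek0 : 0 <= eps `^ kappa by exact: powR_ge0.
apply: (le_trans (ler_wpM2l eb0 (ler_wpM2l sp0 HL))).
have -> : eps `^ b * (sigma `^ p * (s^-1 * m + C * theta `^ (- (b - kappa)))) =
    C1 * eps `^ b + sigma `^ p * C * (eps `^ b * theta `^ (- (b - kappa))) by rewrite /C1; ring.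
rewrite tk.
have -> : sigma `^ p * C * (sigma `^ (b - kappa) * eps `^ kappa) = C2 * eps `^ kappa.
  by rewrite /C2; ring.
have := mulr_ge0 C10 ek0; have := mulr_ge0 C20 eb0; lra.
Qed.

(** Any positive kappa below a / (1 + a) works: the factor n^(-kappa/2) makes the coefficients
    summable, so the error counting sum is bounded and tau = 0. *)
Lemma lambda2_estimate delta : 0 < delta <= 1 ->
  exists2 C : R, 0 <= C & forall eps, 0 < eps -> exists2 L : R,
  lambda2 X_ eps delta = L%:E &
  `|eps `^ (2 * delta) * L -
    sigma `^ (2 * delta + 2) / delta * \int[Q]_w (`|N w| `^ (2 * delta + 2))| <=
  C * eps `^ (2 * delta).
Proof.
move=> dd; have /andP[d0 d1] := dd; have s0 := sigma_gt0; have /andP[q2 q3] := q_range.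
pose kappa := a / (1 + a) / 2.
have k00 : 0 < a / (1 + a) by exact: exponent_gt0 q_range.
have k0 : 0 < kappa by rewrite divr_gt0.
have k1 : kappa < a / (1 + a) by rewrite /kappa; lra.
pose c n : R := if (1 < n)%N then ln n%:R `^ (delta - 1) / n%:R else 0.
pose lev n : R := Num.sqrt (ln n%:R).
have c0 n : 0 <= c n by rewrite /c; case: ifP => // _; rewrite divr_ge0 ?powR_ge0.
have lev0 n : 0 <= lev n by exact: sqrtr_ge0.
have lnn n : (1 < n)%N -> 0 < ln n%:R :> R by move=> n1; rewrite ln_gt0// ltr1n.
have levE n x : (1 < n)%N -> 0 <= x -> (lev n <= x) = (n%:R <= expR (x ^+ 2)).
  move=> n1 x0; have nR : (0 : R) < n%:R by rewrite ltr0n ltnW.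
  rewrite /lev -[in LHS](ger0_norm x0) -sqrtr_sqr ler_sqrt ?sqr_ge0//.
  by rewrite -[in RHS](lnK (_ : n%:R \is Num.pos)) ?posrE// ler_expR.
have HA x : 0 <= x ->
    ((delta^-1 * x `^ (2 * delta) - ln 2 `^ delta / delta)%:E <=
      \sum_(n <oo) (c n * (lev n <= x)%R%:R)%:E)%E /\
    (\sum_(n <oo) (c n * (lev n <= x)%R%:R)%:E <= (delta^-1 * x `^ (2 * delta))%:E)%E.
  move=> x0; have v1 : 1 <= expR (x ^+ 2) by rewrite -[X in X <= _]expR0 ler_expR sqr_ge0.
  have [h1 h2] := log_counting_sum dd v1.
  have E : ln (expR (x ^+ 2)) `^ delta / delta = delta^-1 * x `^ (2 * delta).
    by rewrite expRK -powR_mulrn// -powRrM mulrC.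
  rewrite E in h1 h2.
  have F n : (c n * (lev n <= x)%R%:R)%:E = (c n * (n%:R <= expR (x ^+ 2))%R%:R)%:E.
    rewrite /c; case: (boolP (1 < n)%N) => n1; last by rewrite !mul0r.
    by rewrite levE.
  by under eq_eseriesr do rewrite F.
(* As delta <= 1, (ln n)^(delta - 1) <= (ln 2)^(delta - 1) for n >= 2, and the sum of n^(-1 -
   kappa/2) over n >= 2 is at most 2 / kappa. *)
pose D := ln 2 `^ (delta - 1) * (kappa / 2)^-1.
have D0 : 0 <= D by rewrite mulr_ge0 ?powR_ge0// invr_ge0 divr_ge0// ltW.
have HD x : 0 < x ->
    (\sum_(n <oo) (c n * n%:R `^ (- (kappa / 2)) * (lev n <= x)%R%:R)%:E <= (D * x `^ 0)%:E)%E.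
  move=> x0; rewrite powRr0 mulr1.
  have k20 : 0 < kappa / 2 by rewrite divr_gt0.
  rewrite /D EFinM.
  apply: (le_trans _ (lee_wpmul2l _ (negative_power_sum k20))); last by rewrite lee_fin powR_ge0.
  rewrite -nneseriesZl; last by move=> n _; rewrite lee_fin; case: ifP; rewrite ?powR_ge0.
  apply: lee_nneseries => n *; first by rewrite lee_fin !mulr_ge0 ?powR_ge0.
  rewrite -EFinM lee_fin /c; case: (boolP (1 < n)%N) => n1 /=; last by rewrite !mul0r mulr0.
  have nR : (0 : R) < n%:R by rewrite ltr0n ltnW.
  have l2 : 0 < ln 2 :> R by rewrite ln_gt0// ltr1n.
  have ll : ln n%:R `^ (delta - 1) <= ln 2 `^ (delta - 1) :> R.
    rewrite -(opprB 1 delta) !powRN lef_pV2 ?posrE ?powR_gt0 ?lnn//.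
    apply: le_powRl; [lra|exact: ltW|].
    by rewrite ler_ln ?posrE// ler_nat.
  have -> : n%:R `^ (- (kappa / 2) - 1) = n%:R^-1 * n%:R `^ (- (kappa / 2)) :> R.
    rewrite -[n%:R^-1]powR_inv1 ?(ltW nR)// -powRD; last by rewrite (gt_eqF nR) implybT.
    by congr (_ `^ _); ring.
  have w0 : 0 <= n%:R^-1 * n%:R `^ (- (kappa / 2)) :> R.
    by rewrite mulr_ge0 ?powR_ge0// invr_ge0 ltW.
  rewrite -[ln n%:R `^ _ / _ * _]mulrA.
  apply: (le_trans _ (ler_wpM2r w0 ll)).
  by rewrite ler_piMr ?lern1 ?leq_b1// mulr_ge0// powR_ge0.
have ptq : 2 + 0 < q by rewrite addr0.
have r0 : 0 < 2 * delta by rewrite mulr_gt0.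
have di0 : 0 <= delta^-1 by rewrite invr_ge0 ltW.
have c00 : c 0%N = 0 by [].
have [C C0 HC] := series_estimate indY stdY q_range M0 normalN k0 k1 (ltr0n R 2) r0 di0 D0 ptq
  c0 c00 lev0 HA HD.
rewrite (normal_second_moment indY stdY q_range M0 normalN) mulr1 in HC.
pose m := \int[Q]_w (`|N w| `^ (2 * delta + 2)).
pose C1 := ln 2 `^ delta / delta + C.
have C10 : 0 <= C1 by rewrite addr_ge0// divr_ge0 ?powR_ge0// ltW.
exists (sigma ^+ 2 * C1); first by rewrite mulr_ge0 ?sqr_ge0.
move=> eps e0; pose theta := eps / sigma; have t0 : 0 < theta by rewrite divr_gt0.
have [L EL HL] := HC theta t0.
rewrite [2 + 2 * delta]addrC -/m oppr0 powRr0 mulr1 in HL.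
exists (sigma ^+ 2 * L).
  rewrite /lambda2 EFinM -EL -nneseriesZl; last first.
    by move=> n _; rewrite mule_ge0 ?lee_fin// integral_ge0// => w _; rewrite lee_fin truncated_power_ge0.
  apply: eseries_from => [n n1|n]; last first.
    by rewrite ltnS => n1; rewrite /c ltnNge n1 mul0e mule0.
  have nR : (0 : R) < n%:R by rewrite ltr0n ltnW.
  have sn0 : (0 : R) < Num.sqrt n%:R by rewrite sqrtr_gt0.
  have Et : eps * Num.sqrt (n%:R * ln n%:R) = sigma * Num.sqrt n%:R * (theta * lev n).
    rewrite sqrtrM ?(ltW nR)// /theta /lev; field.
    by rewrite gt_eqF.
  have -> : (fun w => partial_sum X_ n w ^+ 2 *
       \1_[set v | `|partial_sum X_ n v| >= eps * Num.sqrt (n%:R * ln n%:R)] w) =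
     (fun w => `|partial_sum X_ n w| `^ 2 *
       \1_[set v | `|partial_sum X_ n v| >= eps * Num.sqrt (n%:R * ln n%:R)] w).
    apply/funext => w; congr (_ * _).
    by rewrite -[2]/(2%:R) powR_mulrn// real_normK ?num_real.
  rewrite Et (expectation_partial_sum X_ sigma_gt0)//; last by exact: ltnW.
  rewrite muleA -EFinM muleA -EFinM; congr (_%:E * _)%E.
  rewrite /c n1 powR_mulrn ?mulr_ge0 ?(ltW s0) ?(ltW sn0)//.
  rewrite exprMn sqr_sqrtr ?(ltW nR)//; field.
  by rewrite gt_eqF.
have e1 : sigma `^ (2 * delta + 2) / delta * m =
    eps `^ (2 * delta) * (sigma ^+ 2 * (delta^-1 * theta `^ (- (2 * delta)) * m)).
  have sb : sigma `^ (2 * delta + 2) = sigma ^+ 2 * sigma `^ (2 * delta).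
    rewrite powRD; last by rewrite (gt_eqF s0) implybT.
    by rewrite powR_mulrn ?(ltW s0)// mulrC.
  have tb : theta `^ (- (2 * delta)) = eps `^ (- (2 * delta)) * sigma `^ (2 * delta).
    rewrite /theta powRM ?invr_ge0 ?(ltW e0) ?(ltW s0)// -[sigma^-1]powR_inv1 ?(ltW s0)//.
    by rewrite -powRrM mulN1r opprK.
  have eb : eps `^ (2 * delta) * eps `^ (- (2 * delta)) = 1.
    by rewrite powRN divff// gt_eqF// powR_gt0.
  rewrite tb sb.
  transitivity (eps `^ (2 * delta) * eps `^ (- (2 * delta)) *
    (sigma ^+ 2 * sigma `^ (2 * delta) / delta * m)); first by rewrite eb mul1r.
  by ring.
rewrite -/m e1 -mulrBr -mulrBr normrM (ger0_norm (powR_ge0 _ _)) normrM (ger0_norm (sqr_ge0 _)).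
by rewrite mulrC ler_wpM2r ?powR_ge0// ler_wpM2l ?sqr_ge0.
Qed.

End asymptotics.

Theorem theorem2p1 (R : realType)
    (d : measure_display) (T : measurableType d) (P : probability T R)
    (X : {RV P >-> R}) (X_ : nat -> {RV P >-> R})
    (d' : measure_display) (T' : measurableType d') (Q : probability T' R)
    (N : {RV Q >-> R}) (sigma q : R)
    (iidX : iid_copies X X_)
    (normalN : standard_normal N)
    (sigma_gt0 : 0 < sigma)
    (mean0 : 'E_P[X]%E = 0%E)
    (variance : 'E_P[fun w => (X w ^+ 2)%R]%E = (sigma ^+ 2)%:E)
    (q_range : 2 < q <= 3)
    (moment_q : ('E_P[fun w => (`|X w| `^ q)%R] < +oo)%E) :
  (forall p : R, 0 < p < 2 ->
     let gamma := (q - p) / (2 * q - 2 - p) in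
     ((eps `^ ((gamma - 1) * (2 - p)))%:E *
       ((eps `^ (2 - p))%:E * lambda1 X_ eps p
         - (2 * sigma ^+ 2 / (2 - p))%:E))%E @[eps --> 0^'+] --> 0%E)
  /\
  (forall delta : R, 0 < delta <= 1 ->
     ((ln (1 / eps) `^ (- delta) * eps `^ (- (2 * delta)))%:E *
       ((eps `^ (2 * delta))%:E * lambda2 X_ eps delta
         - (sigma `^ (2 * delta + 2) / delta)%:E *
           'E_Q[fun w => (`|N w| `^ (2 * delta + 2))%R]))%E
       @[eps --> 0^'+] --> 0%E).
Proof.
have /andP[q2 q3] := q_range.
split=> [p p02 gamma|delta d01].
  have /andP[p0 p2] := p02.
  pose a := q - 2; pose b := 2 - p.
  (* The opposite of the normalizing exponent (gamma - 1)(2 - p). *)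
  pose rho := a * b / (2 * a + b).
  have a0 : 0 < a by rewrite /a; lra.
  have b0 : 0 < b by rewrite /b; lra.
  have ab0 : 0 < 2 * a + b by lra.
  have a10 : 0 < 1 + a by lra.
  have gE : (gamma - 1) * (2 - p) = - rho.
    rewrite /gamma /rho /a /b; field.
    by rewrite gt_eqF.
  have rb : rho < b.
    by rewrite /rho ltr_pdivrMr// mulrC ltr_pM2l//; lra.
  (* Clearing denominators leaves a b < 2 a, that is 0 < a p. *)
  have ra : rho < a / (1 + a).
    rewrite /rho -mulrA ltr_pM2l// ltr_pdivrMr// mulrC ltr_pdivlMr//.
    have : 0 < a * p by rewrite mulr_gt0.
    by rewrite /b; lra.
  have r0 : 0 < rho by rewrite divr_gt0// mulr_gt0.
  (* The midpoint between rho and the smaller upper limit: a / (1 + a) comes from the normal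
     approximation, and b keeps the exponent b - kappa of the error counting sum positive. *)
  pose kappa := (rho + Num.min b (a / (1 + a))) / 2.
  have [kr kb ka] : [/\ rho < kappa, kappa < b & kappa < a / (1 + a)].
    rewrite /kappa; have [h|h] := leP b (a / (1 + a)); split; lra.
  have k0 : 0 < kappa by lra.
  have [C C0 HC] := lambda1_estimate iidX normalN sigma_gt0 mean0 variance q_range moment_q
    p02 k0 ka kb.
  apply: (cvge_at_right0_squeeze
      (h := fun e => C * e `^ (b - rho) + C * e `^ (kappa - rho))).
    rewrite -[X in _ --> X]addr0; apply: cvgD.
      by rewrite -[X in _ --> X](mulr0 C); apply: cvgM;
        [exact: cvg_cst|apply: powR_cvg0; lra].
    by rewrite -[X in _ --> X](mulr0 C); apply: cvgM;
      [exact: cvg_cst|apply: powR_cvg0; lra].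
  move=> e e0 _; have [L -> HL] := HC e e0; rewrite gE.
  exists (e `^ (- rho) * (e `^ (2 - p) * L - 2 * sigma ^+ 2 / (2 - p))) => //.
  rewrite normrM (ger0_norm (powR_ge0 _ _)).
  apply: (le_trans (ler_wpM2l (powR_ge0 e (- rho)) HL)).
  rewrite ![_ - rho]addrC !powRD; try by rewrite (gt_eqF e0) implybT.
  by rewrite le_eqVlt; apply/orP; left; apply/eqP; rewrite /b; ring.
have /andP[d0 d1] := d01.
have [C C0 HC] := lambda2_estimate iidX normalN sigma_gt0 mean0 variance q_range moment_q d01.
have m0 : 0 < 2 * delta + 2 by lra.
have EN : ('E_Q[fun w => (`|N w| `^ (2 * delta + 2))%R] = (\int[Q]_w (`|N w| `^ (2 * delta + 2))%R)%R%:E)%E.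
  by rewrite unlock integrable_RintegralE//; exact: normal_moment_integrable.
apply: (cvge_at_right0_squeeze (h := fun e => C * ln (1 / e) `^ (- delta))).
  exact: cvg_log_powR.
move=> e e0 _; have [L -> HL] := HC e e0; rewrite EN.
set K := _ / delta * _ in HL.
exists (ln (1 / e) `^ (- delta) * e `^ (- (2 * delta)) * (e `^ (2 * delta) * L - K)) => //.
rewrite normrM ger0_norm ?mulr_ge0 ?powR_ge0//.
have w0 : 0 <= ln (1 / e) `^ (- delta) * e `^ (- (2 * delta)) by rewrite mulr_ge0 ?powR_ge0.
apply: (le_trans (ler_wpM2l w0 HL)).
(* The powers of eps cancel exactly, so the logarithm alone drives the convergence. *)
have eb : e `^ (- (2 * delta)) * e `^ (2 * delta) = 1.
  by rewrite powRN mulVf// gt_eqF// powR_gt0.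
rewrite le_eqVlt; apply/orP; left; apply/eqP.
transitivity (e `^ (- (2 * delta)) * e `^ (2 * delta) * (C * ln (1 / e) `^ (- delta))); first by ring.
by rewrite eb mul1r.
Qed.
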